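(* Consider the linear regression model with unknown noise variance described in the context, and assume that the $X_{ij}$, $1\le i\le n$, $1\le j\le p$, are i.i.d. standard Gaussian. Let $a>0$ be a constant and let $\psi^{HC}$ be the Higher Criticism test defined in the context. (i) The type I error satisfies $\alpha^{un}(\psi^{HC})=o(1)$. (ii) Let $k=p^{1-\beta}$ with $\beta\in(1/2,1)$ and assume $k\log(p)=o(n)$. Let $r_{np}=x_{np}\sqrt{k\log(p)/n}$ be such that $\liminf(x_{np}-\varphi(\beta))>0$, where $$\varphi(\beta)=\begin{cases}\sqrt{2\beta-1},&1/2<\beta\le 3/4,\\ \sqrt2\,(1-\sqrt{1-\beta}),&3/4<\beta<1.\end{cases}$$ Then $\beta^{un}(\psi^{HC},\Theta_k(r_{np}))\to 0$.
   Context: All limits and $o$ symbols are taken as $n\to\infty$ and $p\to\infty$ jointly. Model: one observes $Z=(X,Y)$ with $X=(X_{ij})_{1\le i\le n,1\le j\le p}$, $Y=(Y_1,\dots,Y_n)$ and $Y_i=\sum_{j=1}^p\theta_jX_{ij}+\xi_i$, where $\theta\in\mathbb{R}^p$ and $\sigma>0$ are unknown, the $\xi_i$ are i.i.d. $\mathcal{N}(0,\sigma^2)$ and independent of $X$. $E_{\theta,\sigma}$ is the expectation under the law of $Z$ with coefficient vector $\theta$ and noise standard deviation $\sigma$. $X_j\in\mathbb{R}^n$ is the $j$th column of $X$, $(\cdot,\cdot)$ and $\|\cdot\|$ the Euclidean inner product and norm. Higher Criticism test: for $1\le i\le p$ put $y_i=(Y,X_i)/\|Y\|$ and $q_i=P(|\mathcal{N}(0,1)|>|y_i|)$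 (the probability that a standard Gaussian exceeds $|y_i|$ in absolute value, evaluated at the observed $y_i$). Let $q_{(1)}\le\dots\le q_{(p)}$ be the $q_i$ sorted in increasing order and $$t_{HC}=\max_{i:\ q_{(i)}\le 1/2}\frac{\sqrt p\,(i/p-q_{(i)})}{\sqrt{q_{(i)}(1-q_{(i)})}}.$$ The test $\psi^{HC}$ is the indicator of $\{t_{HC}>(1+a)\sqrt{2\log\log p}\}$ (with $\psi^{HC}=0$ if no $q_{(i)}\le1/2$). $\mathbb{R}^p_k$ is the set of $\theta\in\mathbb{R}^p$ with at most $k$ nonzero coordinates; $\Theta_k(r)=\{\theta\in\mathbb{R}^p_k:\|\theta\|\ge r\}$. For a test $\psi$ (measurable function of $Z$ with values in $[0,1]$), $$\alpha^{un}(\psi)=\sup_{\sigma>0}E_{0,\sigma}(\psi),\qquad \beta^{un}(\psi,\Theta)=\sup_{\theta\in\Theta,\ \sigma>0}E_{\theta\sigma,\sigma}(1-\psi),$$ where $\theta\sigma$ is the vector $\theta$ multiplied by the scalar $\sigma$. *)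

(* Defs.v *)
From HB Require Import structures.
From mathcomp Require Import all_boot all_order all_algebra.
From mathcomp Require Import all_classical all_reals all_analysis.

Set Implicit Arguments.
Unset Strict Implicit.
Unset Printing Implicit Defensive.

Import Order.TTheory GRing.Theory Num.Theory.
Import numFieldNormedType.Exports.

Local Open Scope classical_set_scope.
Local Open Scope ring_scope.

Definition mutually_independent (d : measure_display) (T : measurableType d)
    (R : realType) (P : probability T R) (I : finType) (X : I -> T -> R) : Prop :=
  forall (J : {set I}) (A : I -> set R), (forall i, measurable (A i)) ->
    P (\bigcap_(i in [set` J]) (X i @^-1` A i)) =
    (\prod_(i in J) P (X i @^-1` A i))%E.

(* The parameter s is the standard deviation, as in [normal_prob]. *)
Definition has_normal_law (d : measure_display) (T : measurableType d)
    (R : realType) (P : probability T R) (X : T -> R) (m s : R) : Prop :=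
  forall A : set R, measurable A -> P (X @^-1` A) = normal_prob m s A.

Definition residual (d : measure_display) (T : measurableType d) (R : realType)
    (n p : nat) (X : 'I_n -> 'I_p -> T -> R) (Y : 'I_n -> T -> R)
    (theta : 'rV[R]_p) (i : 'I_n) (w : T) : R :=
  Y i w - \sum_(j < p) theta 0 j * X i j w.

(* Joint family of the entries of the design and of the noise. Its mutual
   independence says that the X_ij are independent, that the xi_i are
   independent, and that xi is independent of X. *)
Definition design_and_noise (d : measure_display) (T : measurableType d)
    (R : realType) (n p : nat) (X : 'I_n -> 'I_p -> T -> R) (Y : 'I_n -> T -> R)
    (theta : 'rV[R]_p) (u : ('I_n * 'I_p) + 'I_n) : T -> R :=
  match u with
  | inl ij => X ij.1 ij.2
  | inr i => residual X Y theta i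
  end.

(* The statistical experiment: one pair of observations (X, Y) together with
   the family of probabilities indexed by (theta, sigma). Nothing is required
   of [reg_law theta sigma] when sigma <= 0. *)
Record gaussian_regression (R : realType) (n p : nat) := GaussianRegression {
  reg_disp : measure_display ;
  reg_space : measurableType reg_disp ;
  reg_X : 'I_n -> 'I_p -> {mfun reg_space >-> R} ;
  reg_Y : 'I_n -> {mfun reg_space >-> R} ;
  reg_law : 'rV[R]_p -> R -> probability reg_space R ;
  reg_design : forall (theta : 'rV[R]_p) (sigma : R), 0 < sigma ->
    forall i j, has_normal_law (reg_law theta sigma) (reg_X i j) 0 1 ;
  reg_noise : forall (theta : 'rV[R]_p) (sigma : R), 0 < sigma ->
    forall i, has_normal_law (reg_law theta sigma)
      (residual (fun i j => reg_X i j : _ -> R) (fun i => reg_Y i : _ -> R)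
         theta i) 0 sigma ;
  reg_indep : forall (theta : 'rV[R]_p) (sigma : R), 0 < sigma ->
    mutually_independent (reg_law theta sigma)
      (design_and_noise (fun i j => reg_X i j : _ -> R)
         (fun i => reg_Y i : _ -> R) theta)
}.

(* Measurability and values in [0, 1] are not part of the type: the errors are
   only taken at [psi_HC], which has both properties. *)
Definition test_fun (R : realType) (n p : nat) : Type :=
  'M[R]_(n, p) -> 'cV[R]_n -> R.

Definition test_at (R : realType) (n p : nat) (M : gaussian_regression R n p)
    (psi : test_fun R n p) (w : reg_space M) : R :=
  psi (\matrix_(i, j) reg_X M i j w) (\col_i reg_Y M i w).

Definition alpha_un (R : realType) (n p : nat) (M : gaussian_regression R n p)
    (psi : test_fun R n p) : \bar R :=
  ereal_sup [set ('E_(reg_law M 0 sigma)[test_at psi])%E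
            | sigma in [set sigma : R | 0 < sigma]].

Definition beta_un (R : realType) (n p : nat) (M : gaussian_regression R n p)
    (psi : test_fun R n p) (Theta : set 'rV[R]_p) : \bar R :=
  ereal_sup [set ('E_(reg_law M (ts.2 *: ts.1) ts.2)[(fun w => 1 - test_at psi w)%R])%E
            | ts in [set ts : 'rV[R]_p * R | Theta ts.1 /\ 0 < ts.2]].

(* The library norm `|theta| on row vectors is the sup norm. *)
Definition l2norm (R : realType) (p : nat) (theta : 'rV[R]_p) : R :=
  Num.sqrt (\sum_(j < p) theta 0 j ^+ 2).

(* k is a real number, so that k = p^(1-beta) needs no rounding. *)
Definition sparse (R : realType) (p : nat) (k : R) : set 'rV[R]_p :=
  [set theta : 'rV[R]_p | #|[pred j : 'I_p | theta 0 j != 0]|%:R <= k].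

Definition Theta_sep (R : realType) (p : nat) (k r : R) : set 'rV[R]_p :=
  [set theta : 'rV[R]_p | sparse k theta /\ r <= l2norm theta].

Section higher_criticism.
Context (R : realType) (n p : nat) (X : 'M[R]_(n, p)) (Y : 'cV[R]_n).

Definition HC_y (i : 'I_p) : R :=
  (\sum_(l < n) Y l 0 * X l i) / l2norm Y^T.

Definition HC_q (i : 'I_p) : R :=
  fine (normal_prob 0 1 [set z : R | `|HC_y i| < `|z|]).

(* Ranks start at 0: [HC_qsorted i] is q_(i+1). *)
Definition HC_qsorted (i : nat) : R :=
  nth 0 (sort <=%R [seq HC_q j | j <- enum 'I_p]) i.

(* The maximum over an empty range is -oo, so that the test below is then 0. *)
Definition HC_stat : \bar R :=
  \big[maxe/-oo%E]_(i < p | HC_qsorted i <= 2^-1)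
    (Num.sqrt p%:R * (i.+1%:R / p%:R - HC_qsorted i) /
     Num.sqrt (HC_qsorted i * (1 - HC_qsorted i)))%:E.

End higher_criticism.

Definition psi_HC (R : realType) (n p : nat) (a : R) : test_fun R n p :=
  fun X Y =>
    if (((1 + a) * Num.sqrt (2 * ln (ln p%:R)))%:E < HC_stat X Y)%E
    then 1 else 0.

Definition phi_boundary (R : realType) (beta : R) : R :=
  if beta <= 3 / 4 then Num.sqrt (2 * beta - 1)
  else Num.sqrt 2 * (1 - Num.sqrt (1 - beta)).

(* Main.v *)
(* Conditionally on Y, a Householder reflection turns the design into i.i.d. standard
   Gaussians: there are i.i.d. N(0,1) variables g_j such that y_j = g_j + theta_j T for
   every j, where T >= (1 - eps) sqrt n / sqrt (1 + |theta|^2) with probability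
   tending to 1. Under the null y_j = g_j, so the q_j are i.i.d. uniform.

   Type I error. The test rejects only if some count N(u) = #{j : q_j <= u} exceeds
   p u + lam sqrt (p u (1 - u)) with u <= 1/2 and lam = (1 + a) sqrt (2 ln (ln p)).
   Since (1 + x / u) ^ N(u) is a reverse martingale of mean (1 + x) ^ p, Doob's
   inequality bounds the exceedance over a whole range of u at once. A union bound
   handles the smallest u, one value of x the moderate ones, and about ln p
   geometric blocks the others, each with probability of order (ln p)^-(1 + a).

   Type II error. If some signal exceeds 2 sqrt (ln p), it is detected alone.
   Otherwise, phi being the boundary, a positive proportion of the k coordinates have
   a signal above (phi + delta) sqrt (ln p), and at a threshold (phi + h) sqrt (ln p)
   their contribution to the count exceeds sqrt (p u) by a positive power of p; a
   Chernoff lower bound for a sum of independent indicators concludes. *)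
Require Import Defs.
From HB Require Import structures.
From mathcomp Require Import all_boot all_order all_algebra.
From mathcomp Require Import all_classical all_reals all_analysis.
From mathcomp Require Import measurable_realfun ring lra.

Set Implicit Arguments.
Unset Strict Implicit.
Unset Printing Implicit Defensive.

Import Order.TTheory GRing.Theory Num.Theory.
Import numFieldNormedType.Exports.

Local Open Scope classical_set_scope.
Local Open Scope ring_scope.

(** * Gaussian measures on the line and the plane *)

(** Conditioning is expressed by a product formula over rectangles, with an arbitrary conditioning
    variable. Two families of reflections act on the Gaussian array. Within the rows they are
    deterministic and separate the design from Y, with which it is correlated under the alternative;
    within the columns they are random and turn Y / |Y| into a fixed axis. That a random reflection
    preserves the law is reduced to the plane by conjugation. The resulting laws do not involve
    sigma, whence the uniformity in sigma.

    Under the null the margin is thin: about ln p blocks of probability about (ln p)^-(1 + a) each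
    leave only (ln p)^-a, so in every block the exponent lam^2 / 2 has to be reached up to a factor
    close to 1. A union over individual levels would be too costly, hence a maximal inequality per
    block; on a grid of levels it becomes a counting statement, proved by induction. Since lam grows
    only like sqrt (ln (ln p)), the bound on the type I error is a negative power of lam, not of
    p. *)

Definition pushforward_measure d1 d2 (T1 : measurableType d1) (T2 : measurableType d2)
    (R : realType) (m : {measure set T1 -> \bar R}) (f : T1 -> T2)
    (mf : measurable_fun setT f) : {measure set T2 -> \bar R} :=
  measure_function_pushforward__canonical__measure_function_Measure m mf.

Section Gaussian.
Context {R : realType}.
Local Notation leb := (@lebesgue_measure R).
Implicit Types (A B : set R) (a b s x y : R).

Lemma measurable_affine a b :
  measurable_fun setT ((fun x => a * x + b) : measurableTypeR R -> measurableTypeR R).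
Proof. by apply: measurable_funD => //; apply: measurable_funM. Qed.

Lemma lebesgue_measure_affine a b : 0 < a -> forall A, measurable A ->
  leb A = (a%:E * leb ((fun x => a * x + b)%R @^-1` A))%E.
Proof.
move=> a0 A mA.
have a0' : 0 <= a by exact: ltW.
pose m := mscale (NngNum a0') (pushforward_measure leb (measurable_affine a b)).
change (leb A = m A).
apply: lebesgue_measure_unique => // _ [[u v]] _ <-.
rewrite /m/= /mscale/= /pushforward/=.
have -> : (fun x : R => a * x + b) @^-1` [set` `]u, v]] = [set` `](u - b) / a, (v - b) / a]].
  apply/seteqP; split => x /=; rewrite !in_itv/= => /andP[h1 h2]; apply/andP; split.
  - by rewrite ltr_pdivrMr// mulrC ltrBlDr.
  - by rewrite ler_pdivlMr// mulrC lerBrDr.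
  - by move: h1; rewrite ltr_pdivrMr// mulrC ltrBlDr.
  - by move: h2; rewrite ler_pdivlMr// mulrC lerBrDr.
rewrite !lebesgue_measure_itv/= !lte_fin ltr_pM2r ?invr_gt0// ltrD2r.
case: ifP => _; last by rewrite mule0.
rewrite -!EFinD -EFinM; congr _%:E; field; lra.
Qed.

Lemma integral_affine_gt0 (f : R -> \bar R) a b : 0 < a -> measurable_fun [set: R] f ->
  (forall x, 0 <= f x)%E ->
  (\int[leb]_x f x = a%:E * \int[leb]_x f (a * x + b)%R)%E.
Proof.
move=> a0 mf f0.
have a0' : 0 <= a by exact: ltW.
pose m := mscale (NngNum a0') (pushforward_measure leb (measurable_affine a b)).
transitivity (\int[m]_x f x)%E.
  by apply: eq_measure_integral => A mA _; exact: lebesgue_measure_affine.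
rewrite ge0_integral_mscale//=; congr (_ * _)%E.
by rewrite ge0_integral_pushforward//=; exact: measurable_affine.
Qed.

Lemma integral_opp (f : R -> \bar R) : measurable_fun [set: R] f ->
  (forall x, 0 <= f x)%E ->
  (\int[leb]_x f x = \int[leb]_x f (- x)%R)%E.
Proof.
move=> mf f0.
transitivity (\int[pushforward leb (-%R : R -> measurableTypeR R)]_x f x)%E.
  by apply: eq_measure_integral => A mA _; apply/esym; exact: lebesgue_measureN.
by rewrite ge0_integral_pushforward//=; exact: measurable_oppr.
Qed.

Lemma integral_affine (f : R -> \bar R) a b : a != 0 -> measurable_fun [set: R] f ->
  (forall x, 0 <= f x)%E ->
  (\int[leb]_x f x = `|a|%:E * \int[leb]_x f (a * x + b)%R)%E.
Proof.
move=> a0 mf f0; case: (ltrP 0 a) => ha.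
  by rewrite gtr0_norm//; exact: integral_affine_gt0.
have na : 0 < - a by rewrite oppr_gt0 lt_neqAle a0.
have mf' : measurable_fun [set: R] (fun x : R => f (a * x + b)).
  by apply: (measurableT_comp mf); exact: measurable_affine.
rewrite ler0_norm// (integral_affine_gt0 b na)// [in RHS]integral_opp//.
by congr (_ * _)%E; apply: eq_integral => x _; rewrite mulNr mulrN.
Qed.

Lemma normal_probT (m s : R) A : measurable A ->
  normal_prob m s A = (\int[leb]_x ((\1_A x)%:E * (normal_pdf m s x)%:E))%E.
Proof.
move=> mA; rewrite /normal_prob integral_mkcond; apply: eq_integral => x _.
by rewrite patchE indicE; case: ifPn => _; rewrite ?mul1e ?mul0e.
Qed.

Import HBNNSimple.

Lemma integral_nnsfun_normal_prob (h : {nnsfun measurableTypeR R >-> R}) m s :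
  (\int[normal_prob m s]_x (h x)%:E =
   \int[leb]_x ((h x)%:E * (normal_pdf m s x)%:E))%E.
Proof.
have p0 x : (0 <= (normal_pdf m s x)%:E)%E by rewrite lee_fin normal_pdf_ge0.
have mp : measurable_fun [set: measurableTypeR R] (fun x => (normal_pdf m s x)%:E).
  by apply/measurable_EFinP; exact: measurable_normal_pdf.
pose term v x := (v * \1_(h @^-1` [set v]) x : R).
have term0 v x : 0 <= term v x by exact: nnfun_muleindic_ge0.
rewrite integralT_nnsfun sintegralE.
transitivity (\int[leb]_x (\sum_(v \in range h) ((term v x)%:E * (normal_pdf m s x)%:E)))%E; last first.
  apply: eq_integral => x _; rewrite -ge0_mule_fsuml; last by move=> v; rewrite lee_fin.
  by rewrite fsumEFin// -fimfunE.
rewrite ge0_integral_fsum//; last 2 first.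
- move=> v; apply: emeasurable_funM => //; apply/measurable_EFinP.
  exact: measurable_funM.
- by move=> v x _; rewrite mule_ge0// lee_fin.
apply: eq_fsbigr => v /set_mem[x0 _ <-].
set A := h @^-1` _; have mA : measurable A by exact: measurable_sfunP.
transitivity ((h x0)%:E * \int[leb]_x ((\1_A x)%:E * (normal_pdf m s x)%:E))%E.
  by congr (_ * _)%E; exact: normal_probT.
rewrite -ge0_integralZl//.
- by apply: eq_integral => x _; rewrite /term EFinM muleA.
- apply: emeasurable_funM => //; apply/measurable_EFinP; exact: measurable_indic.
- by move=> x _; rewrite mule_ge0// lee_fin.
- by rewrite lee_fin.
Qed.

Lemma ge0_integral_normal_prob (f : measurableTypeR R -> \bar R) m s :
  measurable_fun setT f ->
  (forall x, 0 <= f x)%E ->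
  (\int[normal_prob m s]_x f x = \int[leb]_x (f x * (normal_pdf m s x)%:E))%E.
Proof.
move=> mf f0.
have mp : measurable_fun [set: measurableTypeR R] (fun x => (normal_pdf m s x)%:E).
  by apply/measurable_EFinP; exact: measurable_normal_pdf.
pose h := nnsfun_approx measurableT mf.
have hf x : (h n x)%:E @[n --> \oo] --> f x by apply: cvg_nnsfun_approx.
have ndh x : {homo (fun n => h n x) : n n' / (n <= n')%N >-> n <= n'}.
  by move=> n n' nn; have /lefP := nd_nnsfun_approx measurableT mf nn; apply.
transitivity (limn (fun n => \int[normal_prob m s]_x (h n x)%:E))%E.
  rewrite -monotone_convergence//.
  - by apply: eq_integral => x _; apply/esym/cvg_lim => //; exact: hf.
  - by move=> n; apply/measurable_EFinP; exact: measurable_funP.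
  - by move=> n x _; rewrite lee_fin.
  - by move=> x _ n n' nn; rewrite lee_fin; exact: ndh.
transitivity (limn (fun n => \int[leb]_x ((h n x)%:E * (normal_pdf m s x)%:E)))%E.
  by congr (limn _); apply/funext => n; exact: integral_nnsfun_normal_prob.
rewrite -monotone_convergence//.
- apply: eq_integral => x _; apply/cvg_lim => //.
  by apply: cvgeZr => //; exact: hf.
- move=> n; apply: emeasurable_funM => //; apply/measurable_EFinP; exact: measurable_funP.
- by move=> n x _; rewrite -EFinM lee_fin mulr_ge0// normal_pdf_ge0.
- by move=> x _ n n' nn; rewrite -!EFinM lee_fin ler_wpM2r ?normal_pdf_ge0// ndh.
Qed.

Lemma normal_prob_scale (s : R) A : 0 < s -> measurable A ->
  normal_prob 0 s [set x | A (x / s)] = normal_prob 0 1 A.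
Proof.
move=> s0 mA.
have ms : measurable [set x | A (x / s)].
  have -> : [set x | A (x / s)] = (fun x => s^-1 * x + 0) @^-1` A.
    by apply/seteqP; split => x /=; rewrite addr0 mulrC.
  by rewrite -[X in measurable X]setTI; exact: measurable_affine.
have mf : measurable_fun [set: R] (fun x : R => ((\1_[set x | A (x / s)] x)%:E * (normal_pdf 0 s x)%:E)%E).
  apply: emeasurable_funM; apply/measurable_EFinP; first exact: measurable_indic.
  exact: measurable_normal_pdf.
rewrite (normal_probT _ _ ms) (normal_probT _ _ mA) (@integral_affine _ s 0 _ mf); first last.
- by move=> x; rewrite -EFinM lee_fin mulr_ge0// normal_pdf_ge0.
- by rewrite gt_eqF.
rewrite -ge0_integralZl//; first last.
- by move=> x _; rewrite -EFinM lee_fin mulr_ge0// normal_pdf_ge0.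
- by apply: (measurableT_comp mf); exact: measurable_affine.
apply: eq_integral => x _; rewrite addr0.
have -> : \1_[set x0 : R | A (x0 / s)] (s * x) = \1_A x :> R.
  rewrite !indicE; congr (_%:R); congr nat_of_bool.
  apply/idP/idP; rewrite !inE /= mulrAC divff ?mul1r// gt_eqF//.
rewrite -!EFinM gtr0_norm//; congr _%:E.
rewrite !normal_pdfE ?gt_eqF//.
rewrite mulrCA; congr (_ * _).
rewrite mulrA; congr (_ * _).
  rewrite /normal_peak -!mulrnAr expr1n mul1r sqrtrM ?sqr_ge0// sqrtr_sqr gtr0_norm//.
  by rewrite invfM mulrA divff ?mul1r// gt_eqF.
rewrite /normal_fun !subr0; congr expR; rewrite expr1n.
have s1 : s != 0 by rewrite gt_eqF.
by field.
Qed.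

Local Notation N := (@normal_prob R 0 1).

Lemma normal_prob_opp A : measurable A -> N (-%R @^-1` A) = N A.
Proof.
move=> mA.
have mA' : measurable (-%R @^-1` A).
  by rewrite -[X in measurable X]setTI; apply: oppr_measurable.
rewrite (normal_probT _ _ mA) (normal_probT _ _ mA') [RHS]integral_opp; first last.
- by move=> x; rewrite -EFinM lee_fin mulr_ge0// normal_pdf_ge0.
- apply: emeasurable_funM; apply/measurable_EFinP; first exact: measurable_indic.
  exact: measurable_normal_pdf.
apply: eq_integral => x _; congr (_ * _)%E.
by rewrite !normal_pdfE ?oner_eq0// /normal_fun !subr0 sqrrN.
Qed.

Let pdf := @normal_pdf R 0 1.

Lemma normal_pdf_rotate a b x y : a ^+ 2 + b ^+ 2 = 1 ->
  pdf (a * x + b * y) * pdf (b * x - a * y) = pdf x * pdf y.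
Proof.
move=> ab; rewrite /pdf !normal_pdfE ?oner_eq0// /normal_fun !subr0.
rewrite [LHS]mulrACA [RHS]mulrACA -!expRD; congr (_ * expR _).
rewrite -!mulrDl; congr (_ / _); rewrite -!opprD; congr (- _).
have -> : (a * x + b * y) ^+ 2 + (b * x - a * y) ^+ 2 =
  (a ^+ 2 + b ^+ 2) * (x ^+ 2 + y ^+ 2) by ring.
by rewrite ab mul1r.
Qed.

Lemma measurable_pdf : measurable_fun [set: R] (fun x => (pdf x)%:E).
Proof. by apply/measurable_EFinP; exact: measurable_normal_pdf. Qed.

Lemma reflect_preimage_measurable a b A B : measurable A -> measurable B ->
  measurable [set z : R * R | A (a * z.1 + b * z.2) /\ B (b * z.1 - a * z.2)].
Proof.
move=> mA mB.
have m1 : measurable_fun [set: R * R] (fun z => a * z.1 + b * z.2).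
  by apply: measurable_funD; apply: measurable_funM.
have m2 : measurable_fun [set: R * R] (fun z => b * z.1 - a * z.2).
  by apply: measurable_funB; apply: measurable_funM.
have -> : [set z : R * R | A (a * z.1 + b * z.2) /\ B (b * z.1 - a * z.2)] =
  ((fun z => a * z.1 + b * z.2) @^-1` A) `&` ((fun z => b * z.1 - a * z.2) @^-1` B) by [].
by apply: measurableI; rewrite -[X in measurable X]setTI; [exact: m1|exact: m2].
Qed.

(** The density is invariant, and the map is made of two affine substitutions on the line, x = (u -
    b y) / a and then y = b u - a v, whose Jacobians 1 / |a| and |a| cancel. The first one divides
    by a, so a = 0 is separate: there b is 1 or -1 and the coordinates are swapped up to sign. *)
Lemma normal_prob_reflect a b A B : a ^+ 2 + b ^+ 2 = 1 ->
  measurable A -> measurable B ->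
  (N \x N)%E [set z : R * R | A (a * z.1 + b * z.2) /\ B (b * z.1 - a * z.2)] =
  (N A * N B)%E.
Proof.
move=> ab mA mB; have [a0|a0] := eqVneq a 0.
  have -> : [set z : R * R | A (a * z.1 + b * z.2) /\ B (b * z.1 - a * z.2)] =
     ((fun x => b * x) @^-1` B) `*` ((fun x => b * x) @^-1` A).
    by apply/seteqP; split => -[x y] /=; rewrite a0 !mul0r add0r subr0 => -[].
  have hb C : measurable C -> measurable ((fun x => b * x) @^-1` C) /\
      N ((fun x => b * x) @^-1` C) = N C.
    move=> mC; have : (b - 1) * (b + 1) = 0.
      by apply/eqP; rewrite -subr_sqr_1 subr_eq0 -ab a0 expr0n add0r.
    move=> /eqP; rewrite mulf_eq0 subr_eq0 addr_eq0 => /orP[/eqP->|/eqP->].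
      by have -> : (fun x : R => 1 * x) = id by apply/funext => x; rewrite mul1r.
    have -> : (fun x : R => - 1 * x) = -%R by apply/funext => x; rewrite mulN1r.
    split; last exact: normal_prob_opp.
    by rewrite -[X in measurable X]setTI; apply: oppr_measurable.
  have [mA' NA] := hb A mA; have [mB' NB] := hb B mB.
  by rewrite -NA -NB muleC; exact: product_measure1E.
set S := [set z : R * R | _].
have mS : measurable S by exact: reflect_preimage_measurable.
pose F := fun z : measurableTypeR R * measurableTypeR R => ((\1_S z)%:E * ((pdf z.1)%:E * (pdf z.2)%:E))%E.
have F0 z : (0 <= F z)%E by rewrite /F -!EFinM lee_fin !mulr_ge0// normal_pdf_ge0.
have mpdf1 : measurable_fun [set: measurableTypeR R * measurableTypeR R] (fun z => (pdf z.1)%:E).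
  by apply: (measurableT_comp measurable_pdf); exact: measurable_fst.
have mpdf2 : measurable_fun [set: measurableTypeR R * measurableTypeR R] (fun z => (pdf z.2)%:E).
  by apply: (measurableT_comp measurable_pdf); exact: measurable_snd.
have mF : measurable_fun [set: measurableTypeR R * measurableTypeR R] F.
  apply: emeasurable_funM; first by apply/measurable_EFinP; exact: measurable_indic.
  exact: emeasurable_funM.
have -> : (N \x N)%E S = (\int[leb]_x \int[leb]_y F (x, y))%E.
  rewrite /product_measure1 ge0_integral_normal_prob//; last exact: measurable_fun_xsection.
  apply: eq_integral => x _ /=.
  have mx : measurable (xsection S x) by exact: measurable_xsection.
  rewrite (normal_probT _ _ mx) -ge0_integralZr//; last 3 first.
  - apply: emeasurable_funM; last exact: measurable_pdf.
    by apply/measurable_EFinP; exact: measurable_indic.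
  - by move=> y _; rewrite -EFinM lee_fin mulr_ge0// normal_pdf_ge0.
  - by rewrite lee_fin normal_pdf_ge0.
  apply: eq_integral => y _; rewrite /F /= -muleA; congr (_ * _)%E; last by rewrite muleC.
  by rewrite !indicE mem_xsection.
rewrite (fubini_tonelli F mF F0).
pose G := fun z : measurableTypeR R * measurableTypeR R =>
  (`|a^-1|%:E * F (a^-1 * z.1 + - (b * z.2 / a), z.2)%R)%E.
have G0 z : (0 <= G z)%E by rewrite /G mule_ge0.
have mG : measurable_fun [set: measurableTypeR R * measurableTypeR R] G.
  apply: emeasurable_funM => //; apply: (measurableT_comp mF).
  apply/measurable_fun_pairP; split => /=; last exact: measurable_snd.
  apply: measurable_funD; first exact: measurable_funM.
  apply: measurableT_comp => //.
  by apply: measurable_funM => //; apply: measurable_funM.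
transitivity (\int[leb]_y \int[leb]_u G (u, y))%E.
  apply: eq_integral => y _.
  have mFy : measurable_fun [set: R] (fun x => F (x, y)).
    by apply: (measurableT_comp mF); exact: measurable_pair2.
  rewrite (@integral_affine _ a^-1 (- (b * y / a)) _ mFy)//; last by rewrite invr_eq0.
  rewrite -ge0_integralZl//.
  by apply: (measurableT_comp mFy); exact: measurable_affine.
rewrite -(fubini_tonelli G mG G0) (normal_probT _ _ mA) (normal_probT _ _ mB).
have mAp : measurable_fun [set: R] (fun x => ((\1_A x)%:E * (pdf x)%:E)%E).
  by apply: emeasurable_funM; [apply/measurable_EFinP; exact: measurable_indic|exact: measurable_pdf].
have mBp : measurable_fun [set: R] (fun x => ((\1_B x)%:E * (pdf x)%:E)%E).
  by apply: emeasurable_funM; [apply/measurable_EFinP; exact: measurable_indic|exact: measurable_pdf].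
have p0 (C : set R) x : (0 <= (\1_C x)%:E * (pdf x)%:E)%E.
  by rewrite -EFinM lee_fin mulr_ge0// normal_pdf_ge0.
rewrite -ge0_integralZr//; last first.
  by apply: integral_ge0 => x _; exact: p0.
apply: eq_integral => u _.
have mGu : measurable_fun [set: R] (fun x => G (u, x)).
  by apply: (measurableT_comp mG); exact: measurable_pair1.
rewrite /fubini_F (@integral_affine _ (- a) (b * u) _ mGu)//; last by rewrite oppr_eq0.
rewrite -ge0_integralZl//; last by apply: (measurableT_comp mGu); exact: measurable_affine.
rewrite -ge0_integralZl//.
apply: eq_integral => v _; rewrite /G /F /=.
have -> : a^-1 * u - b * (- a * v + b * u) / a = a * u + b * v.
  have E : u = (a ^+ 2 + b ^+ 2) * u by rewrite ab mul1r.
  by rewrite [X in a^-1 * X]E; field.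
have -> : - a * v + b * u = b * u - a * v by ring.
rewrite /S !indicE.
have -> : ((a * u + b * v, b * u - a * v) \in S) = (u \in A) && (v \in B).
  have h1 : a * (a * u + b * v) + b * (b * u - a * v) = u.
    by rewrite -[RHS]mul1r -ab; ring.
  have h2 : b * (a * u + b * v) - a * (b * u - a * v) = v.
    by rewrite -[RHS]mul1r -ab; ring.
  apply/idP/andP => [|[]]; rewrite !inE /S /= h1 h2; first by [].
  by move=> Au Bv; split.
rewrite -!EFinM normal_pdf_rotate//; congr _%:E.
have aa : `|a| * `|a^-1| = 1 by rewrite -normrM divff// normr1.
by rewrite mulrA normrN aa mul1r -mulnb natrM mulrACA.
Qed.

End Gaussian.

(** * Gaussian vectors and random reflections *)

Section MeasurableReal.
Context d (T : measurableType d) {R : realType}.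

Lemma measurable_invr : measurable_fun [set: R] (fun x : R => x^-1).
Proof.
have -> : (fun x : R => x^-1) = (fun x => x * (x ^+ 2) `^ (-1)).
  apply/funext => x; have [->|x0] := eqVneq x 0; first by rewrite invr0 mul0r.
  rewrite powR_inv1 ?sqr_ge0// expr2 invfM mulrA divff// mul1r//.
apply: measurable_funM => //.
by apply: (measurableT_comp (measurable_powR (-1))) => //; exact: measurable_funX.
Qed.

Lemma measurable_sqrtr : measurable_fun [set: R] (Num.sqrt : R -> R).
Proof. by apply: continuous_measurable_fun; exact: sqrt_continuous. Qed.

Lemma measurable_fun_div (f g : T -> R) : measurable_fun setT f ->
  measurable_fun setT g -> measurable_fun setT (fun x => f x / g x).
Proof.
move=> mf mg; apply: measurable_funM => //.
exact: (measurableT_comp measurable_invr).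
Qed.

Lemma measurable_preimage d' (T' : measurableType d') (f : T -> T') (A : set T') :
  measurable_fun setT f -> measurable A -> measurable (f @^-1` A).
Proof. by move=> mf mA; rewrite -[X in measurable X]setTI; exact: mf. Qed.

End MeasurableReal.

Section Reflection.
Context {R : realType} {I : finType}.
Implicit Types (u v : I -> R) (i j k : I) (a b c : R).

Definition dotp u v : R := \sum_k u k * v k.

(** A reflection of the plane (i, j) rather than a rotation: for a^2 + b^2 = 1 it is its own
    inverse, so conjugating by it needs no second map. *)
Definition refl2 i j a b u : I -> R := fun k =>
  if k == i then a * u i + b * u j else if k == j then b * u i - a * u j else u k.

(** For v = 0 the convention 1 / 0 = 0 makes this the identity, so v may vanish at some outcomes. *)
Definition householder v u : I -> R := fun k =>
  u k - 2 * dotp v u / dotp v v * v k.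

Lemma refl2K i j a b u : i != j -> a ^+ 2 + b ^+ 2 = 1 ->
  refl2 i j a b (refl2 i j a b u) = u.
Proof.
move=> ij ab; apply/funext => k; rewrite /refl2 !eqxx [j == i]eq_sym (negbTE ij).
have [->|ki] := eqVneq k i.
  by rewrite -[RHS]mul1r -ab; ring.
have [->|//] := eqVneq k j.
by rewrite -[RHS]mul1r -ab; ring.
Qed.

Lemma refl2_lin i j a b u v c :
  refl2 i j a b (fun k => u k - c * v k) =
  fun k => refl2 i j a b u k - c * refl2 i j a b v k.
Proof. by apply/funext => k; rewrite /refl2; case: ifP => _; [|case: ifP => _]; ring. Qed.

Lemma dotp_refl2 i j a b u v : i != j -> a ^+ 2 + b ^+ 2 = 1 ->
  dotp (refl2 i j a b u) (refl2 i j a b v) = dotp u v.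
Proof.
move=> ij ab; rewrite /dotp (bigD1 i)// (bigD1 j) 1?eq_sym//=.
rewrite [RHS](bigD1 i)// [in RHS](bigD1 j) 1?eq_sym//= !addrA.
congr (_ + _); last first.
  by apply: eq_bigr => k /andP[ki kj]; rewrite /refl2 (negbTE ki) (negbTE kj).
rewrite /refl2 !eqxx [j == i]eq_sym (negbTE ij).
by rewrite -[RHS]mul1r -ab; ring.
Qed.

Lemma householder_refl2 i j a b u v : i != j -> a ^+ 2 + b ^+ 2 = 1 ->
  refl2 i j a b (householder (refl2 i j a b v) (refl2 i j a b u)) =
  householder v u.
Proof.
move=> ij ab; rewrite /householder !dotp_refl2// refl2_lin.
by apply/funext => k; rewrite !refl2K.
Qed.

End Reflection.

Section MeasurableReflection.
Context d (T : measurableType d) {R : realType}.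

Lemma measurable_refl2 (I : finType) (i j : I) (a b : T -> R) (z : I -> T -> R) :
  measurable_fun setT a -> measurable_fun setT b ->
  (forall i, measurable_fun setT (z i)) ->
  forall k, measurable_fun setT (fun w => refl2 i j (a w) (b w) (z^~ w) k).
Proof.
move=> ma mb mz k; rewrite /refl2; case: (k == i); last case: (k == j).
- by apply: measurable_funD; apply: measurable_funM.
- by apply: measurable_funB; apply: measurable_funM.
- exact: mz.
Qed.

Lemma measurable_householder (I : finType) (v z : I -> T -> R) :
  (forall i, measurable_fun setT (v i)) ->
  (forall i, measurable_fun setT (z i)) ->
  forall k, measurable_fun setT (fun w => householder (v^~ w) (z^~ w) k).
Proof.
move=> mv mz k; rewrite /householder.
have mdot (u v' : I -> T -> R) : (forall i, measurable_fun setT (u i)) ->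
    (forall i, measurable_fun setT (v' i)) -> measurable_fun setT (fun w => dotp (u^~ w) (v'^~ w)).
  by move=> mu mv'; rewrite /dotp; apply: measurable_sum => i; exact: measurable_funM.
apply: measurable_funB => //; apply: measurable_funM => //.
by apply: measurable_fun_div; [apply: measurable_funM => //; exact: mdot|exact: mdot].
Qed.

End MeasurableReflection.

(** * Conditionally Gaussian families and their invariance under random reflections *)

Section NormalOver.
Context d (T : measurableType d) {R : realType} (P : probability T R).
Local Notation N := (@normal_prob R 0 1).

(* Conditionally on [W], the coordinates in [J] are i.i.d. standard Gaussian. *)
Definition normal_over d' (E : measurableType d') (I : finType) (J : {set I})
    (W : T -> E) (z : I -> T -> R) : Prop :=
  forall (B : set E) (A : I -> set R), measurable B ->
    (forall i, measurable (A i)) ->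
  P [set w | B (W w) /\ forall i, i \in J -> A i (z i w)] =
  (P (W @^-1` B) * \prod_(i in J) N (A i))%E.

Section Absorb.
Context d' (E : measurableType d') (I : finType) (J : {set I}).
Variables (W : T -> E) (z : I -> T -> R).
Hypotheses (mW : measurable_fun setT W) (mz : forall i, measurable_fun setT (z i)).
Hypothesis Wz : normal_over J W z.

Lemma measurable_box (J' : {set I}) (A : I -> set R) : (forall i, measurable (A i)) ->
  measurable [set w | forall i, i \in J' -> A i (z i w)].
Proof.
move=> mA.
have -> : [set w | forall i, i \in J' -> A i (z i w)] =
    \bigcap_(i in [set` J']) (z i @^-1` A i).
  by apply/seteqP; split => w /= h i; exact: h.
apply: fin_bigcap_measurable; first exact: finite_finset.
by move=> i _; exact: measurable_preimage.
Qed.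

Lemma measurable_event (J' : {set I}) (B : set E) (A : I -> set R) :
  measurable B -> (forall i, measurable (A i)) ->
  measurable [set w | B (W w) /\ forall i, i \in J' -> A i (z i w)].
Proof.
by move=> mB mA; apply: measurableI; [exact: measurable_preimage|exact: measurable_box].
Qed.

Lemma pair_measurable i :
  measurable_fun setT ((fun w => (W w, z i w)) : T -> E * measurableTypeR R).
Proof. by apply/measurable_fun_pairP; split; [exact: mW|exact: mz]. Qed.

Let NE (A : set R) : measurable A -> N A \is a fin_num.
Proof. by move=> mA; apply: fin_num_measure. Qed.

Lemma normal_over_law i (S : set (E * measurableTypeR R)) : i \in J -> measurable S ->
  P [set w | S (W w, z i w)] = (\int[P]_w N (xsection S (W w)))%E.
Proof.
move=> iJ mS.
pose Wm : {mfun T >-> E} := HB.pack W (isMeasurableFun.Build _ _ _ _ W mW).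
have := @product_measure_unique _ _ _ _ R (distribution P Wm) N
  (pushforward_measure P (pair_measurable i)).
move=> /(_ _ S mS); rewrite /pushforward_measure/= /pushforward => h.
transitivity (P ((fun w => (W w, z i w)) @^-1` S)) => //.
rewrite -h => [|A B mA mB].
  rewrite /product_measure1 ge0_integral_distribution//.
  exact: measurable_fun_xsection.
pose A' k := if k == i then B else setT.
have mA' k : measurable (A' k) by rewrite /A'; case: ifP.
have := Wz mA mA'; rewrite (bigD1 i)//= big1 ?mule1; last first.
  by move=> k /andP[_ /negbTE ki]; rewrite /A' ki; exact: probability_setT.
rewrite {2}/A' eqxx => <-; congr (P _); apply/seteqP; split => w /=.
  move=> [? ?]; split => // k _; rewrite /A'; case: ifP => // /eqP ->//.
by move=> [? /(_ i iJ)]; rewrite /A' eqxx.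
Qed.

(** Rectangles determine both sides: restricting P to an event on the remaining coordinates, or
    multiplying it by the Gaussian probability of that event, gives the same finite measure on pairs
    (W, z_i). Absorbing coordinates is what allows events that mix them with W. *)
Lemma normal_over_absorb i : i \in J ->
  normal_over (J :\ i) ((fun w => (W w, z i w)) : T -> E * measurableTypeR R) z.
Proof.
move=> iJ S A mS mA.
pose F := [set w | forall k, k \in J :\ i -> A k (z k w)].
have mF : measurable F by exact: measurable_box.
set c := (\prod_(k in J :\ i) N (A k))%E.
have c0 : (0 <= c)%E by apply: prode_ge0.
have cfin : c \is a fin_num.
  by rewrite /c; apply/prode_fin_num => k _; exact: NE.
pose mc : {nonneg R} := NngNum (fine_ge0 c0).
pose m1 := pushforward_measure (mrestr P mF) (pair_measurable i).
pose m2 := mscale mc (pushforward_measure P (pair_measurable i)).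
have -> : P [set w | S (W w, z i w) /\ (forall k, k \in J :\ i -> A k (z k w))] = m1 S.
  by [].
have -> : (P ((fun w => (W w, z i w)) @^-1` S) * c)%E = m2 S.
  by rewrite /m2 /mscale/= /pushforward fineK// muleC.
have := @measure_unique _ R _ [set A `*` B | A in @measurable _ E & B in @measurable _ (measurableTypeR R)]
  (fun=> setT) (measurable_prod_measurableType E (measurableTypeR R)).
apply => //.
- move=> _ _ [A1 mA1 [B1 mB1 <-]] [A2 mA2 [B2 mB2 <-]].
  exists (A1 `&` A2); first exact: measurableI.
  by exists (B1 `&` B2); [exact: measurableI|rewrite setXI].
- by move=> _; exists setT => //; exists setT => //; rewrite setXTT.
- by rewrite bigcup_const//; exists 0%N.
- move=> _ [A1 mA1 [B1 mB1 <-]].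
  pose pre := (fun w => (W w, z i w)) @^-1` (A1 `*` B1).
  change (P (pre `&` F) = (fine c)%:E * P pre)%E; rewrite fineK// /pre.
  pose A' k : set R := if k == i then B1 else A k.
  pose A'' k : set R := if k == i then B1 else setT.
  have mA' k : measurable (A' k) by rewrite /A'; case: ifP => _; [exact: mB1|exact: mA].
  have mA'' k : measurable (A'' k) by rewrite /A''; case: ifP => _ //; exact: mB1.
  have -> : ((fun w => (W w, z i w)) @^-1` (A1 `*` B1)) `&` F =
      [set w | A1 (W w) /\ forall k, k \in J -> A' k (z k w)].
    apply/seteqP; split => w /=.
      move=> [[h1 h2] h3]; split => // k kJ; rewrite /A'; case: ifPn => [/eqP->//|ki].
      by apply: h3; rewrite !inE ki.
    move=> [h1 h2]; split; first by split => //; have := h2 _ iJ; rewrite /A' eqxx.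
    by move=> k; rewrite !inE => /andP[ki kJ]; have := h2 _ kJ; rewrite /A' (negbTE ki).
  have -> : ((fun w => (W w, z i w)) @^-1` (A1 `*` B1)) =
      [set w | A1 (W w) /\ forall k, k \in J -> A'' k (z k w)].
    apply/seteqP; split => w /=.
      by move=> [h1 h2]; split => // k kJ; rewrite /A''; case: ifPn => [/eqP->//|].
    by move=> [h1 h2]; split => //; have := h2 _ iJ; rewrite /A'' eqxx.
  have r1 : (\prod_(k in J) N (A' k) = N B1 * c)%E.
    rewrite (bigD1 i iJ) {1}/A' eqxx; congr (_ * _)%E; rewrite /c.
    by apply: eq_big => [k|k /andP[_ /negbTE h]]; [rewrite !inE andbC|rewrite /A' h].
  have r2 : (\prod_(k in J) N (A'' k) = N B1)%E.
    rewrite (bigD1 i iJ) {1}/A'' eqxx big1 => [|k /andP[_ /negbTE ki]]; first exact: mule1.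
    by rewrite /A'' ki; exact: probability_setT.
  by rewrite (Wz mA1 mA') (Wz mA1 mA'') r1 r2 muleA muleC.
- move=> _; change (P ((fun w => (W w, z i w)) @^-1` setT `&` F) < +oo)%E.
  rewrite preimage_setT setTI; apply: (le_lt_trans (probability_le1 P mF)).
  by rewrite ltry.
Qed.

End Absorb.

Section Transforms.
Context d' (E : measurableType d') (I : finType) (J : {set I}) (W : T -> E).
Hypothesis mW : measurable_fun setT W.
Implicit Types (z : I -> T -> R).

(** Once z_i and z_j are absorbed, the event on them is a single set [S] of triples. Fubini
    integrates over W last, so the coefficients are frozen at a value e and the invariance in the
    plane applies. *)
Lemma normal_over_refl2 z (i j : I) (a b : E -> R) : i \in J -> j \in J -> i != j ->
  measurable_fun setT a -> measurable_fun setT b ->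
  (forall e, a e ^+ 2 + b e ^+ 2 = 1) ->
  (forall i, measurable_fun setT (z i)) ->
  normal_over J W z ->
  normal_over J W (fun k w => refl2 i j (a (W w)) (b (W w)) (z^~ w) k).
Proof.
move=> iJ jJ ij ma mb ab mz Wz B A mB mA.
have jJi : j \in J :\ i by rewrite !inE eq_sym ij.
have mWi := pair_measurable mW mz i.
have h1 := normal_over_absorb mW mz Wz iJ.
have h2 := normal_over_absorb mWi mz h1 jJi.
pose S := [set q : (E * measurableTypeR R) * measurableTypeR R | B q.1.1 /\
  A i (a q.1.1 * q.1.2 + b q.1.1 * q.2) /\ A j (b q.1.1 * q.1.2 - a q.1.1 * q.2)].
have mq11 : measurable_fun [set: (E * measurableTypeR R) * measurableTypeR R] (fun q => q.1.1).
  by apply: (measurableT_comp measurable_fst); exact: measurable_fst.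
have mq12 : measurable_fun [set: (E * measurableTypeR R) * measurableTypeR R] (fun q => q.1.2 : R).
  by apply: (measurableT_comp measurable_snd); exact: measurable_fst.
have mq2 : measurable_fun [set: (E * measurableTypeR R) * measurableTypeR R] (fun q => q.2 : R).
  exact: measurable_snd.
have mS : measurable S.
  have mf1 : measurable_fun [set: (E * measurableTypeR R) * measurableTypeR R]
      (fun q => a q.1.1 * q.1.2 + b q.1.1 * q.2).
    by apply: measurable_funD; apply: measurable_funM => //;
      [exact: (measurableT_comp ma)|exact: (measurableT_comp mb)].
  have mf2 : measurable_fun [set: (E * measurableTypeR R) * measurableTypeR R]
      (fun q => b q.1.1 * q.1.2 - a q.1.1 * q.2).
    by apply: measurable_funB; apply: measurable_funM => //;
      [exact: (measurableT_comp mb)|exact: (measurableT_comp ma)].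
  by apply: measurableI; [|apply: measurableI]; apply: measurable_preimage.
have -> : [set w | B (W w) /\ (forall k, k \in J -> A k (refl2 i j (a (W w)) (b (W w)) (z^~ w) k))] =
   [set w | S ((W w, z i w), z j w) /\ forall k, k \in J :\ i :\ j -> A k (z k w)].
  apply/seteqP; split => w /=.
    move=> [Bw h]; split; first split => //=.
      have := h _ iJ; have := h _ jJ; rewrite /refl2 !eqxx [j == i]eq_sym (negbTE ij).
      by move=> ? ?; split.
    move=> k; rewrite !inE => /and3P[kj ki kJ].
    by have := h _ kJ; rewrite /refl2 (negbTE ki) (negbTE kj).
  move=> [[/= Bw [Ai Aj]] h]; split => // k kJ; rewrite /refl2.
  case: ifPn => [/eqP->//|ki]; case: ifPn => [/eqP->//|kj].
  by apply: h; rewrite !inE kj ki.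
rewrite (h2 S A mS mA) (bigD1 i iJ) (bigD1 j) /=; last by rewrite eq_sym ij andbT.
have -> : (\prod_(k in J :\ i :\ j) N (A k) = \prod_(k in J | (k != i) && (k != j)) N (A k))%E.
  by apply: eq_bigl => k; rewrite !inE; case: (k \in J); rewrite ?andbT ?andbF// andbC.
under [in RHS]eq_bigl do rewrite -andbA.
rewrite !muleA; congr (_ * _)%E.
transitivity (P [set w | S ((W w, z i w), z j w)]) => //.
rewrite (normal_over_law mWi mz h1 jJi mS).
pose Wm : {mfun T >-> E} := HB.pack W (isMeasurableFun.Build _ _ _ _ W mW).
pose Wim : {mfun T >-> (E * measurableTypeR R)%type} := HB.pack (fun w => (W w, z i w))
  (isMeasurableFun.Build _ _ _ _ _ mWi).
have mx : measurable_fun [set: E * measurableTypeR R] (fun q => N (xsection S q)).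
  exact: measurable_fun_xsection.
transitivity (\int[distribution P Wim]_q N (xsection S q))%E.
  by rewrite ge0_integral_distribution//.
transitivity (\int[distribution P Wm \x N]_q N (xsection S q))%E.
  apply: eq_measure_integral => Q mQ _.
  rewrite /= /distribution /pushforward.
  rewrite -[LHS]/(P [set w | Q (W w, z i w)]) (normal_over_law mW mz Wz iJ mQ).
  rewrite /product_measure1 ge0_integral_distribution//.
  exact: measurable_fun_xsection.
rewrite fubini_tonelli1//.
transitivity (\int[distribution P Wm]_e ((\1_B e)%:E * (N (A i) * N (A j))))%E.
  apply: eq_integral => e _; rewrite /fubini_F indicE.
  have [/set_mem eB|eB] := boolP (e \in B); last first.
    rewrite mul0e; apply: integral0_eq => x _.
    have -> : xsection S (e, x) = set0.
      apply/seteqP; split => y //; rewrite /xsection/= inE /S /= => -[eB' _].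
      by move: eB; rewrite notin_setE.
    exact: measure0.
  rewrite mul1e -(normal_prob_reflect (ab e) (mA i) (mA j)) /product_measure1.
  apply: eq_integral => x _ /=; congr (N _).
  apply/seteqP; split => y; rewrite /xsection/= !inE /S /=; first by case.
  by move=> [? ?]; split.
rewrite ge0_integralZr//; last 2 first.
- by apply/measurable_EFinP; exact: measurable_indic.
- by rewrite mule_ge0.
by rewrite -muleA integral_indic// setIT.
Qed.

(** Base case of the Householder reflections: a vector supported on the coordinate i changes the
    sign of z_i wherever it does not vanish. *)
Lemma normal_over_sign z (i : I) (s : E -> bool) : i \in J -> measurable_fun setT s ->
  (forall i, measurable_fun setT (z i)) ->
  normal_over J W z ->
  normal_over J W (fun k w => if (k == i) && s (W w) then - z k w else z k w).
Proof.
move=> iJ ms mz Wz B A mB mA.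
pose A' k := if k == i then -%R @^-1` A k else A k.
have mA' k : measurable (A' k).
  rewrite /A'; case: ifP => // _.
  by rewrite -[X in measurable X]setTI; apply: oppr_measurable.
pose S := s @^-1` [set true].
have mS : measurable S by apply: measurable_preimage.
have hU (G : set E) : measurable G -> P (W @^-1` B) = (P (W @^-1` (B `&` G)) + P (W @^-1` (B `\` G)))%E.
  move=> mG; rewrite -measureU.
  - by rewrite -preimage_setU setUIDK.
  - by apply: measurable_preimage => //; exact: measurableI.
  - by apply: measurable_preimage => //; exact: measurableD.
  - by apply/seteqP; split => w //= [[_ ?] [_ ?]].
set X := [set w | _].
have -> : P X = (P [set w | (B `&` S) (W w) /\ forall k, k \in J -> A' k (z k w)] +
                 P [set w | (B `\` S) (W w) /\ forall k, k \in J -> A k (z k w)])%E.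
  rewrite -measureU; first congr (P _).
  - apply/seteqP; split => w /=.
      move=> [Bw h]; have [sw|sw] := boolP (s (W w)); [left|right]; split => //.
      + by move=> k kJ; have := h k kJ; rewrite sw andbT /A'; case: ifP.
      + by split => //; apply/negP.
      + by move=> k kJ; have := h k kJ; rewrite (negbTE sw) andbF.
    move=> [[[Bw sw] h]|[[Bw sw] h]]; split => // k kJ.
      by have := h k kJ; rewrite sw andbT /A'; case: ifP.
    by move/negP/negbTE : sw => ->; rewrite andbF; exact: h.
  - by apply: measurable_event => //; exact: measurableI.
  - by apply: measurable_event => //; exact: measurableD.
  - apply/seteqP; split => w //= [[[_ h] _] [[_ h'] _]].
    exact: h'.
have BS : measurable (B `&` S) by exact: measurableI.
have BD : measurable (B `\` S) by exact: measurableD.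
rewrite (Wz _ _ BS mA') (Wz _ _ BD mA) (hU S mS) ge0_muleDl//; congr (_ * _ + _)%E.
apply: eq_bigr => k _; rewrite /A'; case: ifP => // _; exact: normal_prob_opp.
Qed.

(** Induction on the support of v. The plane reflection with coefficients v_i / rho and v_j / rho
    sends the coordinate j of v to 0; conjugating by it, as in [householder_refl2], leaves a vector
    of smaller support. *)
Lemma normal_over_householder (z : I -> T -> R) (v : I -> E -> R) :
  (forall i, measurable_fun setT (v i)) ->
  (forall i e, i \notin J -> v i e = 0) ->
  (forall i, measurable_fun setT (z i)) ->
  normal_over J W z ->
  normal_over J W (fun k w => householder (v^~ (W w)) (z^~ w) k).
Proof.
move=> mv vJ.
suff H n (K : {set I}) (v' : I -> E -> R) z' : #|K| = n -> K \subset J ->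
    (forall i, measurable_fun setT (v' i)) ->
    (forall i e, i \notin K -> v' i e = 0) ->
    (forall i, measurable_fun setT (z' i)) ->
    normal_over J W z' ->
    normal_over J W (fun k w => householder (v'^~ (W w)) (z'^~ w) k).
  exact: (H #|J| J v).
elim: n K v' z' => [|n IH] K v' z' cK KJ mv' vK mz' Wz'.
  suff -> : (fun k w => householder (v'^~ (W w)) (z'^~ w) k) = z' by [].
  apply/funext => k; apply/funext => w; rewrite /householder vK ?mulr0 ?subr0//.
  by move/eqP: cK; rewrite cards_eq0 => /eqP ->; rewrite inE.
have [i iK] : exists i, i \in K by apply/card_gt0P; rewrite cK.
have iJ : i \in J by apply: (fintype.subsetP KJ).
have [/set0Pn[j] jK|/negP] := boolP (K :\ i != finset.set0); last first.
  move=> /negP; rewrite negbK => /eqP K0.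
  have Ki k : k != i -> k \notin K.
    move=> ki; apply/negP => kK; have : k \in K :\ i by rewrite !inE ki.
    by rewrite K0 inE.
  have ms : measurable_fun setT (fun e => v' i e != 0).
    apply: measurable_neg; apply: measurable_fun_eqr => //; exact: mv'.
  have := normal_over_sign iJ ms mz' Wz'; congr (normal_over _ _ _).
  apply/funext => k; apply/funext => w; rewrite /householder /dotp.
  rewrite (bigD1 i)//= big1 ?addr0; last by move=> l li; rewrite vK ?mul0r// Ki.
  rewrite (bigD1 i)//= big1 ?addr0; last by move=> l li; rewrite vK ?mul0r// Ki.
  have [->|ki] /= := eqVneq k i; last by rewrite (vK k) ?mulr0 ?subr0// Ki.
  have [->|v0] := eqVneq (v' i (W w)) 0; first by rewrite mulr0 subr0.
  by field.
have [ji jK'] : j != i /\ j \in K by move: jK; rewrite !inE => /andP[].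
have jJ : j \in J by apply: (fintype.subsetP KJ).
have ij : i != j by rewrite eq_sym.
pose rho e := Num.sqrt (v' i e ^+ 2 + v' j e ^+ 2).
(* Where v_i and v_j both vanish, the values (1, 0) keep a^2 + b^2 = 1. *)
pose a e := if rho e == 0 then 1 else v' i e / rho e.
pose b e := if rho e == 0 then 0 else v' j e / rho e.
have mrho : measurable_fun setT rho.
  apply: (measurableT_comp measurable_sqrtr).
  by apply: measurable_funD; apply: measurable_funX; exact: mv'.
have mrho0 : measurable_fun setT (fun e => rho e == 0).
  exact: measurable_fun_eqr.
have ma : measurable_fun setT a.
  apply: measurable_fun_ifT => //; exact: measurable_fun_div.
have mb : measurable_fun setT b.
  apply: measurable_fun_ifT => //; exact: measurable_fun_div.
have rho2 e : rho e ^+ 2 = v' i e ^+ 2 + v' j e ^+ 2.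
  by rewrite sqr_sqrtr// addr_ge0 ?sqr_ge0.
have ab e : a e ^+ 2 + b e ^+ 2 = 1.
  rewrite /a /b; case: eqP => [_|/eqP r0]; first by rewrite expr1n expr0n addr0.
  by rewrite !expr_div_n -mulrDl -rho2 divff// sqrf_eq0.
have bj e : b e * v' i e - a e * v' j e = 0.
  rewrite /a /b; case: eqP => [r0|/eqP r0]; last by ring.
  have : v' j e ^+ 2 <= 0.
    by have := rho2 e; have := sqr_ge0 (v' i e); rewrite r0 expr0n /=; lra.
  rewrite le_eqVlt ltNge sqr_ge0 orbF sqrf_eq0 => /eqP ->.
  by rewrite mul0r mulr0 subr0.
pose v2 k e := refl2 i j (a e) (b e) (v'^~ e) k.
pose z2 k w := refl2 i j (a (W w)) (b (W w)) (z'^~ w) k.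
have maW : measurable_fun setT (a \o W) by exact: (measurableT_comp ma).
have mbW : measurable_fun setT (b \o W) by exact: (measurableT_comp mb).
have mz2 k : measurable_fun setT (z2 k) by exact: (measurable_refl2 i j maW mbW mz').
have mv2 k : measurable_fun setT (v2 k) by exact: (measurable_refl2 i j ma mb mv').
have Wz2 : normal_over J W z2 by exact: normal_over_refl2.
have vK2 k e : k \notin K :\ j -> v2 k e = 0.
  rewrite !inE negb_and negbK => /orP[/eqP ->|kK].
    by rewrite /v2 /refl2 eqxx (negbTE ji) bj.
  rewrite /v2 /refl2; case: eqP kK => [->|_]; first by rewrite iK.
  by case: eqP => [->|_ kK]; [rewrite jK'|exact: vK].
have cK2 : #|K :\ j| = n by move: cK; rewrite (cardsD1 j) jK' => -[].
have KJ2 : K :\ j \subset J by rewrite (fintype.subset_trans _ KJ)// subD1set.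
have h := IH _ _ _ cK2 KJ2 mv2 vK2 mz2 Wz2.
have mh k : measurable_fun setT (fun w => householder (v2^~ (W w)) (z2^~ w) k).
  apply: measurable_householder => // l.
  exact: (measurableT_comp (mv2 l)).
have := normal_over_refl2 iJ jJ ij ma mb ab mh h; congr (normal_over _ _ _).
apply/funext => k; apply/funext => w.
exact: (congr1 (@^~ k) (householder_refl2 (z'^~ w) (v'^~ (W w)) ij (ab (W w)))).
Qed.

End Transforms.

End NormalOver.

(** * Representation of the regression model *)

Section OrthogonalFamilies.
Context d (T : measurableType d) {R : realType} (P : probability T R).

(** The reflections already applied only add multiples of the other vectors, so by orthogonality the
    inner product with v_l is still that of the original z, and the composition is a single sum. *)
Lemma normal_over_householders d' (E : measurableType d') (I K : finType) (J : {set I})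
    (W : T -> E) (z : I -> T -> R) (v : K -> I -> E -> R) :
  measurable_fun setT W ->
  (forall i, measurable_fun setT (z i)) ->
  (forall l i, measurable_fun setT (v l i)) ->
  (forall l i e, i \notin J -> v l i e = 0) ->
  (forall l l' e, l != l' -> dotp ((v l)^~ e) ((v l')^~ e) = 0) ->
  normal_over P J W z ->
  normal_over P J W (fun k w => z k w - \sum_l
    2 * dotp ((v l)^~ (W w)) (z^~ w) / dotp ((v l)^~ (W w)) ((v l)^~ (W w)) * v l k (W w)).
Proof.
move=> mW mz mv vJ ov Wz.
pose zs s k w := z k w - \sum_(l <- s)
    2 * dotp ((v l)^~ (W w)) (z^~ w) / dotp ((v l)^~ (W w)) ((v l)^~ (W w)) * v l k (W w).
suff [_ H] : (forall k, measurable_fun setT (zs (index_enum K) k)) /\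
  normal_over P J W (zs (index_enum K)) by [].
have : uniq (index_enum K) by exact: index_enum_uniq.
elim: (index_enum K) => [_|l s IH /=/andP[ls us]].
  have E0 : zs [::] = z.
    by apply/funext => k; apply/funext => w; rewrite /zs big_nil subr0.
  by rewrite E0.
have [mzs Wzs] := IH us.
have E1 : zs (l :: s) = fun k w => householder ((v l)^~ (W w)) ((zs s)^~ w) k.
  apply/funext => k; apply/funext => w; rewrite /householder.
  have -> : dotp ((v l)^~ (W w)) ((zs s)^~ w) = dotp ((v l)^~ (W w)) (z^~ w).
    rewrite /zs {1}/dotp.
    under eq_bigr do rewrite mulrBr mulr_sumr.
    rewrite sumrB -[RHS]subr0; congr (_ - _).
    rewrite exchange_big big_seq big1//= => l' l's.
    have ll' : l != l' by apply: contraNneq ls => ->.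
    under eq_bigr do rewrite mulrCA.
    by rewrite -mulr_sumr [X in _ * X](ov l l' (W w) ll') mulr0.
  by rewrite /zs big_cons opprD addrA addrAC.
have mvW i : measurable_fun setT (v l i \o W) by exact: (measurableT_comp (mv l i)).
rewrite E1; split; first exact: measurable_householder.
exact: (normal_over_householder mW (mv l) (vJ l) mzs Wzs).
Qed.

(** The conditioning space gains one factor per absorbed coordinate, hence the existential type; f
    reads these coordinates off W'. *)
Lemma normal_over_absorb_set d' (E : measurableType d') (I : finType) (J K : {set I})
    (W : T -> E) (z : I -> T -> R) :
  K \subset J -> measurable_fun setT W -> (forall i, measurable_fun setT (z i)) ->
  normal_over P J W z ->
  exists d'' (E' : measurableType d'') (W' : T -> E') (f : I -> E' -> R),
    [/\ measurable_fun setT W', (forall i, measurable_fun setT (f i)),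
        (forall i w, i \in K -> f i (W' w) = z i w) &
        normal_over P (J :\: K) W' z].
Proof.
elim: {K}#|K| {-2}K (erefl #|K|) => [|n IH] K cK KJ mW mz Wz.
  exists d', E, W, (fun _ _ => 0); split => //.
    by move=> i w; move/eqP: cK; rewrite cards_eq0 => /eqP ->; rewrite inE.
  by move/eqP: cK; rewrite cards_eq0 => /eqP ->; rewrite finset.setD0.
have [i iK] : exists i, i \in K by apply/card_gt0P; rewrite cK.
have cK2 : #|K :\ i| = n by move: cK; rewrite (cardsD1 i) iK => -[].
have KJ2 : K :\ i \subset J by rewrite (fintype.subset_trans _ KJ)// subD1set.
have [d'' [E' [W' [f [mW' mf fz Wz']]]]] := IH _ cK2 KJ2 mW mz Wz.
have iJ : i \in J :\: (K :\ i) by rewrite !inE eqxx /= (fintype.subsetP KJ).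
have h := normal_over_absorb mW' mz Wz' iJ.
exists _, (E' * measurableTypeR R)%type, (fun w => (W' w, z i w)),
  (fun k (q : E' * measurableTypeR R) => if k == i then q.2 else f k q.1); split.
- exact: pair_measurable.
- move=> k; case: (k == i); first exact: measurable_snd.
  by apply: (measurableT_comp (mf k)); exact: measurable_fst.
- move=> k w kK; have [->//|ki] := eqVneq k i.
  by rewrite fz// !inE ki.
- move: h; congr (normal_over _ _ _ _); apply/setP => k; rewrite !inE.
  by case: (eqVneq k i) => [->|]; rewrite ?iK //= ?andbT.
Qed.

Lemma normal_over_iid d' (E : measurableType d') (I K : finType) (J : {set I})
    (W : T -> E) (z : I -> T -> R) (f : K -> I) : injective f ->
  (forall k, f k \in J) -> normal_over P J W z ->
  forall A : K -> set R, (forall k, measurable (A k)) ->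
  P [set w | forall k, A k (z (f k) w)] = (\prod_k normal_prob 0 1 (A k))%E.
Proof.
move=> finj fJ Wz A mA.
pose B i : set R := if [pick k | f k == i] is Some k then A k else setT.
have mB i : measurable (B i) by rewrite /B; case: pickP.
have Bf k : B (f k) = A k.
  rewrite /B; case: pickP => [k' /eqP/finj ->//|/(_ k)]; by rewrite eqxx.
have := Wz setT B measurableT mB.
rewrite preimage_setT probability_setT mul1e.
have -> : [set w | [set: E] (W w) /\ (forall i, i \in J -> B i (z i w))] =
    [set w | forall k, A k (z (f k) w)].
  apply/seteqP; split => w /=.
    by move=> [_ h] k; rewrite -Bf; exact: h.
  by move=> h; split => // i iJ; rewrite /B; case: pickP => // k /eqP <-.
move=> ->.
rewrite (bigID (fun i => i \in codom f))/= [X in (_ * X)%E]big1 ?mule1; last first.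
  move=> i /andP[_ ni]; rewrite /B; case: pickP => [k /eqP fk|_]; last exact: probability_setT.
  by move: ni; rewrite -fk codom_f.
rewrite [RHS](eq_bigr (fun k => normal_prob 0 1 (B (f k)))); last by move=> k _; rewrite Bf.
rewrite -(big_map f xpredT (fun i => normal_prob 0 1 (B i))).
rewrite -big_filter; apply: perm_big; apply: uniq_perm.
- by rewrite filter_uniq// index_enum_uniq.
- by rewrite map_inj_uniq// index_enum_uniq.
- move=> i; rewrite mem_filter mem_index_enum andbT.
  apply/andP/mapP => [[_ /codomP[k ->]]|[k _ ->]]; first by exists k => //; rewrite mem_index_enum.
  by rewrite fJ codom_f.
Qed.

End OrthogonalFamilies.

Section Regression.
Context {R : realType} (n p : nat) (M : gaussian_regression R n p).
Variables (theta : 'rV[R]_p) (sigma : R).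
Hypotheses (sigma_gt0 : 0 < sigma) (n_gt0 : (0 < n)%N).
Let T := reg_space M.
Let P := reg_law M (sigma *: theta) sigma.
Let Idx : finType := (('I_n * 'I_p) + 'I_n)%type.
Let kappa := Num.sqrt (1 + \sum_j theta 0 j ^+ 2).

Let X (l : 'I_n) (j : 'I_p) (w : T) : R := reg_X M l j w.
Let Y (l : 'I_n) (w : T) : R := reg_Y M l w.
Let normY (w : T) : R := l2norm (\col_l reg_Y M l w)^T.

(** At a noise index this is xi_l / sigma, because the coefficient vector of the model is sigma
    theta. *)
Let z0 (u : Idx) (w : T) : R :=
  match u with
  | inl lj => X lj.1 lj.2 w
  | inr l => Y l w / sigma - \sum_j theta 0 j * X l j w
  end.

Let kappa2 : kappa ^+ 2 = 1 + \sum_j theta 0 j ^+ 2.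
Proof. by rewrite sqr_sqrtr// addr_ge0// sumr_ge0// => j _; rewrite sqr_ge0. Qed.

Let kappa_ge1 : 1 <= kappa.
Proof.
rewrite -[X in X <= _]sqrtr1; apply: ler_wsqrtr; rewrite lerDl.
by apply: sumr_ge0 => j _; rewrite sqr_ge0.
Qed.

Let mX l j : measurable_fun setT (X l j). Proof. exact: measurable_funPT. Qed.

Let mz0 u : measurable_fun setT (z0 u).
Proof.
case: u => [[l j]|l]; first exact: mX.
apply: measurable_funB; first by apply: measurable_funM.
by apply: measurable_sum => j; apply: measurable_funM.
Qed.

Let z0_indep : normal_over P [set: Idx]%SET (fun=> tt) z0.
Proof.
move=> B A mB mA.
pose A' (u : Idx) : set R := match u with inl _ => A u | inr _ => [set x | A u (x / sigma)] end.
have mA' u : measurable (A' u).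
  case: u => [lj|l]; first exact: mA.
  rewrite /A'; have -> : [set x | A (inr l) (x / sigma)] = (fun x : R => x * sigma^-1) @^-1` A (inr l) by [].
  by apply: measurable_preimage => //; apply: measurable_funM.
have := reg_indep M (sigma *: theta) sigma_gt0 [set: Idx]%SET mA'.
set S := \bigcap_(i in _) _.
have SE : S = [set w | forall u, A u (z0 u w)].
  apply/seteqP; split => w /=.
    move=> h u; have := h u; rewrite /= inE => /(_ isT).
    case: u => [[l j]|l]//; rewrite /A' /= /residual /z0.
    congr (A _ _); rewrite mulrBl mulr_suml; congr (_ - _); apply: eq_bigr => j _.
    by rewrite mxE /X; field; rewrite gt_eqF.
  move=> h u _; have := h u.
  case: u => [[l j]|l]//; rewrite /A' /= /residual /z0.
  congr (A _ _); rewrite mulrBl mulr_suml; congr (_ - _); apply: eq_bigr => j _.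
  by rewrite mxE /X; field; rewrite gt_eqF.
have -> : (\prod_(i in [set: Idx]%SET) P (design_and_noise (fun i j => reg_X M i j : _ -> R)
     (fun i => reg_Y M i : _ -> R) (sigma *: theta) i @^-1` A' i) =
   \prod_(i in [set: Idx]%SET) normal_prob 0 1 (A i))%E.
  apply: eq_bigr => u _; case: u => [[l j]|l].
    by rewrite /= (reg_design M (sigma *: theta) sigma_gt0).
  transitivity (normal_prob 0 sigma (A' (inr l))).
    exact: (reg_noise M (sigma *: theta) sigma_gt0 l (mA' (inr l))).
  exact: normal_prob_scale.
move=> E; have [Bt|Bt] := pselect (B tt).
  have -> : [set w : T | B tt /\ (forall i, i \in [set: Idx]%SET -> A i (z0 i w))] = S.
    by rewrite SE; apply/seteqP; split => w /=; [move=> [_ h] u; apply: h; rewrite inE|move=> h; split].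
  have -> : (fun _ : T => tt) @^-1` B = setT by apply/seteqP; split.
  by rewrite probability_setT mul1e.
have -> : [set w : T | B tt /\ (forall i, i \in [set: Idx]%SET -> A i (z0 i w))] = set0.
  by apply/seteqP; split => w //= [].
have -> : (fun _ : T => tt) @^-1` B = set0 by apply/seteqP; split.
by rewrite measure0 mul0e.
Qed.

(** Row l of this is kappa times the difference between the noise axis and the unit vector -(theta,
    1) / kappa, so its Householder map exchanges the two. Its squared norm is 2 kappa (1 + kappa),
    which explains the denominators below. Distinct rows have disjoint supports. *)
Let v1 (l : 'I_n) (u : Idx) (e : unit) : R :=
  match u with inl lj => (lj.1 == l)%:R * theta 0 lj.2 | inr l' => (l' == l)%:R * (1 + kappa) end.

Let dotp_sum (u v : Idx -> R) :
  dotp u v = \sum_l (\sum_j u (inl (l, j)) * v (inl (l, j)) + u (inr l) * v (inr l)).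
Proof.
rewrite /dotp big_sumType/= big_split/=; congr (_ + _).
by rewrite pair_big/=; apply: eq_bigr => -[].
Qed.

Let dotp_v1 l (u : Idx -> R) : dotp ((v1 l)^~ tt) u =
  \sum_j theta 0 j * u (inl (l, j)) + (1 + kappa) * u (inr l).
Proof.
rewrite dotp_sum (bigD1 l)//= [X in _ + X]big1 ?addr0; last first.
  move=> l' /negbTE l'l; rewrite l'l !mul0r addr0 big1// => j _.
  by rewrite !mul0r.
by rewrite eqxx mul1r; congr (_ + _); apply: eq_bigr => j _; rewrite mul1r.
Qed.

Let D l w := \sum_j theta 0 j * X l j w + (1 + kappa) * z0 (inr l) w.

(** The images under the row reflections. The noise entry has become Y_l up to a scalar, so the
    other entries are independent of Y. *)
Let z1 (u : Idx) (w : T) : R :=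
  match u with
  | inl lj => X lj.1 lj.2 w - D lj.1 w / (kappa * (1 + kappa)) * theta 0 lj.2
  | inr l => - (Y l w / (sigma * kappa))
  end.

Let mz1 u : measurable_fun setT (z1 u).
Proof.
case: u => [[l j]|l].
  apply: measurable_funB => //; apply: measurable_funM => //; apply: measurable_funM => //.
  apply: measurable_funD; first by apply: measurable_sum => i; apply: measurable_funM.
  by apply: measurable_funM => //; exact: (mz0 (inr l)).
by apply: measurableT_comp => //; apply: measurable_funM.
Qed.

Let z1_indep : normal_over P [set: Idx]%SET (fun=> tt) z1.
Proof.
have k0 : 0 < kappa by rewrite (lt_le_trans _ kappa_ge1).
have s0 : sigma != 0 by rewrite gt_eqF.
have := @normal_over_householders _ T R P _ unit Idx 'I_n [set: Idx]%SET (fun=> tt) z0 v1.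
move=> /(_ (measurable_cst _) mz0).
have mv : forall (l : 'I_n) (i : Idx), measurable_fun [set: unit] (v1 l i).
  by move=> l i; have -> : v1 l i = cst (v1 l i tt) by apply/funext => -[].
have vJ : forall (l : 'I_n) (i : Idx) (e : unit), i \notin [set: Idx]%SET -> v1 l i e = 0.
  by move=> l i e; rewrite inE.
have ov : forall (l l' : 'I_n) (e : unit), l != l' -> dotp ((v1 l)^~ e) ((v1 l')^~ e) = 0.
  move=> l l' [] ll'; rewrite dotp_v1.
  have -> : v1 l' (inr l) tt = 0 by rewrite /v1 (negbTE ll') mul0r.
  rewrite mulr0 addr0; apply: big1 => j _.
  by rewrite /v1/= (negbTE ll') mul0r mulr0.
move=> /(_ mv vJ ov z0_indep); congr (normal_over _ _ _ _).
apply/funext => u; apply/funext => w.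
have -> : \sum_l 2 * dotp ((v1 l)^~ tt) (z0^~ w) / dotp ((v1 l)^~ tt) ((v1 l)^~ tt) * v1 l u tt =
   \sum_l D l w / (kappa * (1 + kappa)) * v1 l u tt.
  apply: eq_bigr => l _; congr (_ * _).
  rewrite !dotp_v1 -[\sum_j theta 0 j * z0 _ _ + _]/(D l w).
  have -> : \sum_j theta 0 j * v1 l (inl (l, j)) tt + (1 + kappa) * v1 l (inr l) tt =
      2 * kappa * (1 + kappa).
    rewrite /v1/= eqxx mul1r; under eq_bigr do rewrite mul1r -expr2.
    have -> : \sum_j theta 0 j ^+ 2 = kappa ^+ 2 - 1 by rewrite kappa2 addrAC subrr add0r.
    by ring.
  have k1 : 1 + kappa != 0 by rewrite gt_eqF// addr_gt0.
  have k0' : kappa != 0 by rewrite gt_eqF.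
  field; first by rewrite k0' k1.
case: u => [[l j]|l]/=.
  rewrite (bigD1 l)//= big1 ?addr0; last by move=> l' /negbTE; rewrite eq_sym => ->; rewrite mul0r mulr0.
  by rewrite eqxx mul1r.
rewrite (bigD1 l)//= [X in _ - (_ + X)]big1 ?addr0;
  last by move=> l' /negbTE; rewrite eq_sym => ->; rewrite mul0r mulr0.
rewrite eqxx mul1r /D /=.
have k1 : 1 + kappa != 0 by rewrite gt_eqF// addr_gt0.
have k0' : kappa != 0 by rewrite gt_eqF.
field; by rewrite k0' k1 s0.
Qed.

Let l0 : 'I_n := Ordinal n_gt0.
Let nE (q : 'I_n -> R) := Num.sqrt (\sum_l q l ^+ 2).
(** The sign undoes that of [z1] at the noise indices, so that q = z1 there gives Y / |Y|. The
    default at 0 keeps a unit vector at every outcome. *)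
Let unitv (q : 'I_n -> R) (l : 'I_n) : R := if nE q == 0 then (l == l0)%:R else - q l / nE q.

Let unitv_norm q : \sum_l unitv q l ^+ 2 = 1.
Proof.
rewrite /unitv; case: eqP => [_|/eqP q0].
  rewrite (bigD1 l0)// eqxx expr1n big1 => [|l /negbTE ->]; first exact: addr0.
  by rewrite expr0n.
under eq_bigr do rewrite expr_div_n sqrrN.
rewrite -mulr_suml -[X in X / _]sqr_sqrtr ?divff ?sqrf_eq0//.
by apply: sumr_ge0 => l _; rewrite sqr_ge0.
Qed.

(* Row by row, the Householder reflection exchanging the unit vector of the noise
   with -(theta, 1) / kappa sends (X_l, xi_l / sigma) to a standard Gaussian vector
   with last entry - Y_l / (sigma kappa), and X_l j is an explicit combination of
   its entries. The other entries, projected on Y / |Y|, form [g]; this family is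
   independent of Y by rotation invariance. *)
Lemma regression_representation :
  exists (g : 'I_p -> T -> R) (eta : 'I_n -> T -> R),
  [/\ (forall A : 'I_p -> set R, (forall j, measurable (A j)) ->
        P [set w | forall j, A j (g j w)] = (\prod_j normal_prob 0 1 (A j))%E),
     (forall A : 'I_n -> set R, (forall l, measurable (A l)) ->
        P [set w | forall l, A l (eta l w)] = (\prod_l normal_prob 0 1 (A l))%E),
     (forall j, measurable_fun setT (g j)) /\ (forall l, measurable_fun setT (eta l)),
     (forall w, \sum_l eta l w ^+ 2 = (normY w / (sigma * kappa)) ^+ 2) &
     forall w, normY w != 0 -> forall j,
       HC_y (\matrix_(i, j) reg_X M i j w) (\col_i reg_Y M i w) j =
       g j w + theta 0 j * (normY w / (sigma * kappa ^+ 2) -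
         (\sum_i theta 0 i * g i w) / (kappa * (1 + kappa)))].
Proof.
have k0 : 0 < kappa by rewrite (lt_le_trans _ kappa_ge1).
have s0 : sigma != 0 by rewrite gt_eqF.
have k1 : 1 + kappa != 0 by rewrite gt_eqF// addr_gt0.
have k0' : kappa != 0 by rewrite gt_eqF.
(* With the noise entries absorbed, W determines Y up to scale, and the design entries of [z1] are
   still Gaussian given W. *)
pose K : {set Idx} := [set u : Idx | if u is inr _ then true else false]%SET.
have [d' [E [W [f [mW mf fz Wz]]]]] := normal_over_absorb_set (finset.subsetT K)
  (measurable_cst _) mz1 z1_indep.
have KJ : [set: Idx]%SET :\: K = ~: K by rewrite finset.setTD.
rewrite KJ in Wz.
pose ue (e : E) := unitv (fun l => f (inr l) e).
have mue l : measurable_fun setT (ue^~ l).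
  have mn : measurable_fun setT (fun e => nE (fun l => f (inr l) e)).
    apply: (measurableT_comp measurable_sqrtr); apply: measurable_sum => i.
    by apply: measurable_funX; exact: mf.
  apply: measurable_fun_ifT => //; first exact: measurable_fun_eqr.
  by apply: measurable_fun_div => //; apply: measurableT_comp => //; exact: mf.
(* In column j this vector exchanges the direction [ue] of Y with the axis l0; the entry l0 of the
   reflected column is therefore its projection on that direction, which is [g]. *)
pose v2 (j : 'I_p) (u : Idx) (e : E) : R :=
  if u is inl lj then (lj.2 == j)%:R * (ue e lj.1 - (lj.1 == l0)%:R) else 0.
have mv2 j u : measurable_fun setT (v2 j u).
  case: u => [[l i]|l]; last exact: measurable_cst.
  by apply: measurable_funM => //; exact: measurable_funB.
have v2J j u e : u \notin ~: K -> v2 j u e = 0.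
  by case: u => [lj|l]//; rewrite !inE.
have dotp_v2 j e (u : Idx -> R) : dotp ((v2 j)^~ e) u =
    \sum_l ue e l * u (inl (l, j)) - u (inl (l0, j)).
  rewrite dotp_sum.
  transitivity (\sum_l (ue e l * u (inl (l, j)) - (l == l0)%:R * u (inl (l, j)))).
    apply: eq_bigr => l _; rewrite (bigD1 j)//= [X in _ + X + _]big1 ?addr0; last first.
      by move=> i /negbTE ->; rewrite !mul0r.
    by rewrite mul0r addr0 eqxx mul1r mulrBl.
  rewrite sumrB; congr (_ - _); rewrite (bigD1 l0)// eqxx mul1r big1 => [|l /negbTE ->].
    exact: addr0.
  by rewrite mul0r.
have ov j j' e : j != j' -> dotp ((v2 j)^~ e) ((v2 j')^~ e) = 0.
  move=> jj'; rewrite dotp_v2 /v2/= (negbTE jj') mul0r subr0 big1// => l _.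
  by rewrite mul0r mulr0.
have := normal_over_householders mW mz1 mv2 v2J ov Wz.
set z2 := fun k w => _ => Wz2.
pose g j w := \sum_l ue (W w) l * z1 (inl (l, j)) w.
have z2g j w : z2 (inl (l0, j)) w = g j w.
  rewrite /z2 (bigD1 j)// [X in _ - (_ + X)]big1 => [|i ij]; last first.
    have -> : v2 i (inl (l0, j)) (W w) = 0 by rewrite /v2/= eq_sym (negbTE ij) mul0r.
    by rewrite mulr0.
  rewrite [X in _ - X]addr0.
  rewrite !dotp_v2 -/(g j w).
  have -> : \sum_l ue (W w) l * v2 j (inl (l, j)) (W w) - v2 j (inl (l0, j)) (W w) =
      2 - 2 * ue (W w) l0.
    have -> : v2 j (inl (l0, j)) (W w) = ue (W w) l0 - 1 by rewrite /v2 !eqxx mul1r.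
    have -> : \sum_l ue (W w) l * v2 j (inl (l, j)) (W w) = 1 - ue (W w) l0.
      rewrite -[X in X - _](unitv_norm (fun l => f (inr l) (W w))).
      have -> : ue (W w) l0 = \sum_l ue (W w) l * (l == l0)%:R.
        rewrite (bigD1 l0)// eqxx mulr1 big1 => [|l /negbTE ->]; last exact: mulr0.
        by rewrite [RHS]addr0.
      by rewrite -sumrB; apply: eq_bigr => l _; rewrite /v2 eqxx mul1r mulrBr expr2.
    by ring.
  have -> : v2 j (inl (l0, j)) (W w) = ue (W w) l0 - 1 by rewrite /v2 !eqxx mul1r.
  (* If [ue] is the axis l0 itself, the Householder vector vanishes and the reflection is the
     identity; otherwise its squared norm 2 - 2 u_l0 is nonzero. *)
  have [u1|u1] := eqVneq (ue (W w) l0) 1.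
    rewrite u1 subrr mulr0 subr0.
    have u0 l : l != l0 -> ue (W w) l = 0.
      move=> ll0; have hs : \sum_l ue (W w) l ^+ 2 = 1 by exact: unitv_norm.
      have hs' : \sum_(l | l != l0) ue (W w) l ^+ 2 = 0.
        by move: hs; rewrite (bigD1 l0)// u1 expr1n /= => h; lra.
      move/psumr_eq0P : hs' => h.
      by apply/eqP; rewrite -sqrf_eq0; apply/eqP/h => // i _; exact: sqr_ge0.
    rewrite /g (bigD1 l0)// u1 mul1r big1 => [|l /u0 ->]; last exact: mul0r.
    by rewrite [RHS]addr0.
  by field; rewrite -[X in X - _]mulr1 -mulrBr mulf_neq0// subr_eq0 eq_sym.
have mg j : measurable_fun setT (g j).
  apply: measurable_sum => l; apply: measurable_funM => //.
  exact: (measurableT_comp (mue l)).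
exists g, (fun l => z1 (inr l)); split.
- move=> A mA; rewrite -(normal_over_iid _ _ Wz2 mA (f := fun j => inl (l0, j))); last 2 first.
  + by move=> i j [].
  + by move=> j; rewrite !inE.
  by congr (P _); apply/seteqP; split => w /= h j; have := h j; rewrite z2g.
- move=> A mA; apply: (normal_over_iid _ _ z1_indep mA (f := inr)).
  + by move=> i j [].
  + by move=> j; rewrite !inE.
- by split => // l; exact: mz1.
- move=> w; rewrite expr_div_n.
  have -> : normY w ^+ 2 = \sum_l Y l w ^+ 2.
    rewrite sqr_sqrtr; last by apply: sumr_ge0 => l _; exact: sqr_ge0.
    by apply: eq_bigr => l _; rewrite !mxE.
  by rewrite mulr_suml; apply: eq_bigr => l _; rewrite /z1 sqrrN expr_div_n.
move=> w Y0 j.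
have nY2 : normY w ^+ 2 = \sum_l Y l w ^+ 2.
  rewrite sqr_sqrtr; last by apply: sumr_ge0 => l _; exact: sqr_ge0.
  by apply: eq_bigr => l _; rewrite !mxE.
have nY0 : 0 <= normY w by exact: sqrtr_ge0.
have nEY : nE (fun l => f (inr l) (W w)) = normY w / (sigma * kappa).
  rewrite /nE -[RHS]ger0_norm; last by rewrite divr_ge0// mulr_ge0// ltW.
  rewrite -sqrtr_sqr expr_div_n nY2 mulr_suml; congr Num.sqrt.
  by apply: eq_bigr => l _; rewrite fz ?inE// /z1 sqrrN expr_div_n.
have ueY l : ue (W w) l = Y l w / normY w.
  rewrite /ue /unitv nEY mulf_eq0 (negbTE Y0)/= invr_eq0 mulf_eq0 (negbTE s0) (negbTE k0')/=.
  by rewrite fz ?inE// /z1; field; rewrite Y0 s0 k0'.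
pose y j := \sum_l ue (W w) l * X l j w.
have HCy i : HC_y (\matrix_(i, j) reg_X M i j w) (\col_i reg_Y M i w) i = y i.
  rewrite /HC_y -/(normY w) mulr_suml; apply: eq_bigr => l _.
  by rewrite !mxE ueY mulrAC.
rewrite HCy.
pose t := (\sum_l ue (W w) l * D l w) / (kappa * (1 + kappa)).
have yE i : y i = g i w + theta 0 i * t.
  rewrite /y /g /t mulrA [theta 0 i * _]mulr_sumr mulr_suml -big_split; apply: eq_bigr => l _ /=.
  by rewrite /z1/=; ring.
rewrite yE; congr (_ + _ * _).
(* Since D = (1 + kappa) Y / sigma - kappa (X theta), and the projection of X theta is the sum of
   the theta_i y_i with y_i = g_i + theta_i t, the number t satisfies a linear equation, which is
   then solved using |theta|^2 = kappa^2 - 1. *)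
have tE : t * (kappa * (1 + kappa)) = (1 + kappa) * normY w / sigma -
    kappa * (\sum_i theta 0 i * g i w + (kappa ^+ 2 - 1) * t).
  rewrite {1}/t divfK ?mulf_neq0//.
  have -> : kappa ^+ 2 - 1 = \sum_i theta 0 i ^+ 2 by rewrite kappa2 addrAC subrr add0r.
  have -> : \sum_i theta 0 i * g i w + (\sum_i theta 0 i ^+ 2) * t = \sum_i theta 0 i * y i.
    by rewrite mulr_suml -big_split; apply: eq_bigr => i _ /=; rewrite yE; ring.
  have -> : \sum_i theta 0 i * y i = \sum_l ue (W w) l * \sum_i theta 0 i * X l i w.
    under eq_bigr do rewrite /y mulr_sumr.
    rewrite exchange_big/=; apply: eq_bigr => l _; rewrite mulr_sumr.
    by apply: eq_bigr => i _; rewrite mulrCA.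
  have -> : normY w = \sum_l ue (W w) l * Y l w.
    under eq_bigr do rewrite ueY mulrAC -expr2.
    by rewrite -mulr_suml -nY2 expr2 mulfK.
  rewrite [(1 + kappa) * _]mulr_sumr mulr_suml [kappa * _]mulr_sumr -sumrB.
  by apply: eq_bigr => l _; rewrite /D /z0; ring.
have h : kappa ^+ 2 * (1 + kappa) != 0 by rewrite mulf_neq0// expf_neq0.
apply: (mulIf h).
have -> : t * (kappa ^+ 2 * (1 + kappa)) =
    (1 + kappa) * normY w / sigma - kappa * \sum_i theta 0 i * g i w.
  have -> : t * (kappa ^+ 2 * (1 + kappa)) =
     t * (kappa * (1 + kappa)) + kappa * ((kappa ^+ 2 - 1) * t) by ring.
  by rewrite tE; ring.
by field; rewrite k1 k0' s0.
Qed.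

End Regression.

(** * Chernoff bound and level crossings of counts *)

Section ProductLaw.
Context d (T : measurableType d) {R : realType} (P : probability T R) (I : finType).

Definition iid_normal (g : I -> T -> R) : Prop :=
  (forall j, measurable_fun setT (g j)) /\
  forall A : I -> set R, (forall j, measurable (A j)) ->
    P [set w | forall j, A j (g j w)] = (\prod_j normal_prob 0 1 (A j))%E.

Definition nprob (A : set R) : R := fine (normal_prob 0 1 A).

Lemma nprobE A : measurable A -> normal_prob 0 1 A = (nprob A)%:E.
Proof. by move=> mA; rewrite /nprob fineK// fin_num_measure. Qed.

Lemma nprob_ge0 A : 0 <= nprob A.
Proof. by rewrite /nprob fine_ge0. Qed.

(** An event that depends on each g_j only through a finite code is a finite union of boxes. It is
    measurable, and its probability is a finite sum, which turns the tail and crossing bounds into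
    algebra and counting. *)
Lemma iid_normal_ffun_law (K : finType) (g : I -> T -> R) (c : I -> R -> K)
    (D : pred {ffun I -> K}) : iid_normal g ->
  (forall j k, measurable (c j @^-1` [set k])) ->
  measurable [set w | D [ffun j => c j (g j w)]] /\
  P [set w | D [ffun j => c j (g j w)]] =
  (\sum_(f : {ffun I -> K} | D f) \prod_j nprob (c j @^-1` [set f j]))%:E.
Proof.
move=> [mg ig] mc.
pose F (f : {ffun I -> K}) := [set w | forall j, (c j @^-1` [set f j]) (g j w)].
have mF f : measurable (F f).
  have -> : F f = \bigcap_(j in [set: I]) (g j @^-1` (c j @^-1` [set f j])).
    by apply/seteqP; split => w /= h j; [move=> _; exact: h|exact: (h j)].
  apply: fin_bigcap_measurable; first exact: finite_finset.
  by move=> j _; exact: measurable_preimage.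
have FE : [set w | D [ffun j => c j (g j w)]] = \bigcup_(f in [set` D]) F f.
  apply/seteqP; split => w /=.
    by move=> Dw; exists [ffun j => c j (g j w)] => //= j; rewrite ffunE.
  move=> [f Df Fw]; have -> : [ffun j => c j (g j w)] = f by apply/ffunP => j; rewrite ffunE; exact: Fw.
  exact: Df.
have fD : finite_set [set` D] by exact: finite_finset.
split.
  by rewrite FE; apply: fin_bigcup_measurable.
rewrite FE measure_fin_bigcup//; last first.
  move=> f f' _ _ [w [h h']]; apply/ffunP => j.
  by have := h j; have := h' j => /= -> ->.
rewrite -(@bigfs _ _ _ _ (index_enum {ffun I -> K}) D (fun f => P (F f)))//; last 2 first.
- exact: index_enum_uniq.
- by move=> f _; rewrite mem_index_enum.
rewrite -sumEFin; apply: eq_bigr => f _.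
rewrite (ig (fun j => c j @^-1` [set f j])); last by move=> j; exact: mc.
by rewrite -prodEFin; apply: eq_bigr => j _; apply: nprobE; exact: mc.
Qed.

End ProductLaw.

Section Chernoff.
Context d (T : measurableType d) {R : realType} (P : probability T R) (I : finType).

Lemma expR_neg_le (s : R) : 0 <= s -> expR (- s) <= 1 - s + s ^+ 2.
Proof.
move=> s0; have e0 : 0 < expR s by exact: expR_gt0.
rewrite expRN -(ler_pM2r e0) mulVf ?gt_eqF//.
apply: (@le_trans _ _ ((1 - s + s ^+ 2) * (1 + s))).
  have -> : (1 - s + s ^+ 2) * (1 + s) = 1 + s ^+ 3 by ring.
  by rewrite lerDl exprn_ge0.
by apply: ler_wpM2l; [nra|exact: expR_ge1Dx].
Qed.

Lemma chernoff_lower (g : I -> T -> R) (E : I -> set R) (delta mu : R) :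
  iid_normal P g -> (forall j, measurable (E j)) ->
  mu = \sum_j nprob (E j) -> 0 <= delta -> 0 < mu ->
  let D := [set w | \sum_j (\1_(E j) (g j w) : R) <= mu - delta] in
  measurable D /\ (P D <= (expR (- (delta ^+ 2 / (4 * mu))))%:E)%E.
Proof.
move=> ig mE muE d0 mu0 /=.
pose c j (x : R) : bool := x \in E j.
pose D (f : {ffun I -> bool}) := \sum_j (f j)%:R <= mu - delta.
have ct j : c j @^-1` [set true] = E j.
  by apply/seteqP; split => x; rewrite /c/=; [move=> /set_mem|move=> /mem_set].
have cf j : c j @^-1` [set false] = ~` E j.
  apply/seteqP; split => x; rewrite /c/=; first by move/negbT; rewrite notin_setE.
  by move=> h; apply/negbTE; rewrite notin_setE.
have mc j k : measurable (c j @^-1` [set k]).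
  by case: k; rewrite ?ct ?cf//; exact: measurableC.
have [mD PD] := iid_normal_ffun_law D ig mc.
have -> : [set w | \sum_j (\1_(E j) (g j w) : R) <= mu - delta] = [set w | D [ffun j => c j (g j w)]].
  have DE w : D [ffun j => c j (g j w)] = (\sum_j (\1_(E j) (g j w) : R) <= mu - delta).
    by rewrite /D; congr (_ <= _); apply: eq_bigr => k _; rewrite ffunE indicE.
  by apply/seteqP; split => w /=; rewrite DE.
split=> //; rewrite PD lee_fin.
(* Minimiser of s^2 mu - s delta, the exponent left by exp (- s) <= 1 - s + s^2. *)
pose s := delta / (2 * mu).
have s0 : 0 <= s by rewrite divr_ge0// mulr_ge0// ltW.
pose pi j (b : bool) := nprob (c j @^-1` [set b]).
have pi1 j : pi j true = nprob (E j) by rewrite /pi ct.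
have pi0 j : pi j false = 1 - nprob (E j).
  have : normal_prob 0 1 (~` E j) = (1 - normal_prob 0 1 (E j))%E.
    exact: (probability_setC (normal_prob 0 1) (mE j)).
  by rewrite /pi cf (nprobE (measurableC (mE j))) (nprobE (mE j)) -EFinB => -[].
apply: (@le_trans _ _ (\sum_(f : {ffun I -> bool})
    expR (s * (mu - delta)) * \prod_j (expR (- s * (f j)%:R) * pi j (f j)))).
  rewrite big_mkcond/=; apply: ler_sum => f _.
  have pi_ge0 : 0 <= \prod_j pi j (f j) by apply: prodr_ge0 => j _; exact: nprob_ge0.
  case: ifPn => [Df|_]; last first.
    rewrite mulr_ge0 ?expR_ge0//; apply: prodr_ge0 => j _.
    by rewrite mulr_ge0 ?expR_ge0// nprob_ge0.
  rewrite big_split/= mulrA ler_peMl//.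
  rewrite -expR_sum -expRD -[X in X <= _]expR0 ler_expR -mulr_sumr mulNr -mulrBr.
  by rewrite mulr_ge0// subr_ge0.
rewrite -mulr_sumr -(bigA_distr_bigA (fun (j : I) (b : bool) => expR (- s * b%:R) * pi j b))/=.
apply: (@le_trans _ _ (expR (s * (mu - delta)) * \prod_j expR (- (s - s ^+ 2) * nprob (E j)))).
  rewrite ler_wpM2l ?expR_ge0//; apply: ler_prod => j _.
  rewrite big_bool/= pi1 pi0 mulr0 expR0 mul1r mulr1 addr_ge0//; last 2 first.
  - by rewrite mulr_ge0 ?expR_ge0 ?nprob_ge0.
  - by rewrite -pi0 nprob_ge0.
  apply: (@le_trans _ _ (1 + (- (s - s ^+ 2) * nprob (E j)))); last exact: expR_ge1Dx.
  have := ler_wpM2r (nprob_ge0 (E j)) (expR_neg_le s0); lra.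
rewrite -expR_sum -expRD ler_expR -mulr_sumr -muE /s.
have -> : delta / (2 * mu) * (mu - delta) + - (delta / (2 * mu) - (delta / (2 * mu)) ^+ 2) * mu =
  - (delta ^+ 2 / (4 * mu)) by field; rewrite gt_eqF.
exact: lexx.
Qed.

End Chernoff.

(** * A maximal inequality proved by counting *)

Section Counting.
Context {R : realType}.

Lemma sum_subset_exp (I : finType) (B : {set I}) (y : R) :
  \sum_(J : {set I} | J \subset B) y ^+ #|J| = (1 + y) ^+ #|B|.
Proof.
rewrite -[RHS]prodr_const.
have -> : \prod_(i in B) (1 + y) = \prod_i ((if i \in B then y else 0) + 1).
  rewrite big_mkcond/=; apply: eq_bigr => i _; case: ifP => _; first by rewrite addrC.
  by rewrite add0r.
rewrite bigA_distr big_mkcond/=; apply: eq_bigr => J _.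
case: ifPn => [JB|/subsetPn[i iJ iB]]; last first.
  by rewrite (bigD1 i)//= iJ (negbTE iB) mul0r.
rewrite -big_mkcond/= -[LHS]prodr_const; apply: eq_bigr => i iJ.
by rewrite (fintype.subsetP JB).
Qed.

Section Cells.
Variables (I : finType) (M : nat) (x C : R).
Hypotheses (x0 : 0 <= x) (C0 : 0 < C).
Implicit Types (f : {ffun I -> 'I_M.+1}) (B : {set I}).

Definition cell_count f (i : nat) : nat := #|[pred j | (f j <= i)%N]|.

(** Level i stands for u = (i + 1) / M, and x for M times the parameter of the martingale. *)
Definition crossing (m : nat) f : bool :=
  [exists i : 'I_M.+1, (i < m)%N && (C <= (1 + x / i.+1%:R) ^+ cell_count f i)].

(** Points outside B are parked in the last cell, which no level below M counts; points can thus be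
    dropped in an induction without changing the type of the maps. *)
Let cells B (m : nat) : {set {ffun I -> 'I_M.+1}} :=
  [set f : {ffun I -> 'I_M.+1} | [forall j, if j \in B then (f j < m)%N else f j == ord_max]]%SET.

Let card_cells B m : (m <= M)%N -> #|cells B m| = (m ^ #|B|)%N.
Proof.
move=> mM.
have -> : #|cells B m| = #|family (fun j => if j \in B then [pred k : 'I_M.+1 | (k < m)%N] else pred1 ord_max)|.
  apply: eq_card => f; rewrite inE; apply/forallP/familyP => h j; have := h j;
  by case: (j \in B); rewrite /= !inE.
rewrite card_family foldrE big_map.
have -> : (m ^ #|B|)%N = (\prod_(j in B) m)%N by rewrite prod_nat_const.
rewrite big_enum/= [RHS]big_mkcond/=; apply: eq_bigr => j _; case: ifP => _; last exact: card1.
rewrite -[RHS](card_ord m).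
have wi : injective (widen_ord (leqW mM)) by move=> a b /(congr1 val) /= /val_inj.
rewrite -(card_imset _ wi); apply: eq_card => k; rewrite !inE.
apply/idP/imsetP => [km|[k' _ ->]/=]; last exact: ltn_ord.
by exists (Ordinal km) => //; exact: val_inj.
Qed.

(* Discrete Doob inequality for the reverse martingale [(1 + x / u) ^ N(u)]: either
   the constraint at the top level [m] is crossed, deterministically, or the points
   below the level [m] form a smaller instance of the same problem. *)
Lemma crossing_card_le B m : (m <= M)%N ->
  #|[set f in cells B m | crossing m f]|%:R * C <= (m%:R + x) ^+ #|B|.
Proof.
elim: m B => [|m IH] B mM.
  rewrite (_ : #|_| = 0%N) ?mul0r ?exprn_ge0// ?add0r//.
  apply: eq_card0 => f; rewrite !inE; apply/negP => /andP[_ /existsP[i]].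
  by rewrite ltn0.
(* If the full count of B crosses at the top level, the bound already holds for all (m + 1)^|B|
   maps. *)
have [top|top] := leP C ((1 + x / m.+1%:R) ^+ #|B|).
  apply: (@le_trans _ _ ((m.+1 ^ #|B|)%:R * (1 + x / m.+1%:R) ^+ #|B|)).
    apply: ler_pM => //; first exact: ltW.
    rewrite ler_nat -(card_cells _ mM); apply: subset_leq_card.
    by apply/fintype.subsetP => f; rewrite inE => /andP[].
  rewrite natrX -exprMn mulrDr mulr1 mulrCA divff ?mulr1// pnatr_eq0//.
(* Otherwise any crossing occurs below the top level. The maps are sorted by the set J of their
   points below m; the points of B outside J all sit in cell m, so parking them loses no
   information. The bounds (m + x)^|J| add up to (m + 1 + x)^|B| by the binomial formula. *)
pose low f : {set I} := [set j | (f j < m)%N]%SET.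
pose trunc f : {ffun I -> 'I_M.+1} := [ffun j => if (f j < m)%N then f j else ord_max].
have step : (#|[set f in cells B m.+1 | crossing m.+1 f]| <=
    \sum_(J : {set I} | J \subset B) #|[set f in cells J m | crossing m f]|)%N.
  have lowB f : f \in cells B m.+1 -> low f \subset B.
    rewrite inE => /forallP h; apply/fintype.subsetP => j; rewrite inE => fm.
    have := h j; case: ifPn => // _ /eqP fM; move: fm; rewrite fM /=.
    by rewrite ltnNge (leq_trans (leqnSn m) mM).
  rewrite -sum1_card (partition_big low (fun J => J \subset B))/=; last first.
    by move=> f; rewrite !inE => /andP[fB _]; apply: lowB; rewrite inE.
  apply: leq_sum => J JB; rewrite sum1_card.
  have tinj : {in [pred f in cells B m.+1 | low f == J] &, injective trunc}.
    move=> f f'; rewrite !inE => /andP[/forallP fB /eqP fJ] /andP[/forallP fB' /eqP fJ'] /ffunP ff'.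
    apply/ffunP => j; have := ff' j; rewrite !ffunE.
    have Ef : (f' j < m)%N = (f j < m)%N.
      by have := erefl (j \in low f); rewrite {1}fJ -fJ' !inE.
    rewrite Ef; case: ifPn => // fm _; have := fB j; have := fB' j.
    have fm' : ~~ (f' j < m)%N by rewrite Ef.
    case: (j \in B); last by move=> /eqP -> /eqP ->.
    move=> h h'; apply: val_inj => /=; apply/eqP.
    rewrite -leqNgt in fm; rewrite -leqNgt in fm'; rewrite ltnS in h; rewrite ltnS in h'.
    by rewrite eqn_leq (leq_trans h' fm') (leq_trans h fm).
  apply: (@leq_trans #|[set trunc f |
    f in [pred f in [set f in cells B m.+1 | crossing m.+1 f] | low f == J]]|%SET).
    rewrite card_in_imset; last first.
      move=> f f'; rewrite !inE => /andP[/andP[h1 _] h2] /andP[/andP[h1' _] h2'].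
      by apply: tinj; rewrite inE ?h2 ?h2' inE ?h1 ?h1'.
    by apply: eq_leq; apply: eq_card => f; rewrite !inE.
  apply: subset_leq_card; apply/fintype.subsetP => _ /imsetP[f + ->].
  rewrite !inE => /andP[/andP[/forallP fB /existsP[i /andP[im Ci]]] /eqP fJ].
  have iJ : (i < m)%N.
    move: im; rewrite ltnS leq_eqVlt => /orP[/eqP im|//].
    move: Ci; rewrite im leNgt => /negP; case; apply: le_lt_trans top.
    rewrite ler_weXn2l ?lerDl ?divr_ge0//.
    apply: subset_leq_card; apply/fintype.subsetP => j; rewrite inE => fm.
    apply: contraLR fm => jB; have := fB j; rewrite (negbTE jB) => /eqP ->.
    by rewrite -ltnNge.
  apply/andP; split.
    apply/forallP => j; rewrite ffunE -fJ inE.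
    by case: ifP => // fm; rewrite fm.
  apply/existsP; exists i; rewrite iJ; apply: (le_trans Ci).
  rewrite le_eqVlt; apply/orP; left; apply/eqP; congr (_ ^+ _).
  apply: eq_card => j; rewrite !inE ffunE; case: ifPn => // fm.
  have fi : (i < f j)%N by apply: leq_trans iJ _; rewrite leqNgt.
  have Mi : (i < M)%N by apply: leq_trans iJ _; exact: ltnW.
  have Mi' : (i < (ord_max : 'I_M.+1))%N by [].
  by apply/idP/idP; rewrite leqNgt ?fi ?Mi'.
apply: (@le_trans _ _ (\sum_(J : {set I} | J \subset B) (m%:R + x) ^+ #|J|)).
  apply: (@le_trans _ _ ((\sum_(J : {set I} | J \subset B) #|[set f in cells J m | crossing m f]|)%:R * C)).
    by rewrite ler_pM2r// ler_nat.
  rewrite natr_sum mulr_suml; apply: ler_sum => J _; apply: IH; exact: ltnW.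
by rewrite sum_subset_exp addrA -natr1 [1 + _]addrC.
Qed.

End Cells.
End Counting.

(** * Gaussian tails and p-values *)

Section GaussianTail.
Context {R : realType}.
Local Notation N := (@normal_prob R 0 1).
Local Notation leb := (@lebesgue_measure R).
Implicit Types (s t u x : R) (A B : set R).

Lemma nprob_le A B : measurable A -> measurable B -> A `<=` B -> nprob A <= nprob B.
Proof.
move=> mA mB AB; rewrite -lee_fin -(nprobE mA) -(nprobE mB).
by apply: le_measure; rewrite ?inE.
Qed.

Lemma nprobU A B : measurable A -> measurable B -> A `&` B = set0 ->
  nprob (A `|` B) = nprob A + nprob B.
Proof.
move=> mA mB AB; have mU : measurable (A `|` B) by exact: measurableU.
apply/EFin_inj; rewrite EFinD -(nprobE mA) -(nprobE mB) -(nprobE mU).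
exact: (measureU (normal_prob 0 1) mA mB AB).
Qed.

Lemma nprobT : nprob [set: R] = 1.
Proof. by rewrite /nprob (@probability_setT _ _ R (normal_prob 0 1)). Qed.

Lemma nprob_opp A : measurable A -> nprob (-%R @^-1` A) = nprob A.
Proof. by move=> mA; rewrite /nprob normal_prob_opp. Qed.

Lemma measurable_lt_norm t : measurable [set z : R | t < `|z|].
Proof.
have -> : [set z : R | t < `|z|] = Num.norm @^-1` [set` `]t, +oo[].
  by apply/seteqP; split => z /=; rewrite in_itv/= andbT.
by apply: measurable_preimage; [exact: normr_measurable|exact: measurable_itv].
Qed.

Let peak : R := normal_peak 1.

Let peak_gt0 : 0 < peak. Proof. by apply: normal_peak_gt0; rewrite oner_eq0. Qed.

Let pdfE x : normal_pdf 0 1 x = peak * expR (- (x ^+ 2 / 2)).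
Proof. by rewrite normal_pdfE ?oner_eq0// /normal_fun subr0 expr1n mulNr. Qed.

Lemma nprob_itv_lb s t : 0 <= s -> s <= t ->
  (t - s) * (peak * expR (- (t ^+ 2 / 2))) <= nprob [set` `]s, t]].
Proof.
move=> s0 st; rewrite -lee_fin -nprobE; last exact: measurable_itv.
rewrite /normal_prob.
apply: (@le_trans _ _ (\int[leb]_(x in [set` `]s, t]]) (peak * expR (- (t ^+ 2 / 2)))%:E)%E).
  rewrite integral_cst//= lebesgue_measure_itv/= lte_fin.
  move: st; rewrite le_eqVlt => /orP[/eqP ->|st]; first by rewrite ltxx subrr mul0r mule0.
  by rewrite st -EFinB -EFinM mulrC.
apply: ge0_le_integral => //=.
- by move=> x _; rewrite lee_fin mulr_ge0 ?expR_ge0// ltW.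
- by apply/measurable_EFinP; apply: measurable_funTS; exact: measurable_normal_pdf.
- move=> x; rewrite in_itv/= => /andP[sx xt]; rewrite lee_fin pdfE.
  rewrite ler_pM2l// ler_expR lerN2 ler_pM2r// ler_sqr ?nnegrE//; first exact: (le_trans s0 (ltW sx)).
  exact: (le_trans s0 st).
Qed.

Lemma nprob_itv_ub s t : s <= t -> nprob [set` `]s, t]] <= (t - s) * peak.
Proof.
move=> st; rewrite -lee_fin -nprobE; last exact: measurable_itv.
rewrite /normal_prob.
apply: (@le_trans _ _ (\int[leb]_(x in [set` `]s, t]]) peak%:E)%E).
  apply: ge0_le_integral => //=.
  - by move=> x _; rewrite lee_fin normal_pdf_ge0.
  - by apply/measurable_EFinP; apply: measurable_funTS; exact: measurable_normal_pdf.
  - by move=> x _; rewrite lee_fin normal_pdf_ub// oner_eq0.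
rewrite integral_cst//= lebesgue_measure_itv/= lte_fin.
move: st; rewrite le_eqVlt => /orP[/eqP ->|st]; first by rewrite ltxx subrr mul0r mule0.
by rewrite st -EFinB -EFinM mulrC.
Qed.

Lemma nprob_set1 x : nprob [set x] = 0.
Proof.
apply/eqP; rewrite eq_le nprob_ge0 andbT; apply/ler_addgt0Pr => e e0; rewrite add0r.
have h : 0 < e / peak by rewrite divr_gt0.
apply: (@le_trans _ _ (nprob [set` `](x - e / peak), x]])).
  apply: nprob_le => //.
  by move=> y /= ->; rewrite in_itv/= lexx andbT ltrBlDr ltrDl.
apply: (le_trans (nprob_itv_ub _)); first by rewrite lerBlDr lerDl ltW.
by rewrite opprB addrC subrK divfK// gt_eqF.
Qed.

(** Translation by t: for x > 0 the density at x + t is at most expR (- t^2 / 2) times the density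
    at x. *)
Lemma nprob_gt_ub t : 0 <= t -> nprob [set` `]t, +oo[] <= expR (- (t ^+ 2 / 2)).
Proof.
move=> t0.
have mI : measurable [set` `]t, +oo[] by exact: measurable_itv.
rewrite -lee_fin -nprobE// (normal_probT _ _ mI).
have mf : measurable_fun [set: R] (fun x => ((\1_[set` `]t, +oo[] x)%:E * (normal_pdf 0 1 x)%:E)%E).
  apply: emeasurable_funM; apply/measurable_EFinP; first exact: measurable_indic.
  exact: measurable_normal_pdf.
rewrite (@integral_affine _ _ 1 t _ mf) ?oner_eq0//; last first.
  by move=> x; rewrite -EFinM lee_fin mulr_ge0// normal_pdf_ge0.
rewrite normr1 mul1e.
apply: (@le_trans _ _ (\int[leb]_x ((expR (- (t ^+ 2 / 2)))%:E * (normal_pdf 0 1 x)%:E))%E).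
  apply: ge0_le_integral => //.
  - by move=> x _; rewrite -EFinM lee_fin mulr_ge0// normal_pdf_ge0.
  - by apply: (measurableT_comp mf); exact: measurable_affine.
  - by apply: emeasurable_funM => //; apply/measurable_EFinP; exact: measurable_normal_pdf.
  - move=> x _; rewrite -!EFinM lee_fin indicE mul1r.
    case: (boolP (_ \in _)) => [|_]; last by rewrite mul0r mulr_ge0 ?expR_ge0 ?normal_pdf_ge0.
    rewrite inE/= in_itv/= andbT ltrDr => x0.
    rewrite mul1r !pdfE mulrCA ler_pM2l// -expRD ler_expR; nra.
rewrite ge0_integralZl//; last 2 first.
- by apply/measurable_EFinP; exact: measurable_normal_pdf.
- by move=> x _; rewrite lee_fin normal_pdf_ge0.
by rewrite integral_normal_pdf mule1.
Qed.

Definition gtail t : R := nprob [set z : R | t < `|z|].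

Lemma gtail_ub t : 0 <= t -> gtail t <= 2 * expR (- (t ^+ 2 / 2)).
Proof.
move=> t0; have mI : measurable [set` `]t, +oo[] by exact: measurable_itv.
have -> : gtail t = 2 * nprob [set` `]t, +oo[].
  rewrite mulrDl mul1r -{2}(nprob_opp mI) -nprobU//; last 2 first.
  - by rewrite -[X in measurable X]setTI; apply: oppr_measurable.
  - by apply/seteqP; split => x //=; rewrite !in_itv/= !andbT => -[h1 h2]; lra.
  congr nprob; apply/seteqP; split => x /=; rewrite !in_itv/= !andbT.
    by case: (leP 0 x) => x0; [rewrite ger0_norm//; left|rewrite ltr0_norm//; right].
  by move=> [h|h]; [rewrite gtr0_norm//; lra|rewrite ltr0_norm//; lra].
by rewrite ler_pM2l// nprob_gt_ub.
Qed.

Lemma gtailB s t : 0 <= s -> s <= t ->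
  gtail s - gtail t = nprob [set z : R | s < `|z| <= t].
Proof.
move=> s0 st.
have mst : measurable [set z : R | s < `|z| <= t].
  have -> : [set z : R | s < `|z| <= t] = [set z : R | s < `|z|] `&` ~` [set z : R | t < `|z|].
    apply/seteqP; split => z /=; first by move=> /andP[h1 h2]; split => //; apply/negP; rewrite -leNgt.
    by move=> [h1 /negP]; rewrite -leNgt h1.
  by apply: measurableI; [|apply: measurableC]; exact: measurable_lt_norm.
rewrite /gtail (_ : [set z : R | s < `|z|] = [set z : R | t < `|z|] `|` [set z : R | s < `|z| <= t]).
  rewrite nprobU//; first by rewrite addrC addKr.
  - exact: measurable_lt_norm.
  - by apply/seteqP; split => z //= [h /andP[_]]; rewrite leNgt h.
apply/seteqP; split => z /=.
  by move=> h; case: (ltP t `|z|) => h'; [left|right; rewrite h].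
by move=> [h|/andP[]//]; exact: le_lt_trans st h.
Qed.

Lemma gtail_decr s t : 0 <= s -> s < t -> gtail t < gtail s.
Proof.
move=> s0 st; rewrite -subr_gt0 (gtailB s0 (ltW st)).
apply: (@lt_le_trans _ _ (nprob [set` `]s, t]])).
  apply: (lt_le_trans _ (nprob_itv_lb s0 (ltW st))).
  by rewrite mulr_gt0 ?subr_gt0// mulr_gt0 ?expR_gt0.
apply: nprob_le; first exact: measurable_itv.
  have -> : [set z : R | s < `|z| <= t] = [set z : R | s < `|z|] `&` ~` [set z : R | t < `|z|].
    apply/seteqP; split => z /=; first by move=> /andP[h1 h2]; split => //; apply/negP; rewrite -leNgt.
    by move=> [h1 /negP]; rewrite -leNgt h1.
  by apply: measurableI; [|apply: measurableC]; exact: measurable_lt_norm.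
by move=> z /=; rewrite in_itv/= => /andP[h1 h2]; rewrite gtr0_norm ?h1//; exact: le_lt_trans h1.
Qed.

Lemma gtail_gt0 t : 0 <= t -> 0 < gtail t.
Proof.
move=> t0; apply: (@le_lt_trans _ _ (gtail (t + 1))); first exact: nprob_ge0.
by apply: gtail_decr => //; rewrite ltrDl.
Qed.

Lemma gtail_le1 t : gtail t <= 1.
Proof. by rewrite -nprobT; apply: nprob_le => //; exact: measurable_lt_norm. Qed.

Lemma gtail0 : gtail 0 = 1.
Proof.
transitivity (gtail 0 + nprob [set (0 : R)]); first by rewrite nprob_set1 addr0.
rewrite -nprobT /gtail -nprobU//.
- congr nprob; apply/seteqP; split => z //= _; rewrite normr_gt0.
  by have [->|] := eqVneq z 0; [right|left].
- exact: measurable_lt_norm.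
- by apply/seteqP; split => z //= [/[swap] ->]; rewrite normr0 ltxx.
Qed.

Lemma gtail_lipschitz s t : 0 <= s -> s <= t -> gtail s - gtail t <= 2 * peak * (t - s).
Proof.
move=> s0 st; rewrite (gtailB s0 st).
have mI : measurable [set` `]s, t]] by exact: measurable_itv.
have mJ : measurable (-%R @^-1` [set` `]s, t]]).
  by rewrite -[X in measurable X]setTI; apply: oppr_measurable.
apply: (@le_trans _ _ (nprob ([set` `]s, t]] `|` (-%R @^-1` [set` `]s, t]])))).
  apply: nprob_le => //.
  - have -> : [set z : R | s < `|z| <= t] = [set z : R | s < `|z|] `&` ~` [set z : R | t < `|z|].
      apply/seteqP; split => z /=; first by move=> /andP[h1 h2]; split => //; apply/negP; rewrite -leNgt.
      by move=> [h1 /negP]; rewrite -leNgt h1.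
    by apply: measurableI; [|apply: measurableC]; exact: measurable_lt_norm.
  - exact: measurableU.
  - move=> z /=; rewrite !in_itv/=.
    by case: (leP 0 z) => z0; [rewrite ger0_norm//; left|rewrite ltr0_norm//; right].
rewrite nprobU//; last first.
  by apply/seteqP; split => x //=; rewrite !in_itv/= => -[/andP[h1 _] /andP[h2 _]]; lra.
by rewrite nprob_opp//; have := nprob_itv_ub st; lra.
Qed.

Lemma continuous_gtail : continuous (fun x : R => gtail `|x|).
Proof.
move=> x0; apply/cvgrPdist_lt => e e0; pose x : R := x0.
have p2 : 0 < 2 * peak by rewrite mulr_gt0.
exists (e / (2 * peak)); first by rewrite /= divr_gt0.
move=> y /=; rewrite -/x => xy.
have h (z z' : R) : `|z| <= `|z'| -> `|gtail `|z| - gtail `|z'| | <= 2 * peak * (`|z'| - `|z|).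
  move=> zz; rewrite ger0_norm; first exact: gtail_lipschitz.
  by rewrite gtailB// nprob_ge0.
have h' : `|gtail `|x| - gtail `|y| | <= 2 * peak * `|x - y|.
  have [xy'|/ltW yx'] := leP `|x| `|y|.
    apply: (le_trans (h _ _ xy')); rewrite ler_pM2l// distrC.
    exact: lerB_dist.
  rewrite distrC; apply: (le_trans (h _ _ yx')); rewrite ler_pM2l//.
  exact: lerB_dist.
apply: (le_lt_trans h'); rewrite mulrC -ltr_pdivlMr//.
Qed.

Lemma gtail_surj u : 0 < u -> u < 1 -> exists2 t, 0 < t & gtail t = u.
Proof.
(* Right end for the intermediate value theorem: gtail b <= 2 / (1 + b^2 / 2), and u (1 + b^2 / 2) =
   u + 2 / u >= 2. *)
move=> u0 u1; pose b := 2 / u.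
have b0 : 0 <= b by rewrite divr_ge0// ltW.
have gb : gtail b <= u.
  apply: (le_trans (gtail_ub b0)).
  rewrite expRN ler_pdivrMr ?expR_gt0//.
  apply: (@le_trans _ _ (u * (1 + b ^+ 2 / 2))); last by rewrite ler_pM2l// expR_ge1Dx.
  have -> : u * (1 + b ^+ 2 / 2) = u + 2 / u by rewrite /b; field; rewrite gt_eqF.
  apply: (@le_trans _ _ (2 / u)); last by rewrite lerDr ltW.
  by rewrite ler_peMr// invf_ge1// ltW.
have := @IVT R (fun x => gtail `|x|) 0 b u b0 (continuous_subspaceT continuous_gtail).
rewrite normr0 gtail0 (ger0_norm b0) ge_min le_max gb (ltW u1) orbT => /(_ isT)[c].
rewrite in_itv/= => /andP[c0 cb]; rewrite ger0_norm// => gc; exists c => //.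
rewrite lt_neqAle c0 andbT; apply/negP => /eqP c0'; move: gc u1.
by rewrite -c0' gtail0 => <-; rewrite ltxx.
Qed.

Lemma measurable_gtail_le u : measurable [set x : R | gtail `|x| <= u].
Proof.
have -> : [set x : R | gtail `|x| <= u] = (fun x : R => gtail `|x|) @^-1` [set` `]-oo, u]].
  by apply/seteqP; split => z /=; rewrite in_itv.
apply: measurable_preimage; last exact: measurable_itv.
by apply: continuous_measurable_fun; exact: continuous_gtail.
Qed.

Lemma gtail_le s t : 0 <= s -> 0 <= t -> (gtail s <= gtail t) = (t <= s).
Proof.
move=> s0 t0; have [ts|st] := leP t s; last by apply/negbTE; rewrite -ltNge gtail_decr.
move: ts; rewrite le_eqVlt => /orP[/eqP ->|ts]; first exact: lexx.
by apply/ltW; exact: gtail_decr.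
Qed.

(** For u = gtail t the event is |x| >= t, whereas [gtail] takes |x| > t; the two boundary points
    are null. *)
Lemma gtail_uniform u : 0 <= u -> u <= 1 -> nprob [set x : R | gtail `|x| <= u] = u.
Proof.
rewrite le_eqVlt => /orP[/eqP <- _|u0].
  have -> : [set x : R | gtail `|x| <= 0] = set0.
    by apply/seteqP; split => x //=; rewrite leNgt gtail_gt0.
  by rewrite /nprob (@measure0 _ _ R (normal_prob 0 1)).
rewrite le_eqVlt => /orP[/eqP ->|u1].
  rewrite -[RHS]nprobT; congr nprob; apply/seteqP; split => x //= _; exact: gtail_le1.
have [t t0 <-] := gtail_surj u0 u1.
have -> : [set x : R | gtail `|x| <= gtail t] = [set z : R | t < `|z|] `|` ([set t] `|` [set - t]).
  apply/seteqP; split => x /=; rewrite gtail_le ?(ltW t0)//.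
    rewrite le_eqVlt => /orP[/eqP tx|]; last by left.
    right; move: tx; case: (leP 0 x) => x0; first by rewrite ger0_norm// => ->; left.
    by rewrite ltr0_norm// => ->; right; rewrite opprK.
  by move=> [/ltW//|[->|->]]; rewrite ?normrN ger0_norm// ltW.
rewrite nprobU.
- rewrite nprobU ?nprob_set1 ?addr0//.
  by apply/seteqP; split => x //= [-> ?]; lra.
- exact: measurable_lt_norm.
- exact: measurableU.
- apply/seteqP; split => x //= [/[swap]] [->|->]; rewrite ?normrN ger0_norm ?ltxx// ltW//.
Qed.

Lemma nprob_ge_lb s : 0 <= s ->
  peak * expR (- ((s + 1) ^+ 2 / 2)) <= nprob [set z : R | s <= z].
Proof.
move=> s0; have := @nprob_itv_lb s (s + 1) s0.
have -> : s + 1 - s = 1 by ring.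
rewrite mul1r => /(_ _)/le_trans; apply; first by rewrite lerDl.
apply: nprob_le; first exact: measurable_itv.
  by rewrite (_ : [set z | s <= z] = [set` `[s, +oo[]);
    [exact: measurable_itv|apply/seteqP; split => z /=; rewrite in_itv/= andbT].
by move=> z /=; rewrite in_itv/= => /andP[/ltW].
Qed.

End GaussianTail.

Section CrossingProbability.
Context d (T : measurableType d) {R : realType} (P : probability T R) (I : finType).
Variables (g : I -> T -> R) (M : nat) (x C : R).
Hypotheses (ig : iid_normal P g) (M_gt0 : (0 < M)%N) (x0 : 0 <= x) (C0 : 0 < C).

Let U (k : nat) : set R := [set y : R | gtail `|y| <= k%:R / M%:R].

Let M0 : (0 : R) < M%:R. Proof. by rewrite ltr0n. Qed.

Let mU k : measurable (U k). Proof. exact: measurable_gtail_le. Qed.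

Let U_mono k k' : (k <= k')%N -> U k `<=` U k'.
Proof. by move=> kk y /le_trans; apply; rewrite ler_pM2r ?invr_gt0// ler_nat. Qed.

Let nprobU_M k : (k <= M)%N -> nprob (U k) = k%:R / M%:R.
Proof.
by move=> kM; rewrite gtail_uniform// ?divr_ge0// ler_pdivrMr// mul1r ler_nat.
Qed.

(** Index of the p-value rounded up to the grid. As a p-value is at most 1, the last cell M is never
    reached. *)
Let cell (y : R) : 'I_M.+1 :=
  inord (find (fun i => gtail `|y| <= i.+1%:R / M%:R) (iota 0 M)).

Let cell_le y i : (i < M)%N -> (cell y <= i)%N = (gtail `|y| <= i.+1%:R / M%:R).
Proof.
move=> iM; set a := fun i : nat => gtail `|y| <= i.+1%:R / M%:R.
rewrite inordK; last by rewrite ltnS -[X in (_ <= X)%N](size_iota 0 M) find_size.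
rewrite -/a; apply/idP/idP => [fi|ai].
  have ha : has a (iota 0 M) by rewrite has_find size_iota (leq_ltn_trans fi).
  have := nth_find 0%N ha; rewrite nth_iota ?add0n; last by rewrite (leq_ltn_trans fi).
  by rewrite /a => /le_trans; apply; rewrite ler_pM2r ?invr_gt0// ler_nat.
rewrite leqNgt; apply/negP => /(before_find 0%N).
by rewrite nth_iota// add0n /a ai.
Qed.

Let cell_lt y k : (0 < k)%N -> (k <= M)%N -> (cell y < k)%N = (gtail `|y| <= k%:R / M%:R).
Proof. by case: k => // k _ kM; rewrite ltnS cell_le. Qed.

Let cellE k : cell @^-1` [set k] = U k.+1 `\` U k.
Proof.
have lt1 y : U M y by rewrite /U /= divff ?gt_eqF// gtail_le1.
have kM := ltn_ord k; rewrite ltnS in kM.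
apply/seteqP; split => y /=.
  move=> ck; split.
    move: kM; rewrite leq_eqVlt => /orP[/eqP kM|kM].
      by apply: (U_mono _ (lt1 y)); rewrite kM.
    by rewrite /U/= -cell_le// ck.
  case: (posnP k) => [k0|k0].
    by rewrite /U/= k0 mul0r leNgt gtail_gt0.
  by rewrite /U/= -cell_lt// ck ltnn.
move=> [h1 h2]; apply: val_inj => /=; apply/eqP; rewrite eqn_leq.
have kM' : (k < M)%N.
  by rewrite ltn_neqAle kM andbT; apply/eqP => kM'; apply: h2; rewrite kM'.
rewrite cell_le// h1/= leqNgt; apply/negP => ck; apply: h2.
by rewrite /U/= -cell_lt// (leq_ltn_trans _ ck).
Qed.

Lemma crossing_probability :
  let D := [set w | exists2 i, (i < M)%N & C <= (1 + x / (i.+1%:R / M%:R)) ^+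
     #|[pred j | gtail `|g j w| <= i.+1%:R / M%:R]|] in
  measurable D /\ (P D <= ((1 + x) ^+ #|I| / C)%:E)%E.
Proof.
pose X := x * M%:R.
have X0 : 0 <= X by rewrite mulr_ge0// ltW.
have mc (j : I) k : measurable (cell @^-1` [set k]).
  by rewrite cellE; apply: measurableD.
have [mD PD] := iid_normal_ffun_law (@crossing R I M X C M) ig mc.
have DE w : (exists2 i, (i < M)%N & C <= (1 + x / (i.+1%:R / M%:R)) ^+
     #|[pred j | gtail `|g j w| <= i.+1%:R / M%:R]|) <-> crossing X C M [ffun j => cell (g j w)].
  have cnt (i : nat) : (i < M)%N -> cell_count [ffun j => cell (g j w)] i =
      #|[pred j | gtail `|g j w| <= i.+1%:R / M%:R]|.
    by move=> iM; apply: eq_card => j; rewrite !inE ffunE cell_le.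
  have xX (i : nat) : X / i.+1%:R = x / (i.+1%:R / M%:R).
    by rewrite /X invf_div mulrA.
  split.
    move=> [i iM h]; apply/existsP; exists (inord i).
    by rewrite inordK ?ltnS ?(ltnW iM)// iM/= cnt// xX.
  by move=> /existsP[i /andP[iM h]]; exists i => //; move: h; rewrite cnt// xX.
rewrite /=.
have -> : [set w | exists2 i, (i < M)%N & C <= (1 + x / (i.+1%:R / M%:R)) ^+
     #|[pred j | gtail `|g j w| <= i.+1%:R / M%:R]|] = [set w | crossing X C M [ffun j => cell (g j w)]].
  by apply/seteqP; split => w /= /DE.
split => //; rewrite PD lee_fin.
pose pi (k : 'I_M.+1) := nprob (cell @^-1` [set k]).
have piE (k : 'I_M.+1) : pi k = if (k < M)%N then M%:R^-1 else 0.
  have -> : pi k = nprob (U k.+1) - nprob (U k).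
    rewrite /pi cellE; have {2}-> : U k.+1 = (U k.+1 `\` U k) `|` U k.
      by rewrite setUC setDUK//; exact: U_mono.
    rewrite nprobU ?addrK//; first exact: measurableD.
    by rewrite setDE -setIA setICl setI0.
  have kM := ltn_ord k; rewrite ltnS in kM.
  rewrite (nprobU_M kM); case: ifPn => h.
    by rewrite nprobU_M// -mulrBl -natrB// subSnn mul1r.
  have -> : k = M :> nat by apply/eqP; rewrite eqn_leq kM leqNgt.
  have -> : U M.+1 = setT.
    apply/seteqP; split => y // _; apply: (le_trans (gtail_le1 _)).
    by rewrite ler_pdivlMr// mul1r ler_nat.
  by rewrite nprobT divff ?subrr// gt_eqF.
have := @crossing_card_le R I M X C X0 C0 [set: I]%SET M (leqnn M).
set A := [set f in _ | _]%SET => hA.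
(* The codes are uniform on the first M cells, so the probability is the number of crossing maps
   that avoid the last cell, times M^-|I|. *)
apply: (@le_trans _ _ (\sum_(f in A) M%:R^-1 ^+ #|I|)).
  rewrite big_mkcond [X in _ <= X]big_mkcond/=; apply: ler_sum => f _.
  case: ifPn => cf; last by case: ifP => // _; rewrite exprn_ge0// invr_ge0.
  case: ifPn => fA.
    rewrite (eq_bigr (fun=> M%:R^-1)) ?prodr_const// => j _.
    move: fA; rewrite !inE => /andP[/forallP/(_ j)]; rewrite inE => fj _.
    by rewrite -[LHS]/(pi (f j)) piE fj.
  have [j fj] : exists j, ~~ (f j < M)%N.
    move: fA; rewrite !inE cf andbT negb_forall => /existsP[j]; rewrite inE => fj.
    by exists j.
  by rewrite (bigD1 j)//= -[X in X * _]/(pi (f j)) piE (negbTE fj) mul0r.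
rewrite sumr_const -[X in X <= _]mulr_natl ler_pdivlMr// mulrAC.
apply: (le_trans (ler_wpM2r _ hA)); first by rewrite exprn_ge0// invr_ge0.
rewrite cardsT -exprMn le_eqVlt; apply/orP; left; apply/eqP; congr (_ ^+ _).
by rewrite /X; field; rewrite gt_eqF.
Qed.

End CrossingProbability.

(** * The Higher Criticism statistic and null exceedances *)

Section HCStat.
Context {R : realType} (n p : nat) (X : 'M[R]_(n, p)) (Y : 'cV[R]_n).
Local Notation q := (HC_q X Y).
Local Notation qs := (sort <=%R [seq q j | j <- enum 'I_p]).
Let cnt (u : R) := #|[pred j | q j <= u]|.

Let qs_sorted : sorted <=%R qs. Proof. by apply: sort_sorted; exact: le_total. Qed.

Let size_qs : size qs = p. Proof. by rewrite size_sort size_map size_enum_ord. Qed.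

Let count_qs u : count (fun x => x <= u) qs = cnt u.
Proof.
rewrite (permP (permEl (perm_sort _ _))) count_map /cnt -sum1_count big_enum_cond/=.
by rewrite sum1_card; apply: eq_card => j; rewrite !inE.
Qed.

Lemma HC_qE j : q j = gtail `|HC_y X Y j|. Proof. by []. Qed.

Let q_gt0 j : 0 < q j. Proof. by rewrite HC_qE gtail_gt0. Qed.

Lemma HC_qsorted_mem i : (i < p)%N -> exists j, HC_qsorted X Y i = q j.
Proof.
move=> ip; have : nth 0 qs i \in qs by rewrite mem_nth// size_qs.
by rewrite mem_sort => /mapP[j _ e]; exists j.
Qed.

(** Take for u the ordered p-value of an index whose term exceeds c: the count at u is at least its
    rank, and ties only increase it. *)
Lemma HC_stat_gt (c : R) : 0 <= c -> (c%:E < HC_stat X Y)%E ->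
  exists u, [/\ 0 < u, u <= 2^-1 &
    p%:R * u + c * Num.sqrt (p%:R * u * (1 - u)) < (cnt u)%:R].
Proof.
move=> c0 cHC.
have [i /andP[iu ci]] : exists i : 'I_p, (HC_qsorted X Y i <= 2^-1) &&
    (c < Num.sqrt p%:R * (i.+1%:R / p%:R - HC_qsorted X Y i) /
     Num.sqrt (HC_qsorted X Y i * (1 - HC_qsorted X Y i))).
  apply/existsP; apply: contraTT cHC => /existsPn h; rewrite -leNgt /HC_stat.
  apply: (big_ind (fun x => x <= c%:E)%E) => [|x y xc yc|i iu].
  - by rewrite leNye.
  - by rewrite ge_max xc yc.
  - by rewrite lee_fin leNgt; have := h i; rewrite iu.
have ip := ltn_ord i.
have [j uj] := HC_qsorted_mem ip.
set u := HC_qsorted X Y i in iu ci uj *.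
have u0 : 0 < u by rewrite uj.
exists u; split => //.
have p0 : 0 < p%:R :> R by rewrite ltr0n (leq_ltn_trans _ ip).
have v0 : 0 < u * (1 - u) by rewrite mulr_gt0// subr_gt0 (le_lt_trans iu)// invf_lt1// ltr1n.
have hi : (i.+1 <= cnt u)%N.
  rewrite -count_qs -(cat_take_drop i.+1 qs) count_cat.
  apply: (@leq_trans (count (fun x => x <= u) (take i.+1 qs))); last exact: leq_addr.
  have : all (fun x => x <= u) (take i.+1 qs).
    apply/(all_nthP 0) => k; rewrite size_take size_qs => hk.
    have ki : (k <= i)%N by move: hk; case: ifP => // /negbT; rewrite -leqNgt => h1 /leq_trans/(_ h1).
    rewrite nth_take//; apply: (sorted_leq_nth le_trans lexx _ qs_sorted) => //.
    - by rewrite inE size_qs (leq_ltn_trans ki).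
    - by rewrite inE size_qs.
  rewrite all_count => /eqP ->; rewrite size_take size_qs; case: ifP => //.
apply: (@lt_le_trans _ _ i.+1%:R); last by rewrite ler_nat.
move: ci; rewrite ltr_pdivlMr ?sqrtr_gt0// => ci.
rewrite -ltrBrDl -mulrA sqrtrM ?ltW// mulrCA.
have -> : i.+1%:R - p%:R * u = Num.sqrt p%:R * (Num.sqrt p%:R * (i.+1%:R / p%:R - u)).
  by rewrite mulrA -expr2 sqr_sqrtr ?ltW// mulrBr mulrCA divff ?mulr1// gt_eqF.
by rewrite ltr_pM2l ?sqrtr_gt0.
Qed.

(** The index used has rank N, the number of p-values at most u. Its p-value q is at most u, so
    replacing u by q increases N / p - u, and q (1 - q) <= u. *)
Lemma HC_stat_gt_of_count (c u : R) : 0 <= c -> 0 < u -> u <= 2^-1 ->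
  p%:R * u + c * Num.sqrt (p%:R * u) < (cnt u)%:R -> (c%:E < HC_stat X Y)%E.
Proof.
move=> c0 u0 u2 h.
have N0 : (0 < cnt u)%N.
  rewrite -(ltr_nat R); apply: le_lt_trans h; rewrite addr_ge0//.
    by rewrite mulr_ge0// ltW.
  by rewrite mulr_ge0// sqrtr_ge0.
have Np : (cnt u <= p)%N by rewrite -[X in (_ <= X)%N](card_ord p) max_card.
have ip : ((cnt u).-1 < p)%N by rewrite prednK.
have p0 : 0 < p%:R :> R by rewrite ltr0n (leq_ltn_trans _ ip).
pose i := Ordinal ip.
have qu : HC_qsorted X Y i <= u.
  rewrite leNgt; apply/negP => uq.
  have : (count (fun x => x <= u)%R qs <= i)%N.
    rewrite -(cat_take_drop i qs) count_cat [X in (_ + X)%N](_ : _ = 0%N) ?addn0.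
      by rewrite (leq_trans (count_size _ _))// size_take size_qs ip.
    apply/eqP; rewrite -leqn0 leqNgt -has_count; apply/hasPn => y /(nthP 0)[k].
    rewrite size_drop size_qs nth_drop => hk <-; rewrite -ltNge.
    apply: (lt_le_trans uq); apply: (sorted_leq_nth le_trans lexx _ qs_sorted).
    - by rewrite inE size_qs.
    - by rewrite inE size_qs -ltn_subRL.
    - exact: leq_addr.
  by rewrite count_qs /= -ltnS prednK// ltnn.
have [j qj] := HC_qsorted_mem ip.
set qi := HC_qsorted X Y i in qu; rewrite -[HC_qsorted _ _ _]/qi in qj.
have q0 : 0 < qi by rewrite qj.
have q2 : qi <= 2^-1 by exact: le_trans u2.
rewrite /HC_stat (bigD1 i)//= lt_max; apply/orP; left.
rewrite -/qi lte_fin prednK// ltr_pdivlMr; last first.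
  by rewrite sqrtr_gt0 mulr_gt0// subr_gt0 (le_lt_trans q2)// invf_lt1// ltr1n.
apply: (@le_lt_trans _ _ (c * Num.sqrt u)).
  rewrite ler_wpM2l// ler_wsqrtr//; apply: (le_trans _ qu).
  by rewrite ler_piMr ?(ltW q0)// lerBlDr lerDl ltW.
have sp0 : 0 < Num.sqrt (p%:R : R) by rewrite sqrtr_gt0.
rewrite -(ltr_pM2l sp0) mulrCA -sqrtrM ?ler0n//.
rewrite [X in _ < X]mulrA -expr2 sqr_sqrtr ?ler0n// mulrBr mulrCA divff ?mulr1 ?gt_eqF//.
rewrite ltrBrDl; apply: le_lt_trans h; rewrite lerD2r ler_pM2l//.
Qed.

End HCStat.

(** * Bounds for the logarithm and Chernoff exponents *)

Section LogBounds.
Context {R : realType}.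
Implicit Types x y z : R.

Lemma ge0_of_derive_ge0 (f df : R -> R) b : 0 <= b -> f 0 = 0 ->
  (forall x, 0 <= x -> is_derive x 1 f (df x)) ->
  (forall x, 0 <= x -> 0 <= df x) -> 0 <= f b.
Proof.
move=> b0 f0 fd df0.
have [||c] := @MVT_segment R f df 0 b b0.
- by move=> x; rewrite in_itv/= => /andP[/ltW x0 _]; exact: fd.
- apply: derivable_within_continuous => x; rewrite in_itv/= => /andP[x0 _].
  by have [] := fd x x0.
rewrite in_itv/= => /andP[c0 _]; rewrite f0 !subr0 => ->.
by rewrite mulr_ge0// df0.
Qed.

Lemma is_derive_ln1D x : 0 < 1 + x ->
  is_derive x (1 : R) (fun y : R => ln (1 + y)) (1 + x)^-1.
Proof.
move=> x1.
have d0 : is_derive x 1 (cst (1 : R) + id) 1 by apply: is_derive_eq; rewrite add0r.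
have dl := is_derive1_ln x1.
by have := @is_derive1_comp R (@ln R) (cst (1 : R) + id) x _ _ dl d0; rewrite mulr1.
Qed.

Lemma ln1D_ge y : 0 <= y -> y - y ^+ 2 / 2 <= ln (1 + y).
Proof.
move=> y0; rewrite -subr_ge0.
apply: (@ge0_of_derive_ge0 (fun y => ln (1 + y) - (y - y ^+ 2 / 2)) (fun y => y ^+ 2 / (1 + y)) _ y0).
- by rewrite addr0 ln1 expr0n mul0r !subr0.
- move=> x x0; have x1 : 0 < 1 + x by rewrite addrC ltr_wpDl.
  have d1 := is_derive_ln1D x1.
  have -> : (fun y : R => ln (1 + y) - (y - y ^+ 2 / 2)) =
      (fun y : R => ln (1 + y)) - (id - (2^-1 : R) \*: (id ^+ 2)).
    by apply/funext => t; rewrite !fctE; congr (_ - (_ - _)); rewrite mulrC.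
  apply: is_derive_eq; rewrite /GRing.scale /=.
  by field; rewrite gt_eqF.
- by move=> x x0; rewrite divr_ge0// ?sqr_ge0// addr_ge0.
Qed.

Lemma ln1D_le z : 0 <= z -> ln (1 + z) <= z - z ^+ 2 / 2 + z ^+ 3 / 3.
Proof.
move=> z0; rewrite -subr_ge0.
apply: (@ge0_of_derive_ge0 (fun y => y - y ^+ 2 / 2 + y ^+ 3 / 3 - ln (1 + y))
  (fun y => y ^+ 3 / (1 + y)) _ z0).
- by rewrite addr0 ln1 !expr0n !mul0r !subr0 addr0.
- move=> x x0; have x1 : 0 < 1 + x by rewrite addrC ltr_wpDl.
  have d1 := is_derive_ln1D x1.
  have -> : (fun y : R => y - y ^+ 2 / 2 + y ^+ 3 / 3 - ln (1 + y)) =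
      ((id - (2^-1 : R) \*: (id ^+ 2)) + (3^-1 : R) \*: (id ^+ 3)) - (fun y : R => ln (1 + y)).
    by apply/funext => t; rewrite !fctE; congr (_ - _ + _ - _); rewrite mulrC.
  apply: is_derive_eq; rewrite /GRing.scale /=.
  by field; rewrite gt_eqF.
- by move=> x x0; rewrite divr_ge0// ?exprn_ge0// addr_ge0.
Qed.

Lemma ln1D_half y : 1 <= y -> 2^-1 <= ln (1 + y).
Proof.
move=> y1; apply: (@le_trans _ _ (ln (1 + 1))); last first.
  by rewrite ler_ln ?posrE ?lerD2l// addr_gt0// (lt_le_trans _ y1).
have := @ln1D_ge 1 ler01; lra.
Qed.

End LogBounds.

Section Exponents.
Context {R : realType}.
Implicit Types (p u v x y lam tau kap c L : R).

Lemma le_of_sqr x y : 0 <= y -> x ^+ 2 <= y ^+ 2 -> x <= y.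
Proof.
move=> y0 h; apply: (le_trans (ler_norm x)).
by rewrite -sqrtr_sqr -[X in _ <= X]ger0_norm// -(sqrtr_sqr y); exact: ler_wsqrtr.
Qed.

(** The rational 7 / 10 stands in for 1 / sqrt 2: its square is at most 1 / 2 <= 1 - u. *)
Lemma sqrt_half_bound p u : 0 < p * u -> u <= 2^-1 ->
  7 / 10 * Num.sqrt (p * u) <= Num.sqrt (p * u * (1 - u)).
Proof.
move=> w0 u2.
have -> : 7 / 10 * Num.sqrt (p * u) = Num.sqrt ((7 / 10) ^+ 2 * (p * u)).
  by rewrite [in RHS]sqrtrM ?sqr_ge0// sqrtr_sqr ger0_norm.
apply: ler_wsqrtr; rewrite [X in _ <= X]mulrC ler_pM2r//; lra.
Qed.

(* For counts of order up to kap^2 lam^2, with lam = tau^4, a single value of the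
   parameter x = tau / p serves all u at once. *)
Lemma crude_exponent p u tau kap L : 0 < p -> 3 <= tau -> 0 < kap ->
  (tau ^+ 4 * p)^-1 <= u -> u <= 2^-1 -> p * u <= kap ^+ 2 * tau ^+ 8 ->
  L <= 35 / 100 * tau ^+ 2 - tau -> L <= 3 / 10 * tau / kap ->
  L <= (p * u + tau ^+ 4 * Num.sqrt (p * u * (1 - u))) * ln (1 + (tau / p) / u) - p * ln (1 + tau / p).
Proof.
move=> p0 tau3 kap0 ul u2 uh L1 L2.
have tau0 : 0 < tau by rewrite (lt_le_trans _ tau3).
have t4 : 0 < tau ^+ 4 by rewrite exprn_gt0.
have u0 : 0 < u by apply: lt_le_trans ul; rewrite invr_gt0 mulr_gt0.
set w := p * u in uh *.
have w0 : 0 < w by rewrite mulr_gt0.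
set s := Num.sqrt (w * (1 - u)).
pose r := Num.sqrt w.
have r0 : 0 < r by rewrite sqrtr_gt0.
have r2 : r ^+ 2 = w by rewrite sqr_sqrtr// ltW.
have sr : 7 / 10 * r <= s by exact: sqrt_half_bound.
pose y := tau / p / u.
have yE : y * r ^+ 2 = tau by rewrite r2 /y /w; field; rewrite !gt_eqF.
have y0 : 0 < y by rewrite !divr_gt0.
rewrite -/y; have ly0 : 0 <= ln (1 + y) by rewrite ln_ge0// lerDl ltW.
have hp : p * ln (1 + tau / p) <= tau.
  apply: (@le_trans _ _ (p * (tau / p))); last by rewrite mulrCA divff ?mulr1// gt_eqF.
  by rewrite ler_pM2l// le_ln1Dx// (lt_trans (ltrN10 R))// divr_gt0.
have hs : (w + tau ^+ 4 * (7 / 10 * r)) * ln (1 + y) <= (w + tau ^+ 4 * s) * ln (1 + y).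
  by rewrite ler_wpM2r// lerD2l ler_pM2l.
suff : L + tau <= (w + tau ^+ 4 * (7 / 10 * r)) * ln (1 + y) by lra.
have rt : 1 <= r * tau ^+ 2.
  apply: le_of_sqr; first by rewrite mulr_ge0// ?exprn_ge0// ltW.
  have -> : (r * tau ^+ 2) ^+ 2 = u * (tau ^+ 4 * p) by rewrite exprMn r2 /w; ring.
  by rewrite expr1n -ler_pdivrMr ?mulr_gt0// div1r.
have t4r : 0 <= tau ^+ 4 * (7 / 10 * r) by rewrite !mulr_ge0// ltW.
(* For few expected points y >= 1, the logarithm is at least 1 / 2, and the lower limit on u gives
   tau^4 r >= tau^2. For more of them y <= 1 and the quadratic bound on the logarithm is used. *)
have [wt|wt] := leP w tau.
  have y1 : 1 <= y.
    by rewrite -(ler_pM2r w0) mul1r -[X in y * X]r2 yE.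
  have hl := ln1D_half y1.
  have h1 : tau ^+ 4 * (7 / 10 * r) * 2^-1 <= (w + tau ^+ 4 * (7 / 10 * r)) * ln (1 + y).
    by apply: ler_pM => //; rewrite ?lerDr ?invr_ge0// ltW.
  have h2 : tau ^+ 2 <= tau ^+ 4 * r.
    have -> : tau ^+ 4 * r = tau ^+ 2 * (r * tau ^+ 2) by ring.
    by rewrite ler_peMr// exprn_ge0// ltW.
  lra.
have r1 : 1 <= r.
  by apply: le_of_sqr; [exact: ltW|rewrite expr1n r2; lra].
have y1 : y <= 1 by rewrite -(ler_pM2r w0) mul1r -[X in y * X]r2 yE ltW.
have rk : r <= kap * tau ^+ 4.
  apply: le_of_sqr; first by rewrite mulr_ge0// ltW.
  by rewrite r2 exprMn -exprM.
have hln : y - y ^+ 2 / 2 <= ln (1 + y) by apply: ln1D_ge; exact: ltW.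
apply: (@le_trans _ _ ((w + tau ^+ 4 * (7 / 10 * r)) * (y - y ^+ 2 / 2))); last first.
  by rewrite ler_wpM2l// addr_ge0// ltW.
(* Here w y = tau pays for p ln (1 + tau / p). The excess brings at least 35 / 100 A y, the loss tau
   y / 2 is at most A y / 54, and A y >= tau / kap. *)
pose A := tau ^+ 4 * r.
have A27 : 27 * tau <= A.
  have h3 : 27 <= tau ^+ 3.
    have -> : 27 = 3 ^+ 3 :> R by ring.
    by rewrite lerXn2r ?nnegrE// ltW.
  apply: (@le_trans _ _ (tau ^+ 4 * 1)); last by rewrite ler_pM2l.
  have -> : tau ^+ 4 * 1 = tau ^+ 3 * tau by ring.
  by rewrite ler_pM2r.
have hA : tau / kap <= A * y.
  rewrite ler_pdivrMr// -(ler_pM2r r0).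
  have -> : A * y * kap * r = tau * (kap * tau ^+ 4).
    by rewrite -[X in X * (kap * _)]yE /A; ring.
  by rewrite ler_pM2l.
have -> : (w + tau ^+ 4 * (7 / 10 * r)) * (y - y ^+ 2 / 2) =
    tau - tau * y / 2 + 7 / 10 * A * (y * (1 - y / 2)).
  have -> : (w + tau ^+ 4 * (7 / 10 * r)) * (y - y ^+ 2 / 2) =
      y * w - y * w * y / 2 + 7 / 10 * A * (y * (1 - y / 2)) by rewrite /A; field.
  by rewrite -[X in y * X]r2 yE.
have h1 : y / 2 <= y * (1 - y / 2) by rewrite ler_pM2l//; lra.
have A0 : 0 <= 7 / 10 * A by rewrite !mulr_ge0// ltW.
have h2 := ler_wpM2l A0 h1.
have h3 : 27 * tau * y <= A * y by rewrite ler_pM2r.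
have h4 : 3 / 10 * tau / kap <= 3 / 10 * (A * y) by rewrite -mulrA ler_pM2l.
have h5 : 0 <= A * y by apply: mulr_ge0; [apply: mulr_ge0; exact: ltW|exact: ltW].
lra.
Qed.

(* Here x is the optimal Chernoff parameter at the left endpoint v of the block
   [v, c v]; it costs only the factor 1 - 2 (c - 1) - 4 / kap elsewhere. *)
Lemma sharp_exponent p u v lam kap c : 0 < p -> 0 < v -> v <= u -> u <= c * v -> u <= 2^-1 ->
  0 < lam -> 0 < kap -> kap ^+ 2 * lam ^+ 2 <= p * v ->
  lam ^+ 2 / 2 * (1 - 2 * (c - 1) - 4 / kap) <=
  (p * u + lam * Num.sqrt (p * u * (1 - u))) *
     ln (1 + (v * lam / Num.sqrt (p * v * (1 - v))) / u) -
  p * ln (1 + v * lam / Num.sqrt (p * v * (1 - v))).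
Proof.
move=> p0 v0 vu ucv u2 lam0 kap0 kv.
have u0 : 0 < u by exact: lt_le_trans vu.
have u1 : 0 < 1 - u by lra.
have v1 : 0 < 1 - v by lra.
have pu0 : 0 < p * u by rewrite mulr_gt0.
pose s := Num.sqrt (p * u * (1 - u)); pose S := Num.sqrt (p * v * (1 - v)).
rewrite -/s -/S.
have s0 : 0 < s by rewrite sqrtr_gt0 !mulr_gt0.
have S0 : 0 < S by rewrite sqrtr_gt0 !mulr_gt0.
have s2 : s ^+ 2 = p * u * (1 - u) by rewrite sqr_sqrtr// ltW// !mulr_gt0.
have S2 : S ^+ 2 = p * v * (1 - v) by rewrite sqr_sqrtr// ltW// !mulr_gt0.
(* Ratio of the parameter in force, tuned to v, to the one tuned to u. The main term will be lam^2
   (rho - rho^2 / 2), that is lam^2 / 2 less lam^2 (1 - rho)^2 / 2. *)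
pose rho := v * s / (u * S).
have rho0 : 0 < rho by rewrite divr_gt0// mulr_gt0.
have rho2 : rho ^+ 2 = v * (1 - u) / (u * (1 - v)).
  rewrite /rho expr_div_n !exprMn s2 S2; field.
  by rewrite !gt_eqF.
have rhoc : 1 - rho ^+ 2 <= 2 * (c - 1).
  have -> : 1 - rho ^+ 2 = (u - v) / (u * (1 - v)).
    by rewrite rho2; field; rewrite !gt_eqF.
  rewrite ler_pdivrMr ?mulr_gt0//.
  have c1 : 1 <= c by rewrite -(ler_pM2r v0) mul1r (le_trans vu).
  have h1 : u - v <= (c - 1) * v by lra.
  have h2 : v <= u * (2 * (1 - v)).
    have h0 : 0 <= 1 - 2 * v by lra.
    have := mulr_ge0 (ltW u0) h0; lra.
  have h3 : 0 <= c - 1 by lra.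
  apply: (le_trans h1); have := ler_wpM2l h3 h2; lra.
have rho1 : rho <= 1.
  have : rho ^+ 2 <= 1.
    by rewrite rho2 ler_pdivrMr ?mulr_gt0// mul1r; nra.
  by rewrite -[X in _ <= X](expr1n R 2) ler_sqr ?nnegrE// ltW.
pose y := v * lam / S / u.
have ys : y * s = rho * lam by rewrite /y /rho; field; rewrite !gt_eqF.
have y0 : 0 < y by rewrite !divr_gt0// mulr_gt0.
have -> : v * lam / S = u * y by rewrite /y; field; rewrite !gt_eqF.
rewrite [u * y / u]mulrAC divff ?gt_eqF// mul1r.
have sk : 7 / 10 * (kap * lam) <= s.
  apply: le_trans (sqrt_half_bound pu0 u2); rewrite ler_pM2l//.
  have -> : kap * lam = Num.sqrt ((kap * lam) ^+ 2) by rewrite sqrtr_sqr ger0_norm// mulr_ge0// ltW.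
  by apply: ler_wsqrtr; rewrite exprMn (le_trans kv)// ler_pM2l.
have hln : y - y ^+ 2 / 2 <= ln (1 + y) by apply: ln1D_ge; exact: ltW.
have hln' : ln (1 + u * y) <= u * y - (u * y) ^+ 2 / 2 + (u * y) ^+ 3 / 3.
  by apply: ln1D_le; rewrite mulr_ge0// ltW.
have d0 : 0 <= p * u + lam * s by rewrite addr_ge0// ?mulr_ge0// ltW.
apply: (@le_trans _ _ ((p * u + lam * s) * (y - y ^+ 2 / 2) -
    p * (u * y - (u * y) ^+ 2 / 2 + (u * y) ^+ 3 / 3))); last first.
  by rewrite lerB// ?ler_wpM2l// ltW.
(* The first-order terms p u y cancel and the second-order ones combine into the variance s^2. The
   last two terms have relative size 1 / kap, because y <= (10 / 7) / kap. *)
have -> : (p * u + lam * s) * (y - y ^+ 2 / 2) - p * (u * y - (u * y) ^+ 2 / 2 + (u * y) ^+ 3 / 3) =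
   lam * (y * s) - (p * u * (1 - u)) * y ^+ 2 / 2 - lam * (y * s) * y / 2 - p * u ^+ 3 * y ^+ 3 / 3 by ring.
rewrite -s2 ys.
have e0 : s ^+ 2 * y ^+ 2 = rho ^+ 2 * lam ^+ 2 by rewrite -!exprMn [s * y]mulrC ys.
have yk : y <= 10 / 7 / kap.
  rewrite ler_pdivlMr// -(ler_pM2r lam0).
  have h1 : y * (7 / 10 * (kap * lam)) <= y * s by rewrite ler_pM2l.
  have h2 : rho * lam <= lam by rewrite ler_piMl// ltW.
  have -> : y * kap * lam = 10 / 7 * (y * (7 / 10 * (kap * lam))) by field.
  by rewrite ler_pM2l//; lra.
have l2 : 0 < lam ^+ 2 by rewrite exprn_gt0.
have e1 : lam * (rho * lam) * y / 2 <= lam ^+ 2 * (5 / 7 / kap).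
  have -> : lam * (rho * lam) * y / 2 = lam ^+ 2 * (rho * (y / 2)) by ring.
  rewrite ler_pM2l//; apply: (@le_trans _ _ (y / 2)); first by rewrite ler_piMl// divr_ge0// ltW.
  have -> : 5 / 7 / kap = 10 / 7 / kap / 2 by field; rewrite gt_eqF.
  by rewrite ler_pM2r.
have e2 : p * u ^+ 3 * y ^+ 3 / 3 <= lam ^+ 2 * (5 / 21 / kap).
  have h1 : p * u ^+ 3 <= s ^+ 2 / 2.
    have -> : p * u ^+ 3 = (p * u) * u ^+ 2 by ring.
    have -> : s ^+ 2 / 2 = (p * u) * ((1 - u) / 2) by rewrite s2; ring.
    rewrite ler_pM2l//; nra.
  have h2 : p * u ^+ 3 * y ^+ 3 <= s ^+ 2 / 2 * y ^+ 3 by rewrite ler_wpM2r// exprn_ge0// ltW.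
  have h3 : s ^+ 2 / 2 * y ^+ 3 = lam ^+ 2 * (rho ^+ 2 * (y / 2)).
    have -> : s ^+ 2 / 2 * y ^+ 3 = (s ^+ 2 * y ^+ 2) * (y / 2) by ring.
    by rewrite e0; ring.
  have h4 : rho ^+ 2 * (y / 2) <= y / 2.
    by apply: ler_piMl; [rewrite divr_ge0// ltW|rewrite exprn_ile1// ltW].
  have h5 : lam ^+ 2 * (rho ^+ 2 * (y / 2)) <= lam ^+ 2 * (5 / 7 / kap).
    rewrite ler_pM2l//; apply: (le_trans h4).
    have -> : 5 / 7 / kap = 10 / 7 / kap / 2 by field; rewrite gt_eqF.
    by rewrite ler_pM2r.
  have -> : lam ^+ 2 * (5 / 21 / kap) = lam ^+ 2 * (5 / 7 / kap) / 3 by field; rewrite gt_eqF.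
  rewrite ler_pM2r//; lra.
rewrite e0.
have m1 : lam ^+ 2 * (1 / 2 - (c - 1)) <= lam ^+ 2 * (rho - rho ^+ 2 / 2).
  rewrite ler_pM2l//.
  have : 1 - rho <= 1 - rho ^+ 2 by rewrite lerD2l lerN2 expr2 ler_piMl// ltW.
  have : (1 - rho) ^+ 2 <= 1 - rho.
    by rewrite expr2 ler_piMl// ?subr_ge0// lerBlDr lerDl ltW.
  have -> : rho - rho ^+ 2 / 2 = 1 / 2 - (1 - rho) ^+ 2 / 2 by field.
  lra.
have ik : 0 <= lam ^+ 2 / kap by rewrite divr_ge0// ltW.
have -> : lam ^+ 2 / 2 * (1 - 2 * (c - 1) - 4 / kap) =
   lam ^+ 2 * (1 / 2 - (c - 1)) - 2 * (lam ^+ 2 / kap) by field; rewrite gt_eqF.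
have E1 : lam ^+ 2 * (5 / 7 / kap) = 5 / 7 * (lam ^+ 2 / kap) by field; rewrite gt_eqF.
have E2 : lam ^+ 2 * (5 / 21 / kap) = 5 / 21 * (lam ^+ 2 / kap) by field; rewrite gt_eqF.
rewrite E1 in e1; rewrite E2 in e2.
have -> : lam * (rho * lam) = lam ^+ 2 * rho by ring.
have e1' : lam ^+ 2 * rho * y / 2 <= 5 / 7 * (lam ^+ 2 / kap).
  by apply: le_trans e1; rewrite le_eqVlt; apply/orP; left; apply/eqP; ring.
move: m1 e1' e2 ik; rewrite mulrBr; lra.
Qed.

End Exponents.

(** * Outer bounds and null exceedances over blocks of levels *)

Section OuterProbability.
Context d (T : measurableType d) {R : realType} (P : probability T R).
Implicit Types (S : set T) (e : R).

(** A bound on the outer probability: events such as an exceedance at some u of a continuum are only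
    covered by measurable ones. *)
Definition prob_le S e : Prop :=
  exists D, [/\ measurable D, S `<=` D & (P D <= e%:E)%E].

Lemma prob_leS S S' e e' : S `<=` S' -> e' <= e -> prob_le S' e' -> prob_le S e.
Proof.
move=> SS ee [D [mD SD PD]]; exists D; split => //; first exact: subset_trans SD.
by apply: (le_trans PD); rewrite lee_fin.
Qed.

Lemma prob_leU S S' e e' : prob_le S e -> prob_le S' e' -> prob_le (S `|` S') (e + e').
Proof.
move=> [D [mD SD PD]] [D' [mD' SD' PD']]; exists (D `|` D'); split.
- exact: measurableU.
- exact: setUSS.
- have h : (P (D `|` D') <= P D + P D')%E by apply: measureU2.
  by apply: (le_trans h); rewrite EFinD leeD.
Qed.

Lemma prob_le0 e : 0 <= e -> prob_le set0 e.
Proof. by move=> e0; exists set0; split => //; rewrite measure0 lee_fin. Qed.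

Lemma prob_le_has (J : eqType) (s : seq J) (S : J -> set T) e : 0 <= e ->
  (forall j, j \in s -> prob_le (S j) e) ->
  prob_le [set w | exists2 j, j \in s & S j w] ((size s)%:R * e).
Proof.
move=> e0; elim: s => [|i s IH] h.
  by rewrite mul0r (_ : [set w | _] = set0); [exact: prob_le0|apply/seteqP; split => w //= []].
have hs j : j \in s -> prob_le (S j) e by move=> js; apply: h; rewrite inE js orbT.
have := prob_leU (h i (mem_head _ _)) (IH hs).
apply: prob_leS; last by rewrite /= -natr1 mulrDl mul1r addrC.
move=> w [j]; rewrite inE => /orP[/eqP ->|js] Sw; first by left.
by right; exists j.
Qed.

End OuterProbability.

Section NullExceedance.
Context d (T : measurableType d) {R : realType} (P : probability T R) (I : finType).
Variables (g : I -> T -> R).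
Hypothesis ig : iid_normal P g.
Local Notation p := (#|I|%:R : R).
Implicit Types (u v x y lam tau kap c L : R).

Definition pcount w u := #|[pred j | gtail `|g j w| <= u]|.

Definition exceeds lam w u : Prop :=
  p * u + lam * Num.sqrt (p * u * (1 - u)) < (pcount w u)%:R.

(* Rounding the p-values up to multiples of 1/M, with M >= p / a, costs the factor
   expR 1. *)
Lemma exceeds_block a b x lam L : 0 < a -> b <= 2^-1 -> 0 <= x -> 0 <= lam ->
  (forall u, a <= u -> u <= b ->
    L <= (p * u + lam * Num.sqrt (p * u * (1 - u))) * ln (1 + x / u) - p * ln (1 + x)) ->
  prob_le P [set w | exists u, [/\ a <= u, u <= b & exceeds lam w u]] (expR (1 - L)).
Proof.
move=> a0 b2 x0 lam0 hL.
pose M := (Num.truncn (p / a)).+1.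
have pM : p / a < M%:R by rewrite /M truncnS_gt.
have M0 : (0 : R) < M%:R by rewrite ltr0n.
have x1 : 0 < 1 + x by rewrite addrC ltr_wpDl.
(* Level for the crossing bound (1 + x)^p / C; the - 1 in the exponent makes room for the
   rounding. *)
pose C := (1 + x) ^+ #|I| * expR (L - 1).
have C0 : 0 < C by rewrite mulr_gt0 ?expR_gt0// exprn_gt0.
have [mD PD] := crossing_probability ig (ltn0Sn _ : (0 < M)%N) x0 C0.
have CE : (1 + x) ^+ #|I| / C = expR (1 - L).
  rewrite /C invfM mulrA divff ?mul1r ?expf_neq0 ?gt_eqF// -expRN; congr expR; ring.
rewrite CE in PD.
eexists; split; [exact: mD| |exact: PD] => w /= [u [au ub Nu]].
have u0 : 0 < u by exact: lt_le_trans au.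
have u1 : u < 1 by rewrite (le_lt_trans ub)// (le_lt_trans b2)// invf_lt1// ltr1n.
have uM0 : 0 <= u * M%:R by rewrite mulr_ge0// ltW.
pose i := Num.truncn (u * M%:R).
have ile : i%:R <= u * M%:R by rewrite truncn_le.
have ilt : u * M%:R < i.+1%:R by rewrite truncnS_gt.
have iM : (i < M)%N.
  by rewrite -(ltr_nat R) (le_lt_trans ile)// -[X in _ < X]mul1r ltr_pM2r.
exists i => //; set u' := i.+1%:R / M%:R.
have uu' : u < u' by rewrite ltr_pdivlMr.
have u'0 : 0 < u' by exact: lt_trans uu'.
have u'u : u' <= u + M%:R^-1.
  by rewrite /u' -natr1 mulrDl mul1r lerD2r ler_pdivrMr.
have xu0 t : 0 < t -> 0 < 1 + x / t by move=> t0; rewrite addrC ltr_wpDl// divr_ge0// ltW.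
have cc : (pcount w u <= pcount w u')%N.
  by apply: subset_leq_card; apply/fintype.subsetP => j; rewrite !inE => /le_trans; apply; exact: ltW.
apply: (@le_trans _ _ ((1 + x / u') ^+ pcount w u)); last first.
  by rewrite ler_weXn2l// lerDl divr_ge0// ltW.
rewrite -ler_ln ?posrE ?exprn_gt0 ?xu0// lnXn ?xu0// -mulr_natl.
rewrite /C lnM ?posrE ?exprn_gt0 ?expR_gt0// expRK lnXn// -mulr_natl.
have Mu0 : 0 < M%:R * u by rewrite mulr_gt0.
(* Rounding u up to u' lowers the logarithm by at most 1 / (M u), and the count is at most p <= M a
   <= M u: the total loss is at most 1. *)
have h1 : ln (1 + x / u) <= ln (1 + x / u') + (M%:R * u)^-1.
  apply: (@le_trans _ _ (ln ((1 + x / u') * (1 + (M%:R * u)^-1)))); last first.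
    rewrite lnM ?posrE ?xu0//; last by rewrite addr_gt0// invr_gt0.
    by rewrite lerD2l le_ln1Dx// (lt_trans (ltrN10 R))// invr_gt0.
  rewrite ler_ln ?posrE ?mulr_gt0 ?xu0//; last by rewrite addr_gt0// invr_gt0.
  have -> : 1 + x / u = 1 + (x / u') * (u' / u) by field; rewrite !gt_eqF.
  have h2 : u' / u <= 1 + (M%:R * u)^-1.
    rewrite ler_pdivrMr// mulrDl mul1r invfM -mulrA mulVf ?mulr1// gt_eqF//.
  have h3 : 0 <= x / u' by rewrite divr_ge0// ltW.
  have h4 : 0 <= (M%:R * u)^-1 by rewrite invr_ge0 ltW.
  have := ler_wpM2l h3 h2; nra.
have Np : (pcount w u)%:R <= p by rewrite ler_nat max_card.
have h5 : (pcount w u)%:R * (M%:R * u)^-1 <= 1.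
  rewrite ler_pdivrMr// mul1r (le_trans Np)//.
  apply: (@le_trans _ _ (M%:R * a)); last by rewrite ler_pM2l.
  by rewrite -ler_pdivrMr// ltW.
have l0 : 0 <= ln (1 + x / u) by rewrite ln_ge0// lerDl divr_ge0// ltW.
have N0 : 0 <= (pcount w u)%:R :> R by [].
have := hL u au ub; have := ler_wpM2r l0 (ltW Nu); have := ler_wpM2l N0 h1.
rewrite mulrDr; lra.
Qed.

End NullExceedance.

Section IidMarginal.
Context {R : realType} d (T : measurableType d) (P : probability T R) (I : finType).
Variables (g : I -> T -> R).
Hypothesis ig : iid_normal P g.

Lemma iid_normal_marginal j (A : set R) : measurable A ->
  P [set w | A (g j w)] = normal_prob 0 1 A.
Proof.
move=> mA; have := ig.2 (fun i => if i == j then A else setT).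
rewrite (bigD1 j)//= eqxx big1 ?mule1; last first.
  by move=> i /negbTE ->; rewrite probability_setT.
move=> <-; last by move=> i; case: ifP.
congr (P _); apply/seteqP; split => w /= => [h i|/(_ j)]; last by rewrite eqxx.
by case: eqP => // ->.
Qed.

Lemma iid_normal_measurable j (A : set R) : measurable A ->
  measurable [set w | A (g j w)].
Proof.
move=> mA; rewrite -[X in measurable X]setTI; exact: (ig.1 j measurableT).
Qed.

Lemma prob_le_marginal j (A : set R) e : measurable A -> nprob A <= e ->
  prob_le P [set w | A (g j w)] e.
Proof.
move=> mA Ae; exists [set w | A (g j w)]; split => //.
  exact: iid_normal_measurable.
by rewrite (iid_normal_marginal j mA) (nprobE mA) lee_fin.
Qed.

Lemma prob_le_tiny e : 0 <= e <= 1 ->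
  prob_le P [set w | exists j, gtail `|g j w| <= e] (#|I|%:R * e).
Proof.
move=> /andP[e0 e1].
have mA : measurable [set x : R | gtail `|x| <= e] by exact: measurable_gtail_le.
have := @prob_le_has _ T _ P _ (enum I) (fun j => [set w | gtail `|g j w| <= e]) e e0.
rewrite -cardE => h; apply: prob_leS (h _) => //.
- by move=> w [j hj]; exists j => //; rewrite mem_enum.
- move=> j _; have nA := gtail_uniform e0 e1.
  by apply: (prob_le_marginal j mA); rewrite nA.
Qed.

End IidMarginal.

Section NullLimit.
Context {R : realType}.

Lemma geometric_block (v c u : R) m : v <= u -> u < c ^+ m * v ->
  exists2 i, (i < m)%N & c ^+ i * v <= u <= c ^+ i.+1 * v.
Proof.
move=> vu; elim: m => [|m IH] um; first by move: um; rewrite expr0 mul1r ltNge vu.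
have [h|h] := ltP u (c ^+ m * v); last by exists m; rewrite ?ltnSn// h ltW.
by have [i im hi] := IH h; exists i => //; exact: leqW.
Qed.

Let eq_le (x y : R) : x = y -> x <= y. Proof. by move->. Qed.

Lemma expR_neg_le_inv (y : R) : 0 < y -> expR (- y) <= y^-1.
Proof.
move=> y0; rewrite expRN lef_pV2 ?posrE ?expR_gt0//.
by apply: le_trans (expR_ge1Dx _); rewrite lerDr.
Qed.

Section Bound.
Context d (T : measurableType d) (P : probability T R) (I : finType).
Variables (g : I -> T -> R).
Hypothesis ig : iid_normal P g.
Local Notation p := (#|I|%:R : R).

(* The three terms bound the exceedance at p u < 1 / lam (some p-value is tiny), at
   moderate p u, and over [m] geometric blocks up to 1/2. *)
Lemma exceeds_bound (tau kap c L L' : R) m : 0 < p -> 3 <= tau -> 1 <= kap -> 1 < c ->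
  L <= 35 / 100 * tau ^+ 2 - tau -> L <= 3 / 10 * tau / kap ->
  L' <= (tau ^+ 4) ^+ 2 / 2 * (1 - 2 * (c - 1) - 4 / kap) -> p <= c ^+ m ->
  prob_le P [set w | exists u, [/\ 0 < u, u <= 2^-1 & exceeds g (tau ^+ 4) w u]]
    ((tau ^+ 4)^-1 + expR (1 - L) + m%:R * expR (1 - L')).
Proof.
move=> p0 tau3 kap1 c1 hL1 hL2 hL' pc.
have tau0 : 0 < tau by rewrite (lt_le_trans _ tau3).
have kap0 : 0 < kap by rewrite (lt_le_trans _ kap1).
have c0 : 0 < c by rewrite (lt_trans _ c1).
set lam := tau ^+ 4.
have lam1 : 1 <= lam by rewrite exprn_ege1//; lra.
have lam0 : 0 < lam by rewrite (lt_le_trans _ lam1).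
have p1 : 1 <= p by move: p0; rewrite ltr0n => ?; rewrite ler1n.
pose a := (lam * p)^-1.
have a0 : 0 < a by rewrite invr_gt0 mulr_gt0.
(* Common end of the two ranges: p v = kap^2 lam^2 is the upper limit of [crude_exponent] and the
   lower limit of [sharp_exponent]. *)
pose v := kap ^+ 2 * lam ^+ 2 / p.
have v0 : 0 < v by rewrite divr_gt0// mulr_gt0// exprn_gt0.
have vE : p * v = kap ^+ 2 * lam ^+ 2 by rewrite /v mulrCA divff ?mulr1// gt_eqF.
have tiny : prob_le P [set w | exists j, gtail `|g j w| <= a] (lam^-1).
  have -> : lam^-1 = p * a by rewrite /a [in RHS]invfM mulrCA divff ?mulr1// gt_eqF.
  apply: (prob_le_tiny ig); rewrite (ltW a0)/= invf_le1 ?mulr_gt0//.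
  by rewrite (le_trans lam1)// ler_peMr// ltW.
have crude : prob_le P [set w | exists u, [/\ a <= u, u <= Num.min 2^-1 v & exceeds g lam w u]]
    (expR (1 - L)).
  apply: (exceeds_block ig (x := tau / p) a0).
  - by rewrite ge_min lexx.
  - by rewrite divr_ge0// ltW.
  - exact: ltW.
  move=> u au; rewrite le_min => /andP[u2 uv].
  apply: crude_exponent hL1 hL2 => //.
  have -> : kap ^+ 2 * tau ^+ 8 = kap ^+ 2 * lam ^+ 2 by rewrite /lam; ring.
  by rewrite -vE ler_pM2l.
have sharp i : (i < m)%N -> prob_le P [set w | exists u,
    [/\ c ^+ i * v <= u, u <= Num.min 2^-1 (c ^+ i.+1 * v) & exceeds g lam w u]]
    (expR (1 - L')).
  move=> _; have vi0 : 0 < c ^+ i * v by rewrite mulr_gt0// exprn_gt0.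
  pose vi := c ^+ i * v.
  apply: (exceeds_block ig (x := vi * lam / Num.sqrt (p * vi * (1 - vi))) vi0).
  - by rewrite ge_min lexx.
  - by rewrite divr_ge0 ?sqrtr_ge0// mulr_ge0// ltW.
  - exact: ltW.
  move=> u au; rewrite le_min => /andP[u2 uv].
  apply: (le_trans hL'); apply: sharp_exponent => //.
  - by rewrite mulrA -exprS.
  - rewrite -vE ler_pM2l// ler_peMl ?(ltW v0)// exprn_ege1// ltW//.
have sharps : prob_le P [set w | exists2 i, i \in iota 0 m & exists u,
    [/\ c ^+ i * v <= u, u <= Num.min 2^-1 (c ^+ i.+1 * v) & exceeds g lam w u]]
    (m%:R * expR (1 - L')).
  rewrite [X in prob_le _ _ X](_ : _ = (size (iota 0 m))%:R * expR (1 - L')); last by rewrite size_iota.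
  apply: prob_le_has (expR_ge0 _) _ => i.
  by rewrite mem_iota add0n; exact: sharp.
apply: prob_leS (prob_leU (prob_leU tiny crude) sharps) => //.
move=> w /= [u [u0 u2 hu]].
have [ua|au] := ltP u a.
  left; left.
  have : (0 < pcount g w u)%N.
    rewrite -(ltr_nat R); apply: le_lt_trans hu.
    by rewrite addr_ge0 ?mulr_ge0 ?sqrtr_ge0// ltW.
  move=> /card_gt0P[j]; rewrite inE => hj; exists j.
  exact: (le_trans hj (ltW ua)).
have [uv|vu] := leP u v.
  by left; right; exists u; split => //; rewrite le_min u2.
right.
(* The blocks reach beyond 1 / 2, as c^m v >= p v >= 1. *)
have ucm : u < c ^+ m * v.
  apply: (@lt_le_trans _ _ 1).
    by rewrite (le_lt_trans u2)// invf_lt1// ltr1n.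
  apply: (@le_trans _ _ (p * v)); last by rewrite ler_pM2r.
  rewrite vE -exprMn exprn_ege1//; nra.
have [i im /andP[h1 h2]] := geometric_block (ltW vu) ucm.
exists i; first by rewrite mem_iota.
by exists u; split => //; rewrite le_min u2.
Qed.

End Bound.
(** C comes before the probability space, so the bound is uniform over models and sigma. The crude
    range needs a parameter that is large but well below sqrt lam = tau^2, which is why lam is
    written as a fourth power. *)
Lemma exceeds_vanishes (a : R) : 0 < a -> exists C, 0 < C /\
  forall d (T : measurableType d) (P : probability T R) (I : finType)
    (g : I -> T -> R) (tau : R), iid_normal P g -> 3 <= tau ->
    tau ^+ 4 = (1 + a) * Num.sqrt (2 * ln (ln #|I|%:R)) ->
    prob_le P [set w | exists u, [/\ 0 < u, u <= 2^-1 & exceeds g (tau ^+ 4) w u]] (C / tau).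
Proof.
move=> a0.
have a10 : 0 < 1 + a by rewrite addr_gt0.
pose eps := a / (1 + a).
have eps0 : 0 < eps by rewrite divr_gt0.
have eps1 : eps <= 1 by rewrite ler_pdivrMr// mul1r lerDr.
(* Half of eps is lost to c and half to kap: 1 - 2 (c - 1) - 4 / kap = 1 - eps = 1 / (1 + a). Then
   L' = (1 + a) ln (ln p), against at most K ln p blocks, so their sum is of order (ln p)^-a. *)
pose kap := 8 / eps; pose c := 1 + eps / 4.
have kap8 : 8 <= kap by rewrite ler_pdivlMr// ler_piMr.
have kap0 : 0 < kap by rewrite (lt_le_trans _ kap8).
have c1 : 1 < c by rewrite ltrDl divr_gt0.
have lc0 : 0 < ln c by rewrite ln_gt0.
pose K := (ln c)^-1 + 1.
have K0 : 0 < K by rewrite addr_gt0// invr_gt0.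
have e0 : 0 < expR 1 :> R by exact: expR_gt0.
exists (1 + expR 1 * (10 / 3 * kap) + K * expR 1 * (2 * (1 + a) ^+ 2 / a)); split.
  by rewrite !addr_gt0// !(mulr_gt0,invr_gt0,exprn_gt0).
move=> d T P I g tau ig tau3 tauE.
have tau0 : 0 < tau by rewrite (lt_le_trans _ tau3).
set l := ln (ln _) in tauE.
have l0 : 0 < l.
  rewrite ltNge; apply/negP => l0; have : 0 < tau ^+ 4 by rewrite exprn_gt0.
  by rewrite tauE ler0_sqrtr ?mulr0 ?ltxx// pmulr_rle0.
have lp1 : 1 < ln #|I|%:R :> R.
  by rewrite ltNge; apply/negP => h; move: l0; rewrite ltNge ln_le0.
have p1 : (1 : R) < #|I|%:R.
  rewrite ltNge; apply/negP => h; have := ln_le0 h.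
  by rewrite leNgt (lt_trans _ lp1).
have p0 : (0 : R) < #|I|%:R by rewrite (lt_trans _ p1).
have tau8 : (tau ^+ 4) ^+ 2 = 2 * (1 + a) ^+ 2 * l.
  rewrite tauE exprMn sqr_sqrtr; first by ring.
  by rewrite mulr_ge0// ltW.
pose L := 3 / 10 * tau / kap; pose L' := (1 + a) * l.
have tk : tau / kap <= tau / 8 by rewrite ler_pM2l// lef_pV2// posrE.
have hL1 : L <= 35 / 100 * tau ^+ 2 - tau.
  have := ler_wpM2r (ltW tau0) tau3; rewrite -expr2 /L -mulrA; lra.
have hL' : L' <= (tau ^+ 4) ^+ 2 / 2 * (1 - 2 * (c - 1) - 4 / kap).
  have -> : 1 - 2 * (c - 1) - 4 / kap = (1 + a)^-1.
    have kE : 4 / kap = eps / 2 by rewrite /kap invf_div mulrA; lra.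
    have -> : 1 - 2 * (c - 1) - 4 / kap = 1 - eps by rewrite kE /c; lra.
    by rewrite /eps -[X in X - _](divff (lt0r_neq0 a10)) -mulrBl addrK mul1r.
  rewrite tau8 /L'; apply: eq_le; field; by rewrite gt_eqF.
have kap1 : 1 <= kap by lra.
have tau1 : 1 <= tau by lra.
pose m := (Num.truncn (ln #|I|%:R / ln c)).+1.
have mK : m%:R <= K * expR l.
  have -> : expR l = ln #|I|%:R by rewrite lnK// posrE (lt_trans _ lp1).
  rewrite /m -natr1 mulrDl mul1r lerD//; last exact: ltW.
  by rewrite [X in _ <= X]mulrC truncn_le divr_ge0// ltW// (lt_trans _ lp1).
have pc : #|I|%:R <= c ^+ m.
  rewrite -ler_ln ?posrE// ?exprn_gt0//; last by rewrite (lt_trans _ c1).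
  have -> : ln (c ^+ m) = m%:R * ln c by rewrite lnXn ?mulr_natl// (lt_trans _ c1).
  by rewrite -ler_pdivrMr//; apply/ltW; exact: truncnS_gt.
have b1 : (tau ^+ 4)^-1 <= 1 / tau.
  by rewrite div1r lef_pV2 ?posrE ?exprn_gt0//; exact: ler_eXnr.
have b2 : expR (1 - L) <= expR 1 * (10 / 3 * kap) / tau.
  rewrite expRD -mulrA ler_pM2l//; apply: (le_trans (expR_neg_le_inv _)).
    by rewrite !(mulr_gt0,invr_gt0).
  by apply: eq_le; rewrite /L; clear pc mK m; field; rewrite !gt_eqF.
have b3 : m%:R * expR (1 - L') <= K * expR 1 * (2 * (1 + a) ^+ 2 / a) / tau.
  apply: (@le_trans _ _ (K * expR l * expR (1 - L'))).
    by rewrite ler_wpM2r// expR_ge0.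
  rewrite -mulrA -expRD.
  have -> : l + (1 - L') = 1 + - (a * l) by rewrite /L'; clear pc mK m; ring.
  rewrite expRD [K * _]mulrA -!(mulrA (K * expR 1)) ler_pM2l ?mulr_gt0//.
  apply: (le_trans (expR_neg_le_inv _)); first by rewrite mulr_gt0.
  have -> : (a * l)^-1 = 2 * (1 + a) ^+ 2 / a / (2 * (1 + a) ^+ 2 * l).
    by clear pc mK m; field; rewrite !gt_eqF.
  rewrite -tau8 ler_pM2l ?lef_pV2 ?posrE ?exprn_gt0//; last first.
    by rewrite divr_gt0// mulr_gt0// exprn_gt0.
  by rewrite -exprM; exact: ler_eXnr.
apply: prob_leS (exceeds_bound ig p0 tau3 kap1 c1 hL1 (lexx _) hL' pc) => //.
by rewrite [X in _ <= X]mulrDl lerD// [X in _ <= X]mulrDl lerD.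
Qed.

End NullLimit.

(** * Type I error *)

Section Expectation.
Context d (T : measurableType d) {R : realType} (P : probability T R).
Import HBNNSimple.

(* Monotonicity of the integral holds without measurability of the smaller
   function because the library integral is a supremum over simple functions. *)
Lemma expectation_le_prob (f : T -> R) (E : set T) : measurable E ->
  (forall w, 0 <= f w) -> (forall w, f w <= \1_E w) -> ('E_P[f] <= P E)%E.
Proof.
move=> mE f0 fE; rewrite unlock ge0_integralTE; last by move=> w; rewrite lee_fin.
apply: ge_ereal_sup => _ [h /= hf <-].
rewrite -integralT_nnsfun.
apply: (@le_trans _ _ (\int[P]_w (\1_E w)%:E)%E); last by rewrite integral_indic// setIT.
apply: ge0_le_integral => //.
- by move=> w _; rewrite lee_fin.
- by apply/measurable_EFinP; exact: measurable_funP.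
- by apply/measurable_EFinP; exact: measurable_indic.
- by move=> w _; rewrite (le_trans (hf w))// lee_fin.
Qed.

Lemma expectation_prob_le (f : T -> R) (S : set T) e : prob_le P S e ->
  (forall w, 0 <= f w <= 1) -> (forall w, ~ S w -> f w = 0) -> ('E_P[f] <= e%:E)%E.
Proof.
move=> [D [mD SD PD]] f01 fS; apply: le_trans PD; apply: expectation_le_prob => // w.
  by case/andP: (f01 w).
rewrite indicE; have [wD|wD] := boolP (w \in D); first by case/andP: (f01 w).
by rewrite fS// => /SD wD'; rewrite mem_set in wD.
Qed.

End Expectation.

Lemma cvge_to0 {R : realType} (u : nat -> \bar R) :
  (forall e : R, 0 < e -> \forall m \near \oo, (0 <= u m <= e%:E)%E) ->
  u m @[m --> \oo] --> 0%E.
Proof.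
move=> h; apply/fine_cvgP; split.
  near=> m; have /andP[] : (0 <= u m <= 1%:E)%E by near: m; exact: h.
  by move=> u0 u1; rewrite ge0_fin_numE// (le_lt_trans u1)// ltry.
apply/cvgr0Pnorm_le => e e0; near=> m.
have /andP[] : (0 <= u m <= e%:E)%E by near: m; exact: h.
by rewrite /=; case: (u m) => [r|//|//]; rewrite !lee_fin /= => r0 re; rewrite ger0_norm.
Unshelve. all: by end_near. Qed.

Section TypeOne.
Context {R : realType}.

Lemma psi_HC_ge0_le1 n p (M : gaussian_regression R n p) a w :
  0 <= test_at (psi_HC a) (w : reg_space M) <= 1.
Proof. by rewrite /test_at /psi_HC; case: ifP => _; rewrite ?lexx ?ler01. Qed.

Lemma HC_null n p (M : gaussian_regression R n p) (sigma c e : R) :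
  0 < sigma -> (0 < n)%N -> 0 <= c ->
  (forall g : 'I_p -> reg_space M -> R, iid_normal (reg_law M 0 sigma) g ->
    prob_le (reg_law M 0 sigma)
      [set w | exists u, [/\ 0 < u, u <= 2^-1 & exceeds g c w u]] e) ->
  prob_le (reg_law M 0 sigma)
    [set w | (c%:E < HC_stat (\matrix_(i, j) reg_X M i j w) (\col_i reg_Y M i w))%E] e.
Proof.
move=> s0 n0 c0 h.
have := regression_representation M 0 s0 n0; rewrite /= scaler0.
move=> [g [eta [ig _ [mg _] _ hg]]].
have iidg : iid_normal (reg_law M 0 sigma) g by split.
apply: prob_leS (lexx e) (h g iidg) => w /=.
pose X : 'M[R]_(n, p) := \matrix_(i, j) reg_X M i j w.
pose Y : 'cV[R]_n := \col_i reg_Y M i w.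
rewrite -/X -/Y.
move=> /(HC_stat_gt c0)[u [u0 u2 hu]]; exists u; split => //.
rewrite /exceeds card_ord.
suff -> : pcount g w u = #|[pred j | HC_q X Y j <= u]| by [].
apply: eq_card => j; rewrite !inE HC_qE.
(* The representation requires Y nonzero. For Y = 0 the convention 1 / 0 = 0 makes every y_j equal
   to 0 and every p-value equal to 1, so the count vanishes at u <= 1 / 2. *)
have [y0|y0] := eqVneq (l2norm Y^T) 0.
  move: hu; rewrite ltNge => /negP; case.
  have -> : #|[pred j | HC_q X Y j <= u]| = 0%N.
    apply: eq_card0 => i; rewrite !inE HC_qE /HC_y y0 invr0 mulr0 normr0 gtail0.
    by apply/negbTE; rewrite -ltNge (le_lt_trans u2)// invf_lt1// ltr1n.
  by rewrite addr_ge0 ?mulr_ge0 ?sqrtr_ge0// ltW.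
by rewrite hg// mxE mul0r addr0.
Qed.

Lemma alpha_un_ge0 n p (M : gaussian_regression R n p) a :
  (0 <= alpha_un M (psi_HC a))%E.
Proof.
apply: (@le_trans _ _ ('E_(reg_law M 0 1)[test_at (psi_HC a)])%E).
  by apply: expectation_ge0 => w; case/andP: (psi_HC_ge0_le1 a w).
apply: ereal_sup_ubound; exists 1; [exact: ltr01|by []].
Qed.

Lemma HC_threshold_large (a B : R) : 0 < a -> exists N : nat, forall p, (N <= p)%N ->
  exists2 tau, B <= tau & tau ^+ 4 = (1 + a) * Num.sqrt (2 * ln (ln p%:R)).
Proof.
move=> a0; pose B' := Num.max B 1.
have B0 : 0 < B' by rewrite lt_max ltr01 orbT.
(* Then ln (ln p) exceeds B'^8, while tau^8 = 2 (1 + a)^2 ln (ln p). *)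
exists (Num.truncn (expR (expR (B' ^+ 8)))).+1 => p Np.
have hp : expR (expR (B' ^+ 8)) < p%:R.
  by apply: (lt_le_trans (truncnS_gt _)); rewrite ler_nat.
have p0 : 0 < p%:R :> R by rewrite (lt_trans _ hp)// expR_gt0.
have lp : expR (B' ^+ 8) < ln p%:R by rewrite -ltr_expR lnK.
have lp0 : 0 < ln p%:R :> R by rewrite (lt_trans _ lp)// expR_gt0.
have llp : B' ^+ 8 < ln (ln p%:R) by rewrite -ltr_expR lnK.
set l := ln (ln _) in llp *.
have l0 : 0 < l by rewrite (lt_trans _ llp)// exprn_gt0.
pose lam := (1 + a) * Num.sqrt (2 * l).
have lamB : B' ^+ 4 <= lam.
  apply: (@le_trans _ _ (Num.sqrt l)).
    have -> : B' ^+ 4 = Num.sqrt (B' ^+ 8).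
      by rewrite -[8%N]/(4 * 2)%N exprM sqrtr_sqr ger0_norm// exprn_ge0// ltW.
    by apply: ler_wsqrtr; exact: ltW.
  apply: (@le_trans _ _ (1 * Num.sqrt (2 * l))).
    by rewrite mul1r; apply: ler_wsqrtr; rewrite ler_peMl ?ler1n// ltW.
  by rewrite ler_wpM2r ?sqrtr_ge0// lerDl ltW.
have lam0 : 0 <= lam by rewrite (le_trans _ lamB)// exprn_ge0// ltW.
exists (Num.sqrt (Num.sqrt lam)); last first.
  by rewrite -[4%N]/(2 * 2)%N exprM !sqr_sqrtr ?sqrtr_ge0.
apply: (@le_trans _ _ B'); first by rewrite le_max lexx.
have -> : B' = Num.sqrt (Num.sqrt (B' ^+ 4)).
  rewrite -[4%N]/(2 * 2)%N exprM sqrtr_sqr ger0_norm ?sqr_ge0// sqrtr_sqr ger0_norm//.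
  exact: ltW.
by do 2 apply: ler_wsqrtr.
Qed.

Lemma alpha_un_cvg (M : forall n p, gaussian_regression R n p) a (n p : nat -> nat) :
  0 < a -> n @ \oo --> \oo -> p @ \oo --> \oo ->
  alpha_un (M (n m) (p m)) (psi_HC a) @[m --> \oo] --> 0%E.
Proof.
move=> a0 noo poo; apply: cvge_to0 => e e0.
have [C [C0 hC]] := exceeds_vanishes a0.
have [N hN] := HC_threshold_large (Num.max 3 (C / e)) a0.
near=> m; apply/andP; split; first exact: alpha_un_ge0.
have n0 : (0 < n m)%N by near: m; move/cvgnyPge: noo; apply.
have /hN[tau] : (N <= p m)%N by near: m; move/cvgnyPge: poo; apply.
rewrite ge_max => /andP[tau3 tauC] tauE.
have tau0 : 0 < tau by rewrite (lt_le_trans _ tau3).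
apply: ge_ereal_sup => _ [sigma /= s0 <-].
have tau4 : 0 <= tau ^+ 4 by rewrite exprn_ge0// ltW.
have h : prob_le (reg_law (M (n m) (p m)) 0 sigma) [set w | ((tau ^+ 4)%:E <
    HC_stat (\matrix_(i, j) reg_X (M (n m) (p m)) i j w) (\col_i reg_Y (M (n m) (p m)) i w))%E]
    (C / tau).
  apply: HC_null => // g ig; apply: hC => //.
  by rewrite card_ord.
apply: (@le_trans _ _ (C / tau)%:E); last first.
  by rewrite lee_fin ler_pdivrMr// mulrC -ler_pdivrMr.
apply: expectation_prob_le h _ _.
- by move=> w; exact: psi_HC_ge0_le1.
- by move=> w /= hw; rewrite /test_at /psi_HC -tauE ifF//; apply/negP.
Unshelve. all: by end_near. Qed.

End TypeOne.

(** * Exponential moments of Gaussian vectors *)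

Section ProductExpectation.
Context d (T : measurableType d) {R : realType} (P : probability T R).
Local Notation N := (@normal_prob R 0 1).

Lemma normal_over_mul (I : finType) (J : {set I}) (W : T -> measurableTypeR R)
    (z : I -> T -> R) i (f : R -> R) (c : R) :
  measurable_fun setT W -> (forall i, measurable_fun setT (z i)) ->
  normal_over P J W z -> i \in J -> (forall w, 0 <= W w) ->
  measurable_fun [set: measurableTypeR R] (f : measurableTypeR R -> measurableTypeR R) ->
  (forall x, 0 <= f x) -> (\int[N]_x (f x)%:E = c%:E)%E ->
  let W' := (fun w => W w * f (z i w)) : T -> measurableTypeR R in
  [/\ measurable_fun setT W', normal_over P (J :\ i)%SET W' z &
    (\int[P]_w (W' w)%:E = \int[P]_w (W w)%:E * c%:E)%E].
Proof.
move=> mW mz Wz iJ W0 mf f0 fc W'.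
pose G := (fun x : measurableTypeR R * measurableTypeR R => x.1 * f x.2) : _ -> measurableTypeR R.
have mG : measurable_fun setT G.
  apply: measurable_funM; first exact: measurable_fst.
  by apply: (measurableT_comp mf); exact: measurable_snd.
have mp := pair_measurable mW mz i.
have mW' : measurable_fun setT W' by exact: (measurableT_comp mG mp).
split => //.
  move=> B A mB mA.
  apply: (normal_over_absorb mW mz Wz iJ (B := G @^-1` B)) => //.
  rewrite -[X in measurable X]setTI; exact: mG.
pose Wm : {mfun T >-> measurableTypeR R} := HB.pack W (isMeasurableFun.Build _ _ _ _ W mW).
(* The absolute value makes the integrand nonnegative on the whole plane, not only over the range of
   W. *)
pose H := (fun x : measurableTypeR R * measurableTypeR R => (`|x.1| * f x.2)%:E).
have H0 x : (0 <= H x)%E by rewrite lee_fin mulr_ge0.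
have mH : measurable_fun setT H.
  apply/measurable_EFinP; apply: measurable_funM.
    by apply: measurableT_comp => //; exact: measurable_fst.
  by apply: (measurableT_comp mf); exact: measurable_snd.
transitivity (\int[pushforward_measure P mp]_x H x)%E.
  rewrite [RHS](ge0_integral_pushforward mp)//=; apply: eq_integral => w _.
  by rewrite /= /H /W' /= ger0_norm.
transitivity (\int[(distribution P Wm \x N)%E]_x H x)%E.
  apply: eq_measure_integral => S mS _.
  transitivity (P [set w | S (W w, z i w)]) => //.
  rewrite (normal_over_law mW mz Wz iJ mS).
  transitivity (\int[distribution P Wm]_x N (xsection S x))%E => //.
  rewrite ge0_integral_distribution//; exact: measurable_fun_xsection.
rewrite fubini_tonelli1//.
have mf' : measurable_fun [set: measurableTypeR R] (fun x => (f x)%:E).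
  by apply/measurable_EFinP.
have E x : fubini_F N H x = ((`|x|)%:E * c%:E)%E.
  rewrite /fubini_F -fc -ge0_integralZl//.
  by move=> y _; rewrite lee_fin.
under eq_integral do rewrite E.
have c0 : (0 <= c%:E)%E by rewrite -fc; apply: integral_ge0 => x _; rewrite lee_fin.
rewrite ge0_integralZr//; last by apply/measurable_EFinP; exact: normr_measurable.
rewrite ge0_integral_distribution//; last by apply/measurable_EFinP; exact: normr_measurable.
by congr (_ * _)%E; apply: eq_integral => w _ /=; rewrite ger0_norm.
Qed.

(** Induction over the coordinates, the running product serving as the conditioning variable of
    [normal_over]. *)
Lemma iid_normal_expectation_prod (I : finType) (g : I -> T -> R)
    (f : I -> R -> R) (c : I -> R) : iid_normal P g ->
  (forall i, measurable_fun [set: R] (f i)) -> (forall i x, 0 <= f i x) ->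
  (forall i, (\int[N]_x (f i x)%:E = (c i)%:E)%E) ->
  measurable_fun [set: T] (fun w => \prod_i f i (g i w)) /\
  (\int[P]_w (\prod_i f i (g i w))%:E = (\prod_i c i)%:E)%E.
Proof.
move=> [mg ig] mf f0 fc.
suff H s : uniq s ->
    let W := (fun w => \prod_(i <- s) f i (g i w)) : T -> measurableTypeR R in
    [/\ measurable_fun setT W, normal_over P (~: [set x in s])%SET W g &
       (\int[P]_w (W w)%:E = (\prod_(i <- s) c i)%:E)%E].
  by have [] := H (index_enum I) (index_enum_uniq I).
elim: s => [_ W|i s IH /= /andP[is_ us]].
  have W1 w : W w = 1 by rewrite /W big_nil.
  split.
  - have -> : W = cst 1 by apply/funext => w; rewrite W1.
    exact: measurable_cst.
  - move=> B A mB mA; have [B1|B1] := pselect (B 1).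
      have -> : W @^-1` B = setT by apply/seteqP; split => w //= _; rewrite W1.
      rewrite probability_setT mul1e (eq_bigl xpredT) => [|i]; last by rewrite !inE.
      rewrite -ig//; congr (P _); apply/seteqP; split => w /=.
        by move=> [_ h] i; apply: h; rewrite !inE.
      by move=> h; split => [|i _]; [rewrite W1|exact: h].
    have -> : W @^-1` B = set0 by apply/seteqP; split => w //=; rewrite W1.
    rewrite measure0 mul0e (_ : [set w | _] = set0) ?measure0//.
    by apply/seteqP; split => w //= [+ _]; rewrite W1.
  - under eq_integral do rewrite W1.
    by rewrite integral_cst// mul1e big_nil; exact: probability_setT.
have [mW nW iW] := IH us.
have W0 w : 0 <= \prod_(i <- s) f i (g i w) by apply: prodr_ge0.
have iJ : i \in (~: [set x in s])%SET by rewrite !inE.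
have [mW' nW' iW'] := normal_over_mul mW mg nW iJ W0 (mf i) (f0 i) (fc i).
have WE : (fun w => \prod_(j <- i :: s) f j (g j w)) =
    (fun w => (\prod_(j <- s) f j (g j w)) * f i (g i w)).
  by apply/funext => w; rewrite big_cons mulrC.
split.
- by rewrite WE.
- rewrite WE; have -> : (~: [set x in i :: s] = ~: [set x in s] :\ i)%SET.
    by apply/setP => x; rewrite !inE negb_or.
  exact: nW'.
- by under eq_integral do rewrite big_cons mulrC; rewrite iW' iW -EFinM big_cons mulrC.
Qed.

(** The last hypothesis is exponential tilting: the tilted density is c i times another Gaussian
    density, so the exponential moment is c i. Both linear forms and negative squares are of this
    kind. *)
Lemma iid_normal_chernoff (I : finType) (g : I -> T -> R) (h : I -> R -> R)
    (c m s : I -> R) (a : R) : iid_normal P g ->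
  (forall i, measurable_fun [set: R] (h i)) -> (forall i, s i != 0) ->
  (forall i x, expR (h i x) * normal_pdf 0 1 x = c i * normal_pdf (m i) (s i) x) ->
  prob_le P [set w | a <= \sum_i h i (g i w)] (expR (- a) * \prod_i c i).
Proof.
move=> ig mh s0 hc.
have c0 i : 0 <= c i.
  have p0 : 0 < normal_pdf (m i) (s i) 0 :> R.
    by rewrite normal_pdfE// mulr_gt0// ?normal_peak_gt0// expR_gt0.
  by rewrite -(pmulr_lge0 _ p0) -hc mulr_ge0 ?expR_ge0// normal_pdf_ge0.
have mf i : measurable_fun [set: R] (fun x => expR (h i x)).
  by apply: measurableT_comp => //; exact: mh.
have fc i : (\int[N]_x (expR (h i x))%:E = (c i)%:E)%E.
  rewrite ge0_integral_normal_prob//; last by apply/measurable_EFinP; exact: mf.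
  under eq_integral do rewrite -EFinM hc EFinM.
  rewrite ge0_integralZl//; last 3 first.
  - by apply/measurable_EFinP; exact: measurable_normal_pdf.
  - by move=> x _; rewrite lee_fin normal_pdf_ge0.
  - by rewrite lee_fin.
  by rewrite integral_normal_pdf mule1.
have [mE iE] := iid_normal_expectation_prod ig mf (fun i x => expR_ge0 _) fc.
have E w : \prod_i expR (h i (g i w)) = expR (\sum_i h i (g i w)) by rewrite expR_sum.
pose F := fun w => \prod_i expR (h i (g i w)).
have FE : [set w | a <= \sum_i h i (g i w)] = F @^-1` [set` `[expR a, +oo[].
  by apply/seteqP; split => w /=; rewrite in_itv/= andbT /F E ler_expR.
have mD : measurable [set w | a <= \sum_i h i (g i w)].
  rewrite FE -[X in measurable X]setTI; exact: (mE measurableT).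
exists [set w | a <= \sum_i h i (g i w)]; split => //.
rewrite EFinM -iE -ge0_integralZl//; last 2 first.
- by apply/measurable_EFinP.
- by move=> w _; rewrite lee_fin E expR_ge0.
rewrite -[X in P X]setIT -integral_indic//.
apply: ge0_le_integral => //.
- by apply/measurable_EFinP; exact: measurable_indic.
- by apply: measurable_funeM; apply/measurable_EFinP.
move=> w _; rewrite -EFinM lee_fin E -expRD indicE.
have [|_] := boolP (w \in _); last exact: expR_ge0.
by rewrite inE /= => aw; rewrite -expR0 ler_expR addrC subr_ge0.
Qed.

Lemma prob_le_linear_form (I : finType) (g : I -> T -> R) (theta : I -> R) (l a : R) :
  iid_normal P g -> 0 <= l ->
  prob_le P [set w | a <= \sum_i theta i * g i w]
    (expR (l ^+ 2 / 2 * \sum_i theta i ^+ 2 - l * a)).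
Proof.
move=> ig l0.
have mh i : measurable_fun [set: R] (fun z => l * theta i * z).
  by apply: measurable_funM.
have hc i x : expR (l * theta i * x) * normal_pdf 0 1 x =
    expR (l ^+ 2 / 2 * theta i ^+ 2) * normal_pdf (l * theta i) 1 x.
  rewrite !normal_pdfE ?oner_neq0// /normal_fun mulrCA [RHS]mulrCA.
  by congr (_ * _); rewrite -!expRD; congr expR; field.
have := iid_normal_chernoff (l * a) ig mh (fun=> oner_neq0 R) hc.
apply: prob_leS; last first.
  by rewrite -expR_sum -expRD -mulr_sumr addrC.
move=> w /= aw; under eq_bigr do rewrite -mulrA.
by rewrite -mulr_sumr ler_wpM2l.
Qed.

Lemma prob_le_energy (I : finType) (g : I -> T -> R) (e : R) :
  iid_normal P g -> 0 < e -> e < 1 ->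
  prob_le P [set w | \sum_i g i w ^+ 2 <= (1 - e) * #|I|%:R]
    (expR (- (e ^+ 2 / 4 * #|I|%:R))).
Proof.
move=> ig e0 e1.
(* The tilt by expR (- t z^2) costs s <= expR (- t + t^2) per coordinate, and t (1 - e) - t + t^2 is
   least at t = e / 2. *)
pose t := e / 2; have t0 : 0 < t by rewrite divr_gt0.
pose s := (Num.sqrt (1 + 2 * t))^-1.
have v0 : 0 < 1 + 2 * t by lra.
have s0 : 0 < s by rewrite invr_gt0 sqrtr_gt0.
have s2 : s ^+ 2 = (1 + 2 * t)^-1 by rewrite exprVn sqr_sqrtr// ltW.
have mh (i : I) : measurable_fun [set: R] (fun z => - (t * z ^+ 2)).
  by apply: measurableT_comp => //; apply: measurable_funM => //; apply: measurable_funX.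
have hc (i : I) x : expR (- (t * x ^+ 2)) * normal_pdf 0 1 x = s * normal_pdf 0 s x.
  rewrite !normal_pdfE ?oner_neq0 ?gt_eqF// /normal_fun !subr0.
  rewrite mulrCA [RHS]mulrA; congr (_ * _); last first.
    rewrite -expRD; congr expR; rewrite s2; field; rewrite gt_eqF//.
  have -> : normal_peak 1 = s * normal_peak s :> R.
    rewrite /normal_peak expr1n mul1r -mulrnAr sqrtrM ?sqr_ge0//.
    by rewrite sqrtr_sqr gtr0_norm// invfM mulrA divff ?mul1r// gt_eqF.
  by [].
have s0' (i : I) : s != 0 by rewrite gt_eqF.
have sE : s <= expR (- t + t ^+ 2).
  apply: le_of_sqr; first exact: expR_ge0.
  rewrite s2 -expRM_natl.
  have -> : 2%:R * (- t + t ^+ 2) = - (2 * t - (2 * t) ^+ 2 / 2) by field.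
  rewrite expRN lef_pV2 ?posrE ?expR_gt0// -[X in _ <= X](lnK v0) ler_expR.
  by apply: ln1D_ge; rewrite mulr_ge0// ltW.
have := iid_normal_chernoff (- (t * ((1 - e) * #|I|%:R))) ig mh s0' hc.
apply: prob_leS.
  move=> w /= hw.
  have -> : \sum_i - (t * g i w ^+ 2) = - (t * \sum_i g i w ^+ 2) by rewrite sumrN -mulr_sumr.
  by rewrite lerN2 ler_pM2l.
rewrite opprK prodr_const.
apply: (@le_trans _ _ (expR (t * ((1 - e) * #|I|%:R)) * expR (- t + t ^+ 2) ^+ #|I|)).
  rewrite ler_pM2l ?expR_gt0// lerXn2r ?nnegrE ?expR_ge0//; exact: ltW.
rewrite -expRM_natl -expRD ler_expR le_eqVlt; apply/orP; left; apply/eqP.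
by rewrite /t; field.
Qed.

End ProductExpectation.

(** * Signals *)

Section Signal.
Context {R : realType}.

Lemma regression_signal n p (M : gaussian_regression R n p) (theta : 'rV[R]_p)
    (sigma eps : R) : 0 < sigma -> (0 < n)%N -> 0 < eps -> eps < 1 ->
  let P := reg_law M (sigma *: theta) sigma in
  exists2 g : 'I_p -> reg_space M -> R, iid_normal P g &
  prob_le P [set w | ~ exists2 t, (1 - eps) * Num.sqrt n%:R /
        Num.sqrt (1 + \sum_j theta 0 j ^+ 2) <= t &
      forall j, HC_y (\matrix_(i, j) reg_X M i j w) (\col_i reg_Y M i w) j =
        g j w + theta 0 j * t]
    (expR (- (eps ^+ 2 / 16 * n%:R)) + expR (- (eps ^+ 2 / 8 * n%:R))).
Proof.
move=> s0 n0 e0 e1 P.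
have [g [eta [ig ieta [mg meta] Hn hg]]] := regression_representation M theta s0 n0.
exists g; first by split.
have iidg : iid_normal P g by split.
have iideta : iid_normal P eta by split.
set S := \sum_j theta 0 j ^+ 2 in Hn hg *.
have S0 : 0 <= S by apply: sumr_ge0 => j _; exact: sqr_ge0.
set kap := Num.sqrt (1 + S) in Hn hg *.
have kap2 : kap ^+ 2 = 1 + S by rewrite sqr_sqrtr// addr_ge0.
have kap0 : 0 < kap by rewrite sqrtr_gt0 ltr_pwDl.
pose e := eps / 2; have e0' : 0 < e by rewrite divr_gt0.
have e1' : e < 1 by rewrite /e; lra.
pose rn : R := Num.sqrt n%:R.
have rn0 : 0 < rn by rewrite sqrtr_gt0 ltr0n.
have rn2 : rn ^+ 2 = n%:R by rewrite sqr_sqrtr.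
(* Half of eps is spent on |Y|, half on the linear form: at level a the latter lowers t by e sqrt n
   / kap. The tilt l = a / (1 + kap)^2 would be optimal if S were (1 + kap)^2, an upper bound of S
   that never vanishes. *)
pose a := (1 + kap) * (e * rn).
pose l := e * rn / (1 + kap).
have k10 : 0 < 1 + kap by rewrite addr_gt0.
have l0 : 0 <= l by rewrite ltW// divr_gt0// mulr_gt0.
have h1 := prob_le_energy iideta e0' e1'; rewrite card_ord in h1.
have h2 := prob_le_linear_form (theta 0) a iidg l0.
apply: prob_leS (prob_leU h1 h2).
  move=> w /= hw; apply: contrapT => /not_orP[/negP]; rewrite -ltNge => E1 /negP; rewrite -ltNge => G1.
  apply: hw; move: E1; rewrite Hn; set Y := l2norm _ => E1.
  have Y0 : 0 <= Y by rewrite /Y /l2norm sqrtr_ge0.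
  have sk0 : 0 < sigma * kap by rewrite mulr_gt0.
  have Yn : (1 - e) * rn < Y / (sigma * kap).
    rewrite -(@ltr_pXn2r _ 2)// ?nnegrE ?mulr_ge0 ?divr_ge0 ?subr_ge0 ?invr_ge0// ?ltW//.
    apply: le_lt_trans E1; rewrite exprMn rn2 ler_wpM2r//; nra.
  have Yneq : Y != 0.
    apply/eqP => Y00; move: Yn; rewrite Y00 mul0r ltNge mulr_ge0//; lra.
  exists (Y / (sigma * kap ^+ 2) - (\sum_i theta 0 i * g i w) / (kap * (1 + kap))); last exact: hg.
  rewrite ler_pdivrMr//.
  have -> : (Y / (sigma * kap ^+ 2) - (\sum_i theta 0 i * g i w) / (kap * (1 + kap))) * kap =
      Y / (sigma * kap) - (\sum_i theta 0 i * g i w) / (1 + kap).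
    by field; rewrite !gt_eqF.
  have : (\sum_i theta 0 i * g i w) / (1 + kap) < e * rn.
    by rewrite ltr_pdivrMr// mulrC.
  have -> : (1 - eps) * Num.sqrt n%:R = (1 - e) * rn - e * rn by rewrite /rn /e; field.
  lra.
rewrite lerD// ler_expR.
  by rewrite lerN2 /e; apply: ler_wpM2r => //; rewrite le_eqVlt; apply/orP; left; apply/eqP; field.
rewrite -/S.
have -> : l * a = eps ^+ 2 / 4 * n%:R.
  by rewrite /l /a -rn2 /e; field; rewrite gt_eqF.
have : l ^+ 2 * S <= eps ^+ 2 / 4 * n%:R.
  have -> : l ^+ 2 * S = eps ^+ 2 / 4 * n%:R * (S / (1 + kap) ^+ 2).
    by rewrite /l -rn2 /e; field; rewrite gt_eqF.
  apply: ler_piMr; first by rewrite mulr_ge0// mulr_ge0 ?sqr_ge0.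
  by rewrite ler_pdivrMr ?exprn_gt0// mul1r; nra.
lra.
Qed.

(* Forces |z + b| >= t, and still does when b is multiplied by a factor >= 1; the
   latter fails for the event |z + b| >= t itself. *)
Definition signal_event (t b : R) : set R :=
  if b == 0 then [set z | t < `|z|] else [set z | t - `|b| <= Num.sg b * z].

Lemma measurable_signal_event t b : measurable (signal_event t b).
Proof.
rewrite /signal_event; case: ifP => _; first exact: measurable_lt_norm.
have -> : [set z : R | t - `|b| <= Num.sg b * z] = (fun z : R => Num.sg b * z) @^-1` [set` `[t - `|b|, +oo[].
  by apply/seteqP; split => z /=; rewrite in_itv/= andbT.
apply: measurable_preimage; last exact: measurable_itv.
by apply: measurable_funM.
Qed.

Lemma nprob_signal_ge t b s : b != 0 -> 0 <= s -> t - `|b| <= s ->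
  normal_peak 1 * expR (- ((s + 1) ^+ 2 / 2)) <= nprob (signal_event t b).
Proof.
move=> b0 s0 ts; apply: (le_trans (nprob_ge_lb s0)).
have mA : measurable [set z : R | s <= z].
  have -> : [set z : R | s <= z] = [set` `[s, +oo[] by apply/seteqP; split => z /=; rewrite in_itv/= andbT.
  exact: measurable_itv.
case: (ltrgtP b 0) b0 => // hb _.
- rewrite -(nprob_opp mA); apply: nprob_le.
  + by rewrite -[X in measurable X]setTI; apply: oppr_measurable.
  + exact: measurable_signal_event.
  + by move=> z /=; rewrite /signal_event lt_eqF//= ltr0_sg// mulN1r; exact: le_trans.
- apply: nprob_le => //; first exact: measurable_signal_event.
  by move=> z /=; rewrite /signal_event gt_eqF//= gtr0_sg// mul1r; exact: le_trans.
Qed.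

Lemma nprob_signal_miss t b : b != 0 -> 0 <= `|b| - t ->
  nprob (~` signal_event t b) <= 2 * expR (- ((`|b| - t) ^+ 2 / 2)).
Proof.
move=> b0 bt; apply: le_trans (gtail_ub bt).
apply: nprob_le; [by apply: measurableC; exact: measurable_signal_event|exact: measurable_lt_norm|].
move=> z /=; rewrite /signal_event (negbTE b0) => /negP; rewrite -ltNge => h.
have -> : `|z| = `|Num.sg b * z| by rewrite normrM normr_sg b0 mul1r.
have := ler_norm (- (Num.sg b * z)); rewrite normrN; lra.
Qed.

(** Trades the random factor T for its deterministic lower bound T0: multiplying a signal by T / T0
    >= 1 keeps the detections, so the counted events have a nonrandom b. *)
Lemma signal_count n p (X : 'M[R]_(n, p)) (Y : 'cV[R]_n) (g b : 'I_p -> R) (t T0 T : R) :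
  0 < T0 -> T0 <= T -> 0 <= t ->
  (forall j, HC_y X Y j = g j + b j / T0 * T) ->
  \sum_j (\1_(signal_event t (b j)) (g j) : R) <= #|[pred j | HC_q X Y j <= gtail t]|%:R.
Proof.
move=> T00 TT t0 hy.
have -> : #|[pred j | HC_q X Y j <= gtail t]|%:R = \sum_j (HC_q X Y j <= gtail t)%R%:R :> R.
  rewrite -sum1_card natr_sum [LHS]big_mkcond; apply: eq_bigr => j _.
  by rewrite inE; case: ifP.
apply: ler_sum => j _; rewrite indicE.
have [sj|_] := boolP (g j \in signal_event t (b j)); last exact: ler0n.
suff -> : HC_q X Y j <= gtail t by [].
move: sj; rewrite inE HC_qE gtail_le// hy => sj.
have TT0 : 1 <= T / T0 by rewrite ler_pdivlMr// mul1r.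
rewrite -mulrA [_^-1 * _]mulrC; set c := T / T0 in TT0 *.
move: sj; rewrite /signal_event; case: eqP => [->|/eqP b0] /=.
  by rewrite mul0r addr0 => /ltW.
move=> h; rewrite -[X in _ <= X]mul1r -(_ : `|Num.sg (b j)| = 1); last by rewrite normr_sg b0.
rewrite -normrM; apply: le_trans (ler_norm _).
rewrite mulrDr mulrA -normrEsg.
have : `|b j| <= `|b j| * c by rewrite ler_peMr.
lra.
Qed.

Section Detection.
Context d (T : measurableType d) (P : probability T R) (I : finType).
Variables (g : I -> T -> R) (b : I -> R) (t : R).
Hypothesis ig : iid_normal P g.
Local Notation p := (#|I|%:R : R).
Local Notation u := (gtail t).

Let count w := \sum_j (\1_(signal_event t (b j)) (g j w) : R).

Lemma single_signal j : b j != 0 -> 0 <= `|b j| - t ->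
  prob_le P [set w | count w < 1] (2 * expR (- ((`|b j| - t) ^+ 2 / 2))).
Proof.
move=> b0 bt.
have mS := measurable_signal_event t (b j).
have := prob_le_marginal ig j (measurableC mS) (nprob_signal_miss b0 bt).
apply: prob_leS => // w /= h hj; move: h; rewrite ltNge /count (bigD1 j)//= => /negP; apply.
rewrite indicE mem_set// lerDl; apply: sumr_ge0 => i _; by rewrite indicE.
Qed.

(** V is the scale of the fluctuations of the false positives and E the signal-to-noise ratio.
    Signals and threshold cost at most (2 + 2 lam) V <= Pi / 2, so the deviation is at least Pi / 2;
    as E mu <= 3 Pi^2, the exponent delta^2 / (4 mu) is at least E / 48. *)
Lemma dense_signal (lam V E : R) : 1 <= V -> 0 <= lam -> 4 + 4 * lam <= E ->
  p * u <= 2 * V ^+ 2 -> #|[pred j | b j != 0]|%:R * u <= 2 * V ->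
  E * V <= \sum_(j | b j != 0) nprob (signal_event t (b j)) ->
  prob_le P [set w | count w <= p * u + lam * Num.sqrt (p * u)] (expR (- (E / 48))).
Proof.
move=> V1 lam0 E0 puV suV.
set Pi := \sum_(_ | _) _ => EV.
pose mu := \sum_j nprob (signal_event t (b j)).
have u0 : 0 <= u by exact: nprob_ge0.
have nb0 j : b j == 0 -> nprob (signal_event t (b j)) = u.
  by move=> bj; rewrite /signal_event bj.
set s : R := #|[pred j | b j != 0]|%:R in suV.
have muE : mu = (p - s) * u + Pi.
  rewrite /mu (bigID (fun j => b j == 0))/= (eq_bigr (fun=> u)) => [|j]; last exact: nb0.
  have -> : \sum_(j | b j == 0) u = #|[pred j | b j == 0]|%:R * u.
    by rewrite -[LHS]/(\sum_(j in [pred j | b j == 0]) u) sumr_const mulr_natl.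
  by rewrite /s -(cardC [pred j | b j == 0]) natrD addrK.
have sp : s <= p by rewrite ler_nat max_card.
have s0 : 0 <= s by exact: ler0n.
have EV1 : E <= Pi by apply: le_trans EV; rewrite ler_peMr//; lra.
have E4 : 4 <= E by lra.
have Pi0 : 0 < Pi by lra.
have mu0 : 0 < mu by rewrite muE; nra.
have squV : Num.sqrt (p * u) <= 2 * V.
  have -> : 2 * V = Num.sqrt ((2 * V) ^+ 2) by rewrite sqrtr_sqr ger0_norm//; lra.
  by apply: ler_wsqrtr; apply: (le_trans puV); rewrite exprMn; nra.
pose delta := mu - (p * u + lam * Num.sqrt (p * u)).
have hdelta : Pi / 2 <= delta.
  have h1 : lam * Num.sqrt (p * u) <= lam * (2 * V) by rewrite ler_wpM2l.
  have h2 : (4 + 4 * lam) * V <= E * V by rewrite ler_wpM2r//; lra.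
  rewrite /delta muE; lra.
have delta0 : 0 <= delta by lra.
have [mD PD] := chernoff_lower ig (fun j => measurable_signal_event t (b j)) (erefl mu) delta0 mu0.
exists [set w | \sum_j (\1_(signal_event t (b j)) (g j w) : R) <= mu - delta].
split; [exact: mD|by move=> w; rewrite /delta subKr|].
apply: (le_trans PD); rewrite lee_fin ler_expR lerN2.
rewrite ler_pdivlMr ?mulr_gt0//.
have h3 : (Pi / 2) ^+ 2 <= delta ^+ 2 by rewrite ler_sqr ?nnegrE//; lra.
apply: le_trans h3.
have h4 : mu <= 2 * V ^+ 2 + Pi by rewrite muE; nra.
have h5 : E * (2 * V ^+ 2) <= 2 * (Pi ^+ 2).
  have h6 : (E * V) ^+ 2 <= Pi ^+ 2.
    by rewrite ler_sqr ?nnegrE ?mulr_ge0//; lra.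
  have h7 : E * V ^+ 2 <= (E * V) ^+ 2.
    by rewrite exprMn ler_wpM2r ?sqr_ge0//; nra.
  lra.
have h8 : E * Pi <= Pi ^+ 2 by rewrite expr2 ler_wpM2r// ltW.
have h9 : E * mu <= E * (2 * V ^+ 2 + Pi) by rewrite ler_wpM2l//; lra.
have -> : E / 48 * (4 * mu) = E * mu / 12 by field.
lra.
Qed.

End Detection.

End Signal.

(** * Detection above the boundary *)

Section Boundary.
Context {R : realType}.

(* [phi + h] is the threshold, in units of sqrt (ln p), at which the power of the
   test is best; the last equation says that k p^(-h^2/2) and sqrt (p u), with
   u = p^(-(phi + h)^2/2), have the same order. *)
Lemma phi_boundary_split (beta : R) : 2^-1 < beta -> beta < 1 ->
  exists h, [/\ 0 < h, 0 < phi_boundary beta, (phi_boundary beta + h) ^+ 2 <= 2 &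
    1 - beta - h ^+ 2 / 2 = (1 - (phi_boundary beta + h) ^+ 2 / 2) / 2].
Proof.
(* Up to 3 / 4 the best threshold is 2 phi, that is h = phi, and the constraint (phi + h)^2 <= 2 is
   met. Beyond, this constraint binds and phi + h = sqrt 2. *)
move=> b2 b1; rewrite /phi_boundary; case: (leP beta (3 / 4)) => hb.
  set f := Num.sqrt _.
  have f2 : f ^+ 2 = 2 * beta - 1 by rewrite sqr_sqrtr//; lra.
  have f0 : 0 < f by rewrite sqrtr_gt0; lra.
  exists f; split => //.
  - have -> : (f + f) ^+ 2 = 4 * f ^+ 2 by ring.
    by rewrite f2; lra.
  - have -> : (f + f) ^+ 2 = 4 * f ^+ 2 by ring.
    by rewrite f2; field.
set s := Num.sqrt (1 - beta); set r := Num.sqrt 2.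
have s2 : s ^+ 2 = 1 - beta by rewrite sqr_sqrtr//; lra.
have r2 : r ^+ 2 = 2 by rewrite sqr_sqrtr.
have s0 : 0 < s by rewrite sqrtr_gt0; lra.
have r0 : 0 < r by rewrite sqrtr_gt0.
have s1 : s < 1.
  rewrite -(@ltr_pXn2r _ 2)// ?nnegrE ?ltW// s2 expr1n; lra.
have e : r * (1 - s) + r * s = r by ring.
exists (r * s); split.
- exact: mulr_gt0.
- by rewrite mulr_gt0// subr_gt0.
- by rewrite e r2.
- by rewrite e r2 exprMn r2 s2; field.
Qed.

Lemma expR_ge_sqr (x : R) : 0 <= x -> x ^+ 2 / 4 <= expR x.
Proof.
move=> x0; have -> : expR x = expR (x / 2) ^+ 2.
  by rewrite -expRM_natl; congr expR; field.
have -> : x ^+ 2 / 4 = (x / 2) ^+ 2 by field.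
rewrite ler_sqr ?nnegrE ?expR_ge0//; last by rewrite divr_ge0.
by apply: le_trans (expR_ge1Dx _); lra.
Qed.

(* With L = ln p, the right-hand side is the expected number of detected signals
   divided by the standard deviation of the number of false ones. *)
Lemma exponent_large (C kap h : R) : 0 < C -> 0 < kap -> 0 < h ->
  exists L0, forall L, L0 <= L -> L <= C * expR (kap * L - h * Num.sqrt L - 2^-1).
Proof.
move=> C0 k0 h0.
pose y0 := 1 + (2 * h + 1) / kap.
have y00 : 1 <= y0 by rewrite lerDl divr_ge0//; lra.
exists (Num.max (y0 ^+ 2) (16 / (C * kap ^+ 2))) => L; rewrite ge_max => /andP[L1 L2].
have L0 : 0 < L by apply: lt_le_trans L1; rewrite exprn_gt0//; lra.
set y := Num.sqrt L.
have y2 : y ^+ 2 = L by rewrite sqr_sqrtr// ltW.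
have y_ge : y0 <= y by apply: le_of_sqr; [exact: sqrtr_ge0|rewrite y2].
have hq : kap * L / 2 <= kap * L - h * y - 2^-1.
  have ky : 2 * h + 1 <= kap * y.
    have : kap * y0 <= kap * y by rewrite ler_pM2l.
    rewrite /y0 mulrDr mulr1 mulrCA divff ?gt_eqF// mulr1; lra.
  have y1 : 1 <= y by lra.
  have h1 : (2 * h + 1) * y <= kap * L by rewrite -y2 expr2 mulrA ler_wpM2r//; lra.
  lra.
have kL0 : 0 <= kap * L / 2 by rewrite divr_ge0// mulr_ge0// ltW.
have h2 := expR_ge_sqr kL0.
have h3 : L <= C * ((kap * L / 2) ^+ 2 / 4).
  have Ck : 0 < C * kap ^+ 2 by rewrite mulr_gt0// exprn_gt0.
  have h4 : 16 <= L * (C * kap ^+ 2) by rewrite -ler_pdivrMr.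
  have h5 := ler_wpM2l (ltW L0) h4.
  have -> : C * ((kap * L / 2) ^+ 2 / 4) = L * (L * (C * kap ^+ 2)) / 16 by field.
  lra.
apply: (le_trans h3); rewrite ler_pM2l//; apply: (le_trans h2).
by rewrite ler_expR.
Qed.

Lemma threshold_le (a : R) : 0 < a -> exists L0, forall L, L0 <= L ->
  4 + 4 * ((1 + a) * Num.sqrt (2 * ln L)) <= L.
Proof.
move=> a0; exists ((12 + 8 * a) ^+ 2) => L hL.
have L0 : 0 < L by apply: lt_le_trans hL; rewrite exprn_gt0//; lra.
set y := Num.sqrt L.
have y2 : y ^+ 2 = L by rewrite sqr_sqrtr// ltW.
have y_ge : 12 + 8 * a <= y by apply: le_of_sqr; [exact: sqrtr_ge0|rewrite y2].
have h1 : Num.sqrt (2 * ln L) <= 2 * y.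
  apply: (@le_trans _ _ (Num.sqrt ((2 * y) ^+ 2))).
    apply: ler_wsqrtr; rewrite exprMn y2.
    have : ln L <= L.
      by rewrite -ler_expR lnK//; apply: le_trans (expR_ge1Dx L); rewrite lerDr.
    lra.
  by rewrite sqrtr_sqr ger0_norm//; lra.
have a10 : 0 <= 1 + a by lra.
have h2 := ler_wpM2l a10 h1.
have h3 : (12 + 8 * a) * y <= L by rewrite -y2 expr2 ler_wpM2r//; lra.
lra.
Qed.

Definition sigtest (a : R) (I : finType) (b : I -> R) (t : R) : Prop :=
  forall d (T : measurableType d) (P : probability T R) (g : I -> T -> R), iid_normal P g ->
  prob_le P [set w | \sum_j (\1_(signal_event t (b j)) (g j w) : R) <=
      #|I|%:R * gtail t + (1 + a) * Num.sqrt (2 * ln (ln #|I|%:R)) * Num.sqrt (#|I|%:R * gtail t)]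
    (48 / ln #|I|%:R).

Lemma gtail_half (L c : R) : 0 < c -> 0 < L -> 8 / c ^+ 2 <= L -> gtail (c * Num.sqrt L) <= 2^-1.
Proof.
move=> c0 L0 hL.
have s0 : 0 <= c * Num.sqrt L by rewrite mulr_ge0 ?sqrtr_ge0// ltW.
apply: (le_trans (gtail_ub s0)); rewrite exprMn sqr_sqrtr ?(ltW L0)//.
have c2 : 0 < c ^+ 2 by rewrite exprn_gt0.
have x0 : 0 < c ^+ 2 * L / 2 by rewrite divr_gt0// mulr_gt0.
have h1 := expR_neg_le_inv x0.
have h2 : (c ^+ 2 * L / 2)^-1 <= 4^-1.
  rewrite lef_pV2 ?posrE// ler_pdivlMr//; move: hL; rewrite ler_pdivrMr//; lra.
lra.
Qed.

(** At t = (3 / 2) sqrt L the expected number of false positives is at most 2 p^(-1/8), so the count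
    to be exceeded is below 1, while the signal lies at least sqrt L / 2 above t. *)
Lemma single_test (a : R) : 0 < a -> exists L0, forall (I : finType) (b : I -> R) (L := ln #|I|%:R : R) j,
  L0 <= L -> 2 * Num.sqrt L <= `|b j| ->
  let t := 3 / 2 * Num.sqrt L in [/\ 0 <= t, gtail t <= 2^-1 & sigtest a b t].
Proof.
move=> a0; have a10 : 0 <= 1 + a by rewrite ltW// addr_gt0.
have [L1 hL1] := threshold_le a0.
exists (Num.max L1 600) => I b L j; rewrite ge_max => /andP[/hL1 lam L600] bj t.
have L0 : 0 < L by lra.
set y := Num.sqrt L in bj t *.
have y2 : y ^+ 2 = L by rewrite sqr_sqrtr// ltW.
have y0 : 0 < y by rewrite sqrtr_gt0.
have t0 : 0 <= t by rewrite mulr_ge0// ltW.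
split => //.
  by apply: gtail_half => //; lra.
move=> d T P g ig; rewrite -/L.
have p0 : 0 < #|I|%:R :> R.
  by rewrite ltNge; apply/negP => /ln0; rewrite -/L; lra.
have pE : #|I|%:R = expR L by rewrite lnK.
have b0 : b j != 0 by apply/eqP => bj0; move: bj; rewrite bj0 normr0; lra.
have bt : y / 2 <= `|b j| - t by rewrite /t; lra.
have bt0 : 0 <= `|b j| - t by lra.
pose x := expR (- (L / 16)).
have x0 : 0 <= x by exact: expR_ge0.
have hx2 : x ^+ 2 = expR (- (L / 8)) by rewrite -expRM_natl; congr expR; field.
have x2L : x ^+ 2 <= 8 / L.
  by rewrite hx2 -[8 / L]invf_div; apply: expR_neg_le_inv; rewrite divr_gt0.
have xL : x * L <= 1024 / L.
  have L16 : 0 <= L / 16 by rewrite divr_ge0// ltW.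
  have := expR_ge_sqr L16.
  move=> /(ler_wpM2r x0); rewrite /x expRxMexpNx_1 -/x ler_pdivlMr// => hx; lra.
have pu : #|I|%:R * gtail t <= 2 * x ^+ 2.
  rewrite hx2; apply: (@le_trans _ _ (expR L * (2 * expR (- (t ^+ 2 / 2))))).
    by rewrite pE ler_pM2l ?expR_gt0//; exact: gtail_ub.
  rewrite mulrCA ler_pM2l// -expRD ler_expR /t exprMn y2; lra.
have spu : Num.sqrt (#|I|%:R * gtail t) <= 2 * x.
  apply: (@le_trans _ _ (Num.sqrt ((2 * x) ^+ 2))); last first.
    by rewrite sqrtr_sqr ger0_norm// mulr_ge0.
  apply: ler_wsqrtr; apply: (le_trans pu); rewrite exprMn; have := sqr_ge0 x; lra.
have := single_signal ig b0 bt0.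
apply: prob_leS.
  move=> w /= hw; apply: (le_lt_trans hw).
  set lam' := (1 + a) * _ in lam *.
  have lam'0 : 0 <= lam' by apply: mulr_ge0; [exact: a10|exact: sqrtr_ge0].
  have h1 : lam' * Num.sqrt (#|I|%:R * gtail t) <= lam' * (2 * x) by rewrite ler_wpM2l.
  have h2 : lam' * (2 * x) <= L / 4 * (2 * x) by rewrite ler_wpM2r ?mulr_ge0//; lra.
  have iL : 600 * L^-1 <= 1 by rewrite ler_pdivrMr// mul1r.
  lra.
apply: (@le_trans _ _ (2 * x ^+ 2)).
  rewrite ler_pM2l// hx2 ler_expR lerN2.
  have : (y / 2) ^+ 2 <= (`|b j| - t) ^+ 2 by rewrite ler_sqr ?nnegrE ?divr_ge0// ltW.
  have -> : (y / 2) ^+ 2 = L / 4 by rewrite -y2; field.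
  lra.
have iL : 0 < L^-1 by rewrite invr_gt0.
lra.
Qed.

(* No coordinate dominates, so a reverse Markov inequality leaves a proportion [c]
   of the k coordinates above the level D0 > phi; at the threshold phi + h each of
   them is detected with probability about p^(-(h - e)^2/2). *)
Lemma dense_test (beta a phi h D : R) : 0 < a -> 0 < h -> 0 < phi ->
  (phi + h) ^+ 2 <= 2 -> 1 - beta - h ^+ 2 / 2 = (1 - (phi + h) ^+ 2 / 2) / 2 ->
  phi < D -> exists L0, forall (I : finType) (b : I -> R) (L := ln #|I|%:R : R),
  L0 <= L -> #|[pred j | b j != 0]|%:R <= expR ((1 - beta) * L) ->
  D ^+ 2 * expR ((1 - beta) * L) * L <= \sum_j b j ^+ 2 ->
  (forall j, `|b j| <= 2 * Num.sqrt L) ->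
  let t := (phi + h) * Num.sqrt L in [/\ 0 <= t, gtail t <= 2^-1 & sigtest a b t].
Proof.
move=> a0 h0 phi0 t2 hE phiD; have a10 : 0 <= 1 + a by rewrite ltW// addr_gt0.
(* D0 = phi + e must stay below D for the reverse Markov step, and e <= h keeps the distance (h - e)
   sqrt L from D0 sqrt L to the threshold nonnegative. *)
pose e := Num.min ((D - phi) / 2) (h / 2).
have e0 : 0 < e by rewrite lt_min !divr_gt0// subr_gt0.
have eD : e <= (D - phi) / 2 by rewrite ge_min lexx.
have eh : e <= h / 2 by rewrite ge_min lexx orbT.
pose D0 := phi + e.
(* If |J| coordinates exceed D0 sqrt L, all being at most 2 sqrt L, the energy is at most 4 L |J| +
   D0^2 L k; hence |J| >= c k. *)
pose c := (D ^+ 2 - D0 ^+ 2) / 4.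
have c0 : 0 < c.
  have -> : c = (D - D0) * (D + D0) / 4 by rewrite /c; field.
  by rewrite divr_gt0// mulr_gt0//; rewrite /D0; lra.
have pk0 : 0 < normal_peak 1 :> R by rewrite normal_peak_gt0// oner_neq0.
have cp0 : 0 < c * normal_peak 1 by rewrite mulr_gt0.
have eh0 : 0 < e * h / 2 by rewrite divr_gt0// mulr_gt0.
have [L1 hL1] := threshold_le a0.
have [L2 hL2] := exponent_large cp0 eh0 h0.
exists (Num.max 1 (Num.max (8 / (phi + h) ^+ 2) (Num.max L1 L2))) => I b L.
rewrite !ge_max => /and4P[L_1 L8 /hL1 lam /hL2 EL] supp energy bmax t.
have L0 : 0 < L by lra.
set y := Num.sqrt L in bmax t EL *.
have y2 : y ^+ 2 = L by rewrite sqr_sqrtr// ltW.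
have y0 : 0 < y by rewrite sqrtr_gt0.
have t0 : 0 <= t by rewrite mulr_ge0// ltW// addr_gt0.
split => //; first by apply: gtail_half => //; exact: addr_gt0.
move=> d T P g ig; rewrite -/L.
have p0 : 0 < #|I|%:R :> R.
  by rewrite ltNge; apply/negP => /ln0; rewrite -/L; lra.
have pE : #|I|%:R = expR L by rewrite lnK.
pose w := (1 - (phi + h) ^+ 2 / 2) / 2.
pose V := expR (w * L).
pose k := expR ((1 - beta) * L); rewrite -/k in supp energy.
have k0 : 0 < k by exact: expR_gt0.
have bE : 1 - beta = w + h ^+ 2 / 2 by rewrite /w -hE; ring.
pose s := (h - e) * y.
have s0 : 0 <= s by rewrite mulr_ge0 ?ltW//; lra.
(* Chosen so that E V is c k times the lower bound on the power of one strong signal, where V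
   dominates sqrt (p u) up to a constant. *)
pose Q := h ^+ 2 / 2 * L - (s + 1) ^+ 2 / 2.
pose E := c * normal_peak 1 * expR Q.
have LE : L <= E.
  apply: (le_trans EL); rewrite ler_pM2l// ler_expR /Q /s.
  have -> : h ^+ 2 / 2 * L - ((h - e) * y + 1) ^+ 2 / 2 =
    (e * (2 * h - e) / 2) * y ^+ 2 - (h - e) * y - 2^-1 by rewrite -y2; field.
  have q1 : 0 <= e * (h - e) * L by rewrite mulr_ge0 ?(ltW L0)// mulr_ge0 ?(ltW e0)//; lra.
  have q2 : 0 <= e * y by rewrite mulr_ge0// ltW.
  rewrite y2; lra.
have V1 : 1 <= V by rewrite -expR0 ler_expR mulr_ge0 ?(ltW L0)// /w divr_ge0//; lra.
set lam' := (1 + a) * _ in lam *.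
have lam'0 : 0 <= lam' by apply: mulr_ge0; [exact: a10|exact: sqrtr_ge0].
have lamE : 4 + 4 * lam' <= E by lra.
have uE : gtail t <= 2 * expR (- ((phi + h) ^+ 2 * L / 2)).
  by apply: (le_trans (gtail_ub t0)); rewrite exprMn y2.
have puV : #|I|%:R * gtail t <= 2 * V ^+ 2.
  rewrite pE; apply: (@le_trans _ _ (expR L * (2 * expR (- ((phi + h) ^+ 2 * L / 2))))).
    by rewrite ler_pM2l ?expR_gt0.
  rewrite mulrCA ler_pM2l// -expRD -expRM_natl ler_expR /w; lra.
have suV : #|[pred j | b j != 0]|%:R * gtail t <= 2 * V.
  apply: (@le_trans _ _ (k * (2 * expR (- ((phi + h) ^+ 2 * L / 2))))).
    by apply: ler_pM => //; exact: nprob_ge0.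
  rewrite mulrCA ler_pM2l// /k -expRD ler_expR bE.
  have : h ^+ 2 * L <= (phi + h) ^+ 2 * L by rewrite ler_pM2r//; nra.
  lra.
pose J := [pred j | D0 * y <= `|b j|].
have D00 : 0 < D0 by rewrite addr_gt0.
have card_sum (A : pred I) : #|A|%:R = \sum_j (A j)%:R :> R.
  rewrite -sum1_card natr_sum [LHS]big_mkcond; apply: eq_bigr => j _.
  by rewrite unfold_in; case: (A j).
have Jk : c * k <= #|J|%:R.
  have h1 j : b j ^+ 2 <= (J j)%:R * (4 * L) + (b j != 0)%:R * (D0 ^+ 2 * L).
    have [->|bj] := eqVneq (b j) 0.
      by rewrite expr0n/= mul0r addr0 mulr_ge0// mulr_ge0// ltW.
    have DL0 : 0 <= D0 ^+ 2 * L by rewrite mulr_ge0 ?sqr_ge0// ltW.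
    have -> : b j ^+ 2 = `|b j| ^+ 2 by rewrite real_normK// num_real.
    rewrite mul1r; have [hb|hb] := leP (D0 * y) `|b j|.
      have -> : (J j)%:R = 1 :> R by rewrite /J /= hb.
      have : `|b j| ^+ 2 <= (2 * y) ^+ 2.
        by rewrite ler_sqr ?nnegrE ?mulr_ge0// ?(ltW y0)//; exact: bmax.
      rewrite exprMn y2; lra.
    have -> : (J j)%:R = 0 :> R by rewrite /J /= leNgt hb.
    rewrite mul0r add0r -y2 -exprMn ler_sqr ?nnegrE ?mulr_ge0 ?(ltW y0) ?(ltW D00)//.
    exact: ltW.
  have h2 : \sum_j b j ^+ 2 <= #|J|%:R * (4 * L) + #|[pred j | b j != 0]|%:R * (D0 ^+ 2 * L).
    by rewrite !card_sum !mulr_suml -big_split/=; apply: ler_sum.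
  have DL : 0 <= D0 ^+ 2 * L by rewrite mulr_ge0 ?sqr_ge0// ltW.
  have h3 := ler_wpM2r DL supp.
  rewrite -(ler_pM2r (_ : 0 < 4 * L)); last by rewrite mulr_gt0.
  have -> : c * k * (4 * L) = D ^+ 2 * k * L - k * (D0 ^+ 2 * L) by rewrite /c; field.
  lra.
have EV : E * V <= \sum_(j | b j != 0) nprob (signal_event t (b j)).
  pose q := normal_peak 1 * expR (- ((s + 1) ^+ 2 / 2)).
  have q0 : 0 <= q by rewrite mulr_ge0 ?expR_ge0// ltW.
  have -> : E * V = c * k * q.
    have Ek : expR Q * V = k * expR (- ((s + 1) ^+ 2 / 2)).
      by rewrite /V /k -!expRD; congr expR; rewrite /Q bE; ring.
    by rewrite /E -mulrA Ek mulrACA.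
  apply: (@le_trans _ _ (#|J|%:R * q)); first by rewrite ler_wpM2r.
  rewrite card_sum mulr_suml [X in _ <= X]big_mkcond; apply: ler_sum => j _.
  have [bj|bj] := boolP (J j); last first.
    by rewrite mul0r; case: ifP => // _; exact: nprob_ge0.
  have bpos : 0 < `|b j| by apply: lt_le_trans bj; rewrite mulr_gt0.
  rewrite -normr_gt0 bpos mul1r; apply: nprob_signal_ge => //; first by rewrite -normr_gt0.
  move: bj; rewrite /J /= /t /s /D0; lra.
have := dense_signal ig V1 lam'0 lamE puV suV EV.
apply: prob_leS => //.
apply: (@le_trans _ _ (E / 48)^-1).
  apply: expR_neg_le_inv; lra.
by rewrite invf_div ler_pM2l// lef_pV2 ?posrE//; lra.
Qed.

End Boundary.

(** * Type II error *)

Section Power.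
Context {R : realType}.

Lemma HC_detects n p (M : gaussian_regression R n p) (theta : 'rV[R]_p)
    (sigma a eps t : R) :
  0 < sigma -> (0 < n)%N -> 0 < a -> 0 < eps -> eps < 1 -> 0 <= t -> gtail t <= 2^-1 ->
  sigtest a (fun j : 'I_p => theta 0 j *
    ((1 - eps) * Num.sqrt n%:R / Num.sqrt (1 + \sum_j theta 0 j ^+ 2))) t ->
  prob_le (reg_law M (sigma *: theta) sigma)
    [set w | ~ (((1 + a) * Num.sqrt (2 * ln (ln p%:R)))%:E <
       HC_stat (\matrix_(i, j) reg_X M i j w) (\col_i reg_Y M i w))%E]
    (expR (- (eps ^+ 2 / 16 * n%:R)) + expR (- (eps ^+ 2 / 8 * n%:R)) + 48 / ln p%:R).
Proof.
move=> s0 n0 a0 e0 e1 t0 t2; set T0 := _ / Num.sqrt (1 + _) => ht.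
have [g ig hg] := regression_signal M theta s0 n0 e0 e1.
have T00 : 0 < T0.
  rewrite /T0 divr_gt0//; first by rewrite mulr_gt0 ?sqrtr_gt0 ?ltr0n// subr_gt0.
  by rewrite sqrtr_gt0 ltr_pwDl// sumr_ge0// => j _; exact: sqr_ge0.
have := ht _ _ _ g ig; rewrite card_ord => htg.
apply: prob_leS (lexx _) (prob_leU hg htg) => w /= hw.
apply: contrapT => /not_orP[/contrapT[T hT hy] /negP]; rewrite -ltNge => hc.
apply: hw; apply: (HC_stat_gt_of_count _ (gtail_gt0 t0) t2).
  by rewrite mulr_ge0 ?sqrtr_ge0// addr_ge0// ltW.
apply: (lt_le_trans hc); apply: (signal_count T00 hT t0) => j.
by rewrite hy mulfK// gt_eqF.
Qed.

Lemma HC_power (a beta D e : R) : 0 < a -> 2^-1 < beta -> beta < 1 ->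
  phi_boundary beta < D -> 0 < e ->
  exists2 rho, 0 < rho & exists N : nat, forall n p (M : gaussian_regression R n p)
    (theta : 'rV[R]_p) (sigma : R) (k := p%:R `^ (1 - beta)),
  (N <= n)%N -> (N <= p)%N -> k * ln p%:R <= rho * n%:R -> 0 < sigma ->
  sparse k theta -> D * Num.sqrt (k * ln p%:R / n%:R) <= l2norm theta ->
  prob_le (reg_law M (sigma *: theta) sigma)
    [set w | ~ (((1 + a) * Num.sqrt (2 * ln (ln p%:R)))%:E <
       HC_stat (\matrix_(i, j) reg_X M i j w) (\col_i reg_Y M i w))%E] e.
Proof.
move=> a0 b2 b1 phiD e0.
have [h [h0 phi0 t2 hE]] := phi_boundary_split b2 b1.
set phi := phi_boundary beta in phiD phi0 t2 hE.
(* The margin is spent twice: from D to D2 = (1 - eps) D on the random factor of the signal, then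
   from D2 to D1 on the factor 1 + |theta|^2, by the choice of rho. *)
pose D1 := (phi + D) / 2; pose D2 := (D1 + D) / 2; pose eps := 1 - D2 / D.
have phiD1 : phi < D1 by rewrite /D1; lra.
have D12 : D1 < D2 by rewrite /D2 /D1; lra.
have D2D : D2 < D by rewrite /D2 /D1; lra.
have D0 : 0 < D by lra.
have D10 : 0 < D1 by lra.
have D20 : 0 < D2 by lra.
have eps0 : 0 < eps by rewrite subr_gt0 ltr_pdivrMr// mul1r.
have eps1 : eps < 1 by rewrite ltrBlDr ltrDl divr_gt0.
have epsE : 1 - eps = D2 / D by rewrite /eps subKr.
pose rho := (D2 ^+ 2 / D1 ^+ 2 - 1) / D ^+ 2.
have rho0 : 0 < rho.
  rewrite divr_gt0 ?exprn_gt0// subr_gt0 ltr_pdivlMr ?exprn_gt0// mul1r.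
  by rewrite ltr_sqr ?nnegrE// ltW.
exists rho => //.
have [L1 hL1] := single_test a0.
have [L2 hL2] := dense_test a0 h0 phi0 t2 hE phiD1.
pose Lm := Num.max 1 (Num.max (96 / e) (Num.max L1 L2)).
pose nm := 48 / (eps ^+ 2 * e).
exists (maxn (Num.truncn (expR Lm)).+1 (Num.truncn nm).+1) => n p M theta sigma k.
rewrite !geq_max => /andP[_ hn] /andP[hp _] kn s0 sp hr.
have {}hp : expR Lm <= p%:R.
  by apply: (le_trans (ltW (truncnS_gt _))); rewrite ler_nat.
have {}hn : nm <= n%:R.
  by apply: (le_trans (ltW (truncnS_gt _))); rewrite ler_nat.
have nm0 : 0 < nm by rewrite divr_gt0// mulr_gt0// exprn_gt0.
have nR0 : 0 < n%:R :> R by exact: lt_le_trans hn.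
have n0 : (0 < n)%N by rewrite -(ltr0n R).
have p0 : 0 < p%:R :> R by apply: lt_le_trans hp; exact: expR_gt0.
set L := ln p%:R in kn hr *.
have : Lm <= L by rewrite -ler_expR lnK.
rewrite /Lm !ge_max => /and4P[L_1 Le LL1 LL2].
have L0 : 0 < L by lra.
have kE : k = expR ((1 - beta) * L) by rewrite /k /powR gt_eqF.
have k0 : 0 < k by rewrite kE expR_gt0.
set S := \sum_j theta 0 j ^+ 2.
have S0 : 0 <= S by apply: sumr_ge0 => j _; exact: sqr_ge0.
have SE : l2norm theta ^+ 2 = S by rewrite sqr_sqrtr.
have kL0 : 0 < k * L by rewrite mulr_gt0.
have hS : D ^+ 2 * (k * L) <= n%:R * S.
  have : (D * Num.sqrt (k * L / n%:R)) ^+ 2 <= l2norm theta ^+ 2.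
    by rewrite ler_sqr ?nnegrE ?mulr_ge0 ?sqrtr_ge0// ltW.
  rewrite SE exprMn sqr_sqrtr; last by rewrite divr_ge0// ltW.
  by rewrite (mulrA _ (k * L)) ler_pdivrMr// [S * _]mulrC.
pose kap := Num.sqrt (1 + S).
have kap2 : kap ^+ 2 = 1 + S by rewrite sqr_sqrtr// addr_ge0.
have S1 : 0 < 1 + S by rewrite ltr_pwDl.
have kap0 : 0 < kap by rewrite sqrtr_gt0.
pose T0 := (1 - eps) * Num.sqrt n%:R / kap.
have T00 : 0 < T0 by rewrite divr_gt0// mulr_gt0 ?sqrtr_gt0// subr_gt0.
pose b j := theta 0 j * T0.
have b_neq0 j : (b j != 0) = (theta 0 j != 0) by rewrite mulf_eq0 (gt_eqF T00) orbF.
have supp : #|[pred j | b j != 0]|%:R <= expR ((1 - beta) * L).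
  by rewrite -kE; apply: le_trans sp; rewrite ler_nat; apply/eq_leq/eq_card => j; rewrite !inE b_neq0.
have energy : D1 ^+ 2 * expR ((1 - beta) * L) * L <= \sum_j b j ^+ 2.
  have -> : \sum_j b j ^+ 2 = (D2 / D) ^+ 2 * (n%:R * S / (1 + S)).
    rewrite /b; under eq_bigr do rewrite exprMn.
    rewrite -mulr_suml -/S /T0 epsE exprMn exprVn kap2 exprMn sqr_sqrtr; last exact: ltW.
    by move: (1 + S)^-1 => q; ring.
  (* The energy n S / (1 + S) saturates for large S. Bounding k L by n S / D^2 for the term 1, and
     by rho n for the term S, covers small and large S together. *)
  rewrite -kE (mulrA _ (n%:R * S)) ler_pdivlMr// -(mulrA (D1 ^+ 2)).
  have h1 : D1 ^+ 2 * (k * L) <= D1 ^+ 2 / D ^+ 2 * (n%:R * S).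
    rewrite -[X in _ <= X]mulrA ler_pM2l ?exprn_gt0// ler_pdivlMl ?exprn_gt0//.
  have h2 : D1 ^+ 2 * (k * L) * S <= D1 ^+ 2 * rho * (n%:R * S).
    by have := ler_wpM2l (sqr_ge0 D1) (ler_wpM2r S0 kn); lra.
  have -> : (D2 / D) ^+ 2 * (n%:R * S) = D1 ^+ 2 / D ^+ 2 * (n%:R * S) + D1 ^+ 2 * rho * (n%:R * S).
    by rewrite /rho; field; rewrite !gt_eqF.
  lra.
have fin (t : R) : 0 <= t -> gtail t <= 2^-1 -> sigtest a b t ->
    prob_le (reg_law M (sigma *: theta) sigma)
    [set w | ~ (((1 + a) * Num.sqrt (2 * ln L))%:E <
       HC_stat (\matrix_(i, j) reg_X M i j w) (\col_i reg_Y M i w))%E] e.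
  move=> t0 tt2 ht; apply: prob_leS (HC_detects M s0 n0 a0 eps0 eps1 t0 tt2 ht) => //.
  have q0 : 0 < eps ^+ 2 * n%:R by rewrite mulr_gt0// exprn_gt0.
  have qe : 48 / (eps ^+ 2 * n%:R) <= e.
    by move: hn; rewrite /nm !ler_pdivrMr ?mulr_gt0 ?exprn_gt0//; lra.
  have q1 : expR (- (eps ^+ 2 / 16 * n%:R)) <= 16 / (eps ^+ 2 * n%:R).
    rewrite -[X in _ <= X]invf_div mulrAC; apply: expR_neg_le_inv.
    by rewrite divr_gt0.
  have q2 : expR (- (eps ^+ 2 / 8 * n%:R)) <= 8 / (eps ^+ 2 * n%:R).
    rewrite -[X in _ <= X]invf_div mulrAC; apply: expR_neg_le_inv.
    by rewrite divr_gt0.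
  have qL : 48 / L <= e / 2 by move: Le; rewrite !ler_pdivrMr//; lra.
  rewrite -/L; lra.
have [[j hj]|nj] := pselect (exists j, 2 * Num.sqrt L <= `|b j|).
  have [||t0 tt2 ht] := hL1 'I_p b j; rewrite ?card_ord//.
  exact: fin t0 tt2 ht.
have [|||j|t0 tt2 ht] := hL2 'I_p b; rewrite ?card_ord//.
  by rewrite leNgt; apply/negP => /ltW hj; apply: nj; exists j.
exact: fin t0 tt2 ht.
Qed.

End Power.

Section TypeTwo.
Context {R : realType}.

Lemma limn_einf_gt0 (v : nat -> R) : (0 < limn_einf (fun m => (v m)%:E))%E ->
  exists2 D, 0 < D & \forall m \near \oo, D <= v m.
Proof.
rewrite limn_einf_lim => lim0.
have [N hN] : exists N, (0 < einfs (fun m => (v m)%:E) N)%E.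
  apply: contrapT => hn; move: lim0; rewrite ltNge => /negP; apply.
  apply: lime_le; first exact: is_cvg_einfs.
  by apply: nearW => N; rewrite leNgt; apply/negP => h; apply: hn; exists N.
have hv m : (N <= m)%N -> (einfs (fun m => (v m)%:E) N <= (v m)%:E)%E.
  by move=> Nm; apply: ereal_inf_lbound; exists m.
have ev_fin : einfs (fun m => (v m)%:E) N \is a fin_num.
  by rewrite ge0_fin_numE ?(ltW hN)// (le_lt_trans (hv N _))// ltry.
exists (fine (einfs (fun m => (v m)%:E) N)); first by apply: fine_gt0; rewrite hN ltey_eq ev_fin.
near=> m; rewrite -lee_fin fineK//; apply: hv; near: m; exact: nbhs_infty_ge.
Unshelve. all: by end_near. Qed.

(** Over an empty class the supremum would be -oo; k >= 1 leaves room for one coordinate of any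
    size. *)
Lemma Theta_sep_nonempty p (k r : R) : (0 < p)%N -> 1 <= k -> exists theta : 'rV[R]_p, Theta_sep k r theta.
Proof.
move=> p0 k1; pose j0 := Ordinal p0.
exists (\row_j if j == j0 then `|r| else 0); split.
  apply: le_trans k1; rewrite -[X in _ <= X]/(1%:R) ler_nat.
  rewrite -[X in (_ <= X)%N](card1 j0); apply: subset_leq_card; apply/fintype.subsetP => j.
  by apply: contraTT; rewrite !inE => /negbTE jj; rewrite mxE jj eqxx.
rewrite /l2norm (bigD1 j0)//= mxE eqxx big1 ?addr0.
  by rewrite sqrtr_sqr normr_id ler_norm.
by move=> j /negbTE jj; rewrite mxE jj expr0n.
Qed.

Lemma beta_un_ge0 n p (M : gaussian_regression R n p) a (Theta : set 'rV[R]_p) :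
  (exists theta, Theta theta) -> (0 <= beta_un M (psi_HC a) Theta)%E.
Proof.
move=> [theta Ht].
apply: (@le_trans _ _ ('E_(reg_law M (1 *: theta) 1)[(fun w => 1 - test_at (psi_HC a) w)%R])%E).
  by apply: expectation_ge0 => w; rewrite subr_ge0; case/andP: (psi_HC_ge0_le1 a w).
apply: ereal_sup_ubound; exists (theta, 1); last by [].
by split => /=; [exact: Ht|exact: ltr01].
Qed.

End TypeTwo.

Theorem proposition4p6 (R : realType)
  (M : forall n p : nat, gaussian_regression R n p)
  (a : R) (a_gt0 : 0 < a)
  (n p : nat -> nat) (n_oo : n @ \oo --> \oo) (p_oo : p @ \oo --> \oo) :
  (alpha_un (M (n m) (p m)) (psi_HC a) @[m --> \oo] --> 0%E)
  /\
  (forall (beta : R) (x : nat -> nat -> R),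
    2^-1 < beta -> beta < 1 ->
    let k := fun m => (p m)%:R `^ (1 - beta) in
    let r := fun m =>
      x (n m) (p m) * Num.sqrt (k m * ln (p m)%:R / (n m)%:R) in
    (fun m => k m * ln (p m)%:R : R^o) =o_\oo (fun m => (n m)%:R : R^o) ->
    (0 < limn_einf (fun m => (x (n m) (p m) - phi_boundary beta)%:E))%E ->
    beta_un (M (n m) (p m)) (psi_HC a) (Theta_sep (k m) (r m))
      @[m --> \oo] --> 0%E).
Proof.
split; first exact: alpha_un_cvg.
move=> beta x b2 b1 k r kn xphi.
have [delta d0 hx] := limn_einf_gt0 xphi.
apply: cvge_to0 => e e0.
have [|rho rho0 [N hN]] := @HC_power R a beta (phi_boundary beta + delta) e a_gt0 b2 b1 _ e0.
  by rewrite ltrDl.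
move/eqoP: kn => /(_ _ rho0) kn.
near=> m.
have hx' : delta <= x (n m) (p m) - phi_boundary beta by near: m; exact: hx.
have nN : (N <= n m)%N by near: m; move/cvgnyPge: n_oo; apply.
have pN : (N <= p m)%N by near: m; move/cvgnyPge: p_oo; apply.
have p1 : (0 < p m)%N by near: m; move/cvgnyPge: p_oo; apply.
have knm : k m * ln (p m)%:R <= rho * (n m)%:R.
  apply: (le_trans (ler_norm _)).
  rewrite -[X in _ <= _ * X]ger0_norm//; near: m; exact: kn.
apply/andP; split.
  apply: beta_un_ge0; apply: Theta_sep_nonempty => //.
  rewrite /k /powR gt_eqF ?ltr0n// -[X in X <= _]expR0 ler_expR.
  by rewrite mulr_ge0 ?ln_ge0 ?ler1n// subr_ge0 ltW.
apply: ge_ereal_sup => _ [[theta sigma] /= [[sp hr] s0] <-].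
have hr' : (phi_boundary beta + delta) * Num.sqrt (k m * ln (p m)%:R / (n m)%:R) <= l2norm theta.
  apply: le_trans hr; rewrite /r ler_wpM2r ?sqrtr_ge0//; lra.
have := hN _ _ (M (n m) (p m)) theta sigma nN pN knm s0 sp hr'.
move=> /expectation_prob_le; apply.
  move=> w; have /andP[h0 h1] := psi_HC_ge0_le1 a w.
  by rewrite subr_ge0 h1 lerBlDr lerDl h0.
move=> w /= /contrapT hw.
by rewrite /test_at /psi_HC hw subrr.
Unshelve. all: by end_near. Qed.
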